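(* Let $(\{X_i\}_{i=1}^n,\{Y_j\}_{j=1}^m)$ be a tracially bi-partite system in a C$^*$-non-commutative probability space $(\mathcal A,\varphi)$. Suppose that for some $0\le p\le n$ and $0\le q\le m$ the pairs \[ (\mathrm{alg}(X_1,\ldots,X_p),\mathrm{alg}(Y_1,\ldots,Y_q))\quad\text{and}\quad(\mathrm{alg}(X_{p+1},\ldots,X_n),\mathrm{alg}(Y_{q+1},\ldots,Y_m)) \] are bi-free with respect to $\varphi$. (a) If the $\limsup_{d\to\infty}$ in the definition of $\chi_R(\,\cdot\,;M,\epsilon)$ is actually a limit (for all $R,\epsilon>0$ and $M\in\mathbb N$) both for the system $(\{X_i\}_{i=1}^p,\{Y_j\}_{j=1}^q)$ and for the system $(\{X_i\}_{i=p+1}^n,\{Y_j\}_{j=q+1}^m)$, then \[ \chi(X_1,\ldots,X_n\sqcup Y_1,\ldots,Y_m)=\chi(X_1,\ldots,X_p\sqcup Y_1,\ldots,Y_q)+\chi(X_{p+1},\ldots,X_n\sqcup Y_{q+1},\ldots,Y_m). \] (b) Alternatively (without the assumption in (a)), for every non-principal ultrafilter $\omega$ on $\mathbb N$, \[ \chi^\omega(X_1,\ldots,X_n\sqcup Y_1,\ldots,Y_m)=\chi^\omega(X_1,\ldots,X_p\sqcup Y_1,\ldots,Y_q)+\chi^\omega(X_{p+1},\ldots,X_n\sqcup Y_{q+1},\ldots,Y_m). \]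
   Context: A C$^*$-non-commutative probability space $(\mathcal A,\varphi)$ is a unital C$^*$-algebra with a state $\varphi$. A tracially bi-partite system $(\{X_i\}_{i=1}^n,\{Y_j\}_{j=1}^m)$ in $(\mathcal A,\varphi)$ consists of self-adjoint operators $X_1,\ldots,X_n$ (left variables) and $Y_1,\ldots,Y_m$ (right variables) in $\mathcal A$ such that every $X_i$ commutes with every $Y_j$ (in distribution: interchanging adjacent $X_i,Y_j$ in a word does not change $\varphi$ of the word) and $\varphi$ is tracial on the unital algebra $\mathrm{alg}(X_1,\ldots,X_n)$ and on $\mathrm{alg}(Y_1,\ldots,Y_m)$; $\varphi$ is not assumed tracial or faithful on $\mathcal A$. Microstate bi-free entropy. $\mathcal M_d$ is the algebra of complex $d\times d$ matrices, $\mathcal M_d^{sa}$ its self-adjoint part, $\mathrm{Tr}_d$ the trace, $\tau_d=\frac1d\mathrm{Tr}_d$, $\|\cdot\|$ the operator norm, and $\lambda_{d,p}$ is Lebesgue measure on $(\mathcal M_d^{sa})^p$ normalized by the inner product $\langle (A_i),(B_i)\rangle=\sum_i\mathrm{Tr}_d(A_iB_i)$. For $M,d\in\mathbb N$ and $R,\epsilon>0$, $\Gamma_R(X_1,\ldots,X_n\sqcup Y_1,\ldots,Y_m;M,d,\epsilon)$ is the set of $(A_1,\ldots,A_n,B_1,\ldots,B_m)\in(\mathcal M_d^{sa})^{n+m}$ with $\|A_i\|,\|B_j\|\le R$ for all $i,j$ and \[ |\varphi(X_{i_1}\cdots X_{i_p}Y_{j_1}\cdots Y_{j_q})-\tau_d(A_{i_1}\cdots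 A_{i_p}B_{j_q}\cdots B_{j_1})|<\epsilon \] for all $p,q\ge0$ with $1\le p+q\le M$ and all indices $i_1,\ldots,i_p\in\{1,\ldots,n\}$, $j_1,\ldots,j_q\in\{1,\ldots,m\}$. Define (with $\log 0=-\infty$) $\chi_R(\cdot;M,d,\epsilon)=\log\lambda_{d,n+m}(\Gamma_R(\cdot;M,d,\epsilon))$, $\chi_R(\cdot;M,\epsilon)=\limsup_{d\to\infty}\big(\frac1{d^2}\chi_R(\cdot;M,d,\epsilon)+\frac{n+m}2\log d\big)$, $\chi_R(\cdot)=\inf_{M\in\mathbb N,\epsilon>0}\chi_R(\cdot;M,\epsilon)$, and $\chi(X_1,\ldots,X_n\sqcup Y_1,\ldots,Y_m)=\sup_{R>0}\chi_R(X_1,\ldots,X_n\sqcup Y_1,\ldots,Y_m)\in[-\infty,\infty)$. The entropy of an empty family is $0$. The quantity $\chi^\omega$ is defined in the same way, with $\limsup_{d\to\infty}$ replaced by the limit along the non-principal ultrafilter $\omega$. Bi-freeness. Given vector spaces with specified state vectors $(\mathcal X_k,\mathcal X_k^\circ,\xi_k)$, $\mathcal X_k=\mathbb C\xi_k\oplus\mathcal X_k^\circ$, their free product is $\mathcal X=\mathbb C\xi\oplus\bigoplus_{r\ge1}\bigoplus_{k_1\ne k_2\ne\cdots\ne k_r}\mathcal X_{k_1}^\circ\otimes\cdots\otimes\mathcal X_{k_r}^\circ$. Let $\mathcal X(\ell,k)$ (resp. $\mathcal X(r,k)$) be the span of $\xi$ and the summands with first index (resp. last index) $\neq k$. Using the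 canonical isomorphisms $V_k:\mathcal X_k\otimes\mathcal X(\ell,k)\to\mathcal X$ and $W_k:\mathcal X(r,k)\otimes\mathcal X_k\to\mathcal X$, put $\lambda_k(T)=V_k(T\otimes I)V_k^{-1}$ and $\rho_k(T)=W_k(I\otimes T)W_k^{-1}$ for linear maps $T$ on $\mathcal X_k$. Pairs $(C_k,D_k)_{k\in K}$ of unital subalgebras of $\mathcal A$ (left face, right face) are bi-free with respect to $\varphi$ if there exist such $\mathcal X_k$ and unital homomorphisms $l_k:C_k\to L(\mathcal X_k)$, $r_k:D_k\to L(\mathcal X_k)$ such that for every word $z_1\cdots z_N$ in elements of the $C_k$'s and $D_k$'s, $\varphi(z_1\cdots z_N)$ equals the $\xi$-coefficient of $T_1\cdots T_N\xi$, where $T_i=\lambda_k(l_k(z_i))$ if $z_i$ is taken from $C_k$ and $T_i=\rho_k(r_k(z_i))$ if $z_i$ is taken from $D_k$. *)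

(* Defs.v *)
From mathcomp Require Import all_boot all_order all_algebra.
From mathcomp Require Import all_classical all_reals all_analysis.
From mathcomp Require Import complex.

Set Implicit Arguments.
Unset Strict Implicit.
Unset Printing Implicit Defensive.

Import Order.TTheory GRing.Theory Num.Theory numFieldNormedType.Exports.
Local Open Scope classical_set_scope.
Local Open Scope ring_scope.
Local Open Scope complex_scope.
Local Open Scope sesquilinear_scope.

(* Unital C*-algebras. The norm is real-valued rather than R[i]-valued, hence
   not the library's norm on a normed module over R[i]. *)
Record cstarAlg (R : realType) := CstarAlg {
  cstar_sort :> algType R[i] ;
  cnorm : cstar_sort -> R ;
  star : cstar_sort -> cstar_sort ;
  cnorm0_eq0 : forall x, cnorm x = 0 -> x = 0 ;
  cnormD : forall x y, cnorm (x + y) <= cnorm x + cnorm y ;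
  cnormZ : forall (a : R[i]) x, (cnorm (a *: x))%:C = `|a| * (cnorm x)%:C ;
  cnormM : forall x y, cnorm (x * y) <= cnorm x * cnorm y ;
  cnorm_complete : forall u : nat -> cstar_sort,
    (forall e : R, 0 < e ->
       \forall i & j \near \oo, cnorm (u i - u j) < e) ->
    exists l, (fun i => cnorm (u i - l)) @ \oo --> (0 : R) ;
  starK : involutive star ;
  starD : forall x y, star (x + y) = star x + star y ;
  starZ : forall (a : R[i]) x, star (a *: x) = conjc a *: star x ;
  starM : forall x y, star (x * y) = star y * star x ;
  cstar_identity : forall x, cnorm (star x * x) = cnorm x ^+ 2
}.

Section NoncommutativeProbability.
Variables (R : realType) (A : cstarAlg R).

(* [0 <= z] in [R[i]] says that z is real and nonnegative. *)
Definition is_state (phi : {scalar A}) : Prop :=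
  (forall x : A, 0 <= phi (star x * x)) /\ phi 1 = 1.

Definition unital_subalgebra (S : set A) : Prop :=
  [/\ S 1,
      forall (a : R[i]) x y, S x -> S y -> S (a *: x + y) &
      forall x y, S x -> S y -> S (x * y)].

Definition alg_gen (J : Type) (X : J -> A) : set A :=
  smallest unital_subalgebra (range X).

Definition tracial_on (phi : {scalar A}) (S : set A) : Prop :=
  forall x y, S x -> S y -> phi (x * y) = phi (y * x).

Definition bipartite (phi : {scalar A}) (n m : nat)
    (X : 'I_n -> A) (Y : 'I_m -> A) : Prop :=
  let Z (s : 'I_n + 'I_m) := match s with inl i => X i | inr j => Y j end in
  forall (u v : seq ('I_n + 'I_m)) (i : 'I_n) (j : 'I_m),
    phi (\prod_(s <- u) Z s * (X i * Y j) * \prod_(s <- v) Z s) =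
    phi (\prod_(s <- u) Z s * (Y j * X i) * \prod_(s <- v) Z s).

Definition tracially_bipartite (phi : {scalar A}) (n m : nat)
    (X : 'I_n -> A) (Y : 'I_m -> A) : Prop :=
  [/\ forall i, star (X i) = X i,
      forall j, star (Y j) = Y j,
      bipartite phi X Y,
      tracial_on phi (alg_gen X) &
      tracial_on phi (alg_gen Y)].

End NoncommutativeProbability.

(* For X_k = K xi_k (+) E_k we take the external direct sum [K^o * E k], with
   xi_k = (1, 0). An elementary tensor x_1 (x) ... (x) x_r, with x_i in E_{k_i},
   is encoded by the word of the tagged vectors x_i; xi is the empty word. *)
Section FreeProduct.
Variables (K : fieldType) (I : eqType) (E : I -> lmodType K).

Let word := seq {k : I & E k}.

Definition indices (w : word) : seq I := [seq tag a | a <- w].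

Definition alternating (ks : seq I) : bool := sorted (fun i j => i != j) ks.

Definition word_multilinear (G : lmodType K) (f : word -> G) : Prop :=
  forall (u v : word) (k : I) (a : K) (x y : E k),
    alternating (indices u ++ k :: indices v) ->
    f (u ++ Tagged E (a *: x + y) :: v) =
    a *: f (u ++ Tagged E x :: v) + f (u ++ Tagged E y :: v).

(* The direct sum K xi (+) (+)_{k_1 != ... != k_r} E_{k_1} (x) ... (x) E_{k_r},
   given by its elementary tensors and the universal property of (direct sums
   of) tensor products. Values of [fp_tens] on non-alternating words are
   irrelevant. *)
Record free_product := FreeProduct {
  fp_space :> lmodType K ;
  fp_tens : word -> fp_space ;
  fp_multilinear : word_multilinear fp_tens ;
  fp_universal : forall (G : lmodType K) (f : word -> G), word_multilinear f ->
    exists g : {linear fp_space -> G},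
      (forall w, alternating (indices w) -> g (fp_tens w) = f w) /\
      (forall h : {linear fp_space -> G},
         (forall w, alternating (indices w) -> h (fp_tens w) = f w) -> h =1 g)
}.

Variable F : free_product.

(* V_k (x (x) w) and W_k (w (x) x) for x in X_k and w an elementary tensor. *)
Definition fp_V (k : I) (x : K^o * E k) (w : word) : F :=
  x.1 *: fp_tens F w + fp_tens F (Tagged E x.2 :: w).
Definition fp_W (k : I) (w : word) (x : K^o * E k) : F :=
  x.1 *: fp_tens F w + fp_tens F (rcons w (Tagged E x.2)).

(* L = V_k (T (x) 1) V_k^-1, i.e. L V_k = V_k (T (x) 1) on X_k (x) X(l,k), which
   is spanned by the x (x) w with w alternating of first index <> k. *)
Definition is_left_action (k : I)
    (T : {linear (K^o * E k)%type -> (K^o * E k)%type})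
    (L : {linear F -> F}) : Prop :=
  forall (x : K^o * E k) (w : word), alternating (k :: indices w) ->
    L (fp_V x w) = fp_V (T x) w.

Definition is_right_action (k : I)
    (T : {linear (K^o * E k)%type -> (K^o * E k)%type})
    (L : {linear F -> F}) : Prop :=
  forall (x : K^o * E k) (w : word), alternating (rcons (indices w) k) ->
    L (fp_W w x) = fp_W w (T x).

Definition is_xi_coefficient (c : {scalar F}) : Prop :=
  forall w, alternating (indices w) -> c (fp_tens F w) = (w == [::])%:R.

End FreeProduct.

Section BiFree.
Variables (R : realType) (A : cstarAlg R).

Definition unital_hom_on (S : set A) (V : lmodType R[i])
    (l : A -> {linear V -> V}) : Prop :=
  [/\ l 1 =1 id,
      forall (a : R[i]) x y, S x -> S y ->
        l (a *: x + y) =1 (fun v => a *: l x v + l y v) &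
      forall x y, S x -> S y -> l (x * y) =1 l x \o l y].

(* A letter of a word, tagged by the face it is taken from. *)
Inductive letter (I : Type) := Left of I & A | Right of I & A.

Definition letter_val (I : Type) (z : letter I) : A :=
  match z with Left _ a => a | Right _ a => a end.

Definition letter_in (I : Type) (C D : I -> set A) (z : letter I) : Prop :=
  match z with Left k a => C k a | Right k a => D k a end.

Definition bi_free (phi : {scalar A}) (I : eqType) (C D : I -> set A) : Prop :=
  exists (E : I -> lmodType R[i]) (F : free_product E)
    (l r : forall k, A -> {linear (R[i]^o * E k)%type -> (R[i]^o * E k)%type})
    (lambda rho : forall k,
      {linear (R[i]^o * E k)%type -> (R[i]^o * E k)%type} -> {linear F -> F})
    (coef : {scalar F}),
  [/\ forall k, unital_hom_on (C k) (l k) /\ unital_hom_on (D k) (r k),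
      forall k T, is_left_action T (lambda k T),
      forall k T, is_right_action T (rho k T),
      is_xi_coefficient coef &
      forall zs : seq (letter I),
        (forall i : 'I_(size zs), letter_in C D (tnth (in_tuple zs) i)) ->
        let T (z : letter I) : {linear F -> F} :=
          match z with
          | Left k a => lambda k (l k a)
          | Right k a => rho k (r k a)
          end in
        phi (\prod_(z <- zs) letter_val z) =
        coef (foldr (fun z v => T z v) (fp_tens F [::]) zs)].

End BiFree.

Section LebesgueMeasure.
Variable R : realType.

(* The n-fold product of the Lebesgue measure of R, by Tonelli's formula. *)
Fixpoint lebesgue_tuple (n : nat) : set (n.-tuple R) -> \bar R :=
  match n with
  | 0%N => fun S => \d_([tuple] : 0.-tuple R) S
  | n'.+1 => fun S =>
      (\int[@lebesgue_measure R]_x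
         lebesgue_tuple [set t : n'.-tuple R | S [tuple of x :: t]])%E
  end.

Definition lebesgue_fin (J : finType) (S : set (J -> R)) : \bar R :=
  lebesgue_tuple [set t : #|J|.-tuple R | S (fun j => tnth t (enum_rank j))].

(* An isometry from Euclidean space R^(d^2) onto the self-adjoint matrices with
   inner product Tr(AB). *)
Definition herm (d : nat) (u : 'I_d -> 'I_d -> R) : 'M[R[i]]_d :=
  \matrix_(k, l)
    if k == l then (u k k)%:C
    else if (k < l)%N then (Num.sqrt 2)^-1%:C * (u k l +i* u l k)
    else (Num.sqrt 2)^-1%:C * (u l k -i* u k l).

(* lambda_{d,p} on subsets of (M_d^sa)^J, where #|J| = p. *)
Definition lebesgue_sa (J : finType) (d : nat) (S : set (J -> 'M[R[i]]_d)) :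
    \bar R :=
  lebesgue_fin
    [set u : J * 'I_d * 'I_d -> R | S (fun s => herm (fun k l => u (s, k, l)))].

Definition l2norm (d : nat) (v : 'cV[R[i]]_d) : R :=
  Num.sqrt (\sum_k Normc.normc (v k 0) ^+ 2).

Definition opnorm (d : nat) (B : 'M[R[i]]_d) : R :=
  sup [set l2norm (B *m v) | v in [set v : 'cV_d | l2norm v <= 1]].

End LebesgueMeasure.

Section Entropy.
Variables (R : realType) (A : cstarAlg R) (phi : {scalar A}).
Variables (n m : nat) (X : 'I_n -> A) (Y : 'I_m -> A).

(* Gamma_r(X |_| Y; M, d, e). *)
Definition microstates (r : R) (M d : nat) (e : R) :
    set ('I_n + 'I_m -> 'M[R[i]]_d) :=
  [set B | [/\ forall s, (B s) ^t* = B s,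
               forall s, opnorm (B s) <= r &
               forall (i : seq 'I_n) (j : seq 'I_m),
                 (1 <= size i + size j <= M)%N ->
                 `|phi (\prod_(a <- i) X a * \prod_(b <- j) Y b) -
                   \tr (\prod_(a <- i) B (inl a) *
                        \prod_(b <- rev j) B (inr b)) / d%:R| < e%:C]].

Arguments microstates : clear implicits.

Definition chi_d (r : R) (M d : nat) (e : R) : \bar R :=
  lne (lebesgue_sa (microstates r M d e)).

Definition chi_seq (r : R) (M : nat) (e : R) (d : nat) : \bar R :=
  ((d%:R ^- 2)%:E * chi_d r M d e + ((n + m)%:R / 2 * ln d%:R)%:E)%E.

(* The entropy for a notion [limd] of limit as d tends to infinity. For
   n = m = 0 the set of microstates is the one-point space (M_d^sa)^0, of
   measure 1, so that the entropy is 0. *)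
Definition chi_of (limd : (nat -> \bar R) -> \bar R) : \bar R :=
  ereal_sup
    [set ereal_inf [set limd (chi_seq r Me.1 Me.2) |
                      Me in [set Me : nat * R | (0 < Me.1)%N /\ 0 < Me.2]] |
       r in [set r : R | 0 < r]].

Definition chi : \bar R := chi_of (@limn_esup R).

Definition chi_ultra (w : set_system nat) : \bar R :=
  chi_of (fun u => lim (u @ w)).

Definition chi_limsup_is_lim : Prop :=
  forall (r : R) (M : nat) (e : R), 0 < r -> (0 < M)%N -> 0 < e ->
    cvgn (chi_seq r M e).

End Entropy.

(* (x_1, ..., x_p) and (x_{p+1}, ..., x_n) *)
Definition first_part (T : Type) (n p : nat) (hp : (p <= n)%N) (x : 'I_n -> T) :
  'I_p -> T := fun i => x (widen_ord hp i).
Definition last_part (T : Type) (n p : nat) (hp : (p <= n)%N) (x : 'I_n -> T) :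
  'I_(n - p) -> T := fun i => x (cast_ord (subnKC hp) (rshift p i)).

(* Main.v *)
Require Import Defs.
From HB Require Import structures.
From mathcomp Require Import all_boot all_order all_fingroup all_algebra.
From mathcomp Require Import all_classical all_reals all_analysis.
From mathcomp Require Import measurable_realfun normal_distribution complex zify ring lra.
Set Implicit Arguments.
Unset Strict Implicit.
Unset Printing Implicit Defensive.
Import Order.TTheory GRing.Theory Num.Theory numFieldNormedType.Exports.
Local Open Scope classical_set_scope.
Local Open Scope ring_scope.
Local Open Scope complex_scope.

(* The microstates of the whole system lie in the product of the microstate sets
   of the two parts, which gives the upper bound. For the lower bound one shows
   that for narrow neighbourhoods of the two marginal moment families at least
   half of the volume of the product consists of joint microstates, once d is
   large. The product set is invariant under conjugating the matrices of one
   part by a unitary, and so is the uniform probability on it. Differentiating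
   this invariance along one-parameter families of unitaries and summing over
   matrix units yields loop equations; they imply, by induction on the length,
   that normalized traces of alternating centred words tend to 0 in L^2 as d
   tends to infinity. Bi-freeness implies that phi vanishes on the
   alternating centred words obtained by reading the right variables in reversed
   order, so all joint moments converge in L^2, and Chebyshev's inequality
   concludes. *)

(** * Lebesgue measure on tuples *)

(** Microstates only see words in which left letters precede right ones. Read with the right letters
    reversed, such words behave under bi-freeness like words in two free families, and the class is
    closed under subwords, so that centring and expanding never leaves it. Asymptotic freeness of
    the two colours is therefore what has to be shown. It is usually obtained by averaging over Haar
    unitaries and concentration of measure. Here no integral over the unitary group occurs:
    conjugation is a linear isometry, so Lebesgue measure itself carries the symmetry; this requires
    the volume formula for linear maps, and sets that are measurable and of finite volume. Testing
    the invariance with a trace times the conjugate of the normalised trace of the same word yields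
    second moments directly, the additional term being smaller by a factor [d ^ 2]. Losing half of
    the volume costs [ln 2 / d ^ 2] after normalisation, which vanishes in the limit. Convergence of
    the marginal sequences serves to make upper limits additive, and along an ultrafilter it is
    automatic; so both claims are instances of one statement about upper limits along a filter on
    the dimensions. *)

Section ConsMeasure.
Variable R : realType.
Local Notation mT := (measurableTypeR R).
Local Notation mu := (@lebesgue_measure R).

Definition consp n (p : mT * n.-tuple mT) : n.+1.-tuple mT := [tuple of p.1 :: p.2].

Lemma measurable_consp n : measurable_fun setT (@consp n).
Proof. by apply: measurable_cons; [exact: measurable_fst|exact: measurable_snd]. Qed.

Section ext.
Variables (n : nat) (m : {sigma_finite_measure set (n.-tuple mT) -> \bar R}).

Definition consm : set (n.+1.-tuple mT) -> \bar R := pushforward (mu \x m)%E (@consp n).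

Let pm : {measure set _ -> \bar R} :=
  measure_function_pushforward__canonical__measure_function_Measure
    (mu \x m)%E (@measurable_consp n).
Let consm0 : consm set0 = 0%E. Proof. exact: (measure0 pm). Qed.
Let consm_ge0 S : (0 <= consm S)%E. Proof. exact: (measure_ge0 pm). Qed.
Let consm_sa : semi_sigma_additive consm.
Proof. exact: (@measure_semi_sigma_additive _ _ _ pm). Qed.
HB.instance Definition _ := isMeasure.Build _ _ _ consm consm0 consm_ge0 consm_sa.

Definition unconsp (t : n.+1.-tuple mT) : mT * n.-tuple mT := (thead t, [tuple of behead t]).

Lemma measurable_unconsp : measurable_fun setT unconsp.
Proof.
apply: measurable_fun_pair; first exact: (@measurable_tnth _ mT n.+1 ord0).
exact: measurable_behead.
Qed.

Lemma conspK : cancel (@consp n) unconsp.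
Proof. by move=> [x t]; rewrite /unconsp theadE; congr pair; apply: val_inj. Qed.

Let consm_sigma_finite : sigma_finite setT consm.
Proof.
have /sigma_finiteP[F [TF ndF Foo]] := sigma_finiteT mu.
have /sigma_finiteP[G [TG ndG Goo]] := sigma_finiteT m.
exists (fun k => unconsp @^-1` (F k `*` G k)).
  rewrite -preimage_bigcup (_ : \bigcup_k _ = setT) ?preimage_setT //.
  rewrite -setXTT TF TG predeqE => -[x y]; split.
    by move=> [k _ []/= ? ?]; split; exists k.
  move=> [/= [k _ Fnx] [l _ Gky]]; exists (maxn k l) => //; split.
  - by move: x Fnx; exact/subsetPset/ndF/leq_maxl.
  - by move: y Gky; exact/subsetPset/ndG/leq_maxr.
move=> k; have [? ?] := Foo k; have [? ?] := Goo k.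
have mFG : measurable (F k `*` G k) by exact: measurableX.
split; first by rewrite -[_ @^-1` _]setTI; exact: measurable_unconsp.
rewrite /consm /pushforward -comp_preimage (_ : _ \o _ = id); last exact/funext/conspK.
by rewrite preimage_id product_measure1E// lte_mul_pinfty// ge0_fin_numE.
Qed.
HB.instance Definition _ := Measure_isSigmaFinite.Build _ _ _ consm consm_sigma_finite.
End ext.

(** [lebesgue_tuple] is only a set function given by iterated integrals. [leb] is its counterpart
    with the structure of a sigma-finite measure, so that uniqueness and Tonelli arguments apply;
    the two agree on measurable sets. *)
Fixpoint leb n : {sigma_finite_measure set (n.-tuple mT) -> \bar R} :=
  match n with
  | 0%N => \d_([tuple] : 0.-tuple mT)
  | n'.+1 => consm (leb n')
  end.

Lemma lebesgue_tupleE n (S : set (n.-tuple mT)) : measurable S -> lebesgue_tuple S = leb n S.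
Proof.
elim: n S => [//|n IH] S mS /=.
rewrite /consm /pushforward /product_measure1; apply: eq_integral => x _ /=.
rewrite IH.
  congr (leb n _); apply/seteqP; split => t; rewrite /xsection /=; rewrite ?inE ?mem_set //=.
rewrite (_ : [set _ | _] = xsection (@consp n @^-1` S) x); last first.
  apply/seteqP; split => t; rewrite /xsection /=; rewrite ?inE ?mem_set //=.
apply: measurable_xsection; rewrite -[_ @^-1` _]setTI; exact: measurable_consp.
Qed.
End ConsMeasure.

Section Boxes.
Variable R : realType.
Local Notation mT := (measurableTypeR R).
Local Notation mu := (@lebesgue_measure R).

Definition box n (F : 'I_n -> set mT) : set (n.-tuple mT) :=
  [set t | forall i, F i (tnth t i)].

Lemma measurable_box n (F : 'I_n -> set mT) :
  (forall i, measurable (F i)) -> measurable (box F).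
Proof.
move=> mF; rewrite (_ : box F = \bigcap_(i in [set: 'I_n]) (fun t => tnth t i) @^-1` F i).
  apply: fin_bigcap_measurable => // i _; rewrite -[_ @^-1` _]setTI.
  exact: measurable_tnth.
by apply/seteqP; split => t /= tF i; [move=> _|]; exact: tF.
Qed.

Lemma leb_box n (F : 'I_n -> set mT) : (forall i, measurable (F i)) ->
  leb R n (box F) = \big[mule/1%E]_(i < n) mu (F i).
Proof.
elim: n F => [|n IH] F mF; first by rewrite big_ord0 /= diracE mem_set// => -[].
rewrite big_ord_recl /= /consm /pushforward.
rewrite (_ : _ @^-1` _ = F ord0 `*` box (F \o lift ord0)); last first.
  apply/seteqP; split => -[x t] /=.
    move=> tF; split; first by have := tF ord0; rewrite tnth0.
    by move=> i /=; have := tF (lift ord0 i); rewrite tnthS.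
  move=> [Fx Ft] i; have [j ->|->] := unliftP ord0 i; last by rewrite tnth0.
  by rewrite tnthS; exact: Ft.
rewrite product_measure1E; last 2 first.
- exact: mF.
- by apply: measurable_box => i; exact: mF.
by rewrite IH // => i; exact: mF.
Qed.

(** Boxes form a pi-system generating the product sigma-algebra, and the cubes with sides []-k, k]]
    exhaust the space with finite measure. Permutation invariance and the product formula are both
    reduced to boxes in this way. *)
Lemma leb_unique n (m : {measure set (n.-tuple mT) -> \bar R}) :
  (forall F, (forall i, measurable (F i)) -> m (box F) = \big[mule/1%E]_(i < n) mu (F i)) ->
  forall S, measurable S -> m S = leb R n S.
Proof.
move=> mbox S mS; apply/esym.
pose C : set (set (n.-tuple mT)) := [set box F | F in [set F | forall i, measurable (F i)]].
have CC : C `<=` measurable by move=> _ [F mF <-]; exact: measurable_box.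
apply: (@measure_unique _ R (n.-tuple mT) C (fun k => box (fun=> `]- k%:R, k%:R]%classic)) _ _ _ _ (leb R n) m) => //.
- apply/seteqP; split; last first.
    by apply: smallest_sub; first exact: sigma_algebra_measurable.
  apply: smallest_sub; first exact: smallest_sigma_algebra.
  (* A cylinder over one coordinate is the box whose other sides are the whole line; dimension 0 is
     apart because [inord] needs a nonempty index type. *)
  case: n @C CC {m mbox S mS} => [|n] C CC; first by rewrite big_ord0.
  rewrite -bigcup_mkord_ord; apply: bigcup_sub => i Ii A [B mB <-].
  apply: sub_sigma_algebra; exists (fun j => if j == inord i then B else setT).
    by move=> j /=; case: ifP.
  rewrite setTI; apply/seteqP; split => t /=; first by move=> /(_ (inord i)); rewrite eqxx.
  by move=> Bt j; case: eqP => // ->.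
- move=> _ _ [F mF <-] [G mG <-]; exists (fun i => F i `&` G i).
    by move=> i; exact: measurableI.
  apply/seteqP; split => t /=; first by move=> h; split => i; have [] := h i.
  by move=> [h1 h2] i; split; [exact: h1|exact: h2].
- by move=> k /=; exists (fun=> `]- k%:R, k%:R]%classic).
- apply/seteqP; split => // t _.
  have [k kt] : exists k : nat, \sum_i `|tnth t i| < k%:R.
    by exists (Num.bound (\sum_i `|tnth t i|)); rewrite archi_boundP // sumr_ge0.
  exists k => // i /=; rewrite in_itv /=.
  have := le_lt_trans _ kt; move=> /(_ `|tnth t i|).
  rewrite (bigD1 i) //= lerDl sumr_ge0 // => /(_ isT).
  by rewrite ltr_norml => /andP[-> /ltW ->].
- by move=> _ [F mF <-]; rewrite mbox //; exact: leb_box.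
move=> k; apply: (@le_lt_trans _ _ (leb R n (box (fun=> `]- k%:R, k%:R]%classic)))); first exact: lexx.
rewrite leb_box //.
have : (0 <= \big[mule/1%E]_(i < n) mu (`](- k%:R)%R, (k%:R)%R]%classic) < +oo)%E; last by case/andP.
apply: (big_ind (fun x : \bar R => 0 <= x < +oo)%E) => [|x y /andP[x0 xoo] /andP[y0 yoo]|i _].
- by rewrite lee01 ltry.
- by rewrite mule_ge0 // lte_mul_pinfty // ge0_fin_numE.
- by rewrite measure_ge0 lebesgue_measure_itv /=; case: ifP => _; rewrite ?ltry.
Qed.

Lemma leb_perm n (s : 'S_n) S : measurable S ->
  leb R n ((fun t => [tuple tnth t (s i) | i < n]) @^-1` S) = leb R n S.
Proof.
have mf : measurable_fun setT (fun t : n.-tuple mT => [tuple tnth t (s i) | i < n]).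
  apply/measurable_fun_tnthP => i.
  rewrite (_ : _ \o _ = (fun t => tnth t (s i))); first exact: measurable_tnth.
  by apply/funext => t /=; rewrite tnth_mktuple.
pose m : {measure set (n.-tuple mT) -> \bar R} :=
  measure_function_pushforward__canonical__measure_function_Measure (leb R n) mf.
apply: (@leb_unique _ m) => F mF; rewrite /m /= /pushforward.
rewrite (_ : _ @^-1` _ = box (fun i => F ((s^-1)%g i))); last first.
  apply/seteqP; split => t /= tF i; have := tF ((s^-1)%g i); have := tF (s i);
  by rewrite ?tnth_mktuple ?permKV ?permK.
by rewrite leb_box // (reindex_perm s) /=; apply: eq_bigr => i _; rewrite permK.
Qed.
End Boxes.

(** * Linear changes of variables *)

Section Linear.
Variable R : realType.
Local Notation mT := (measurableTypeR R).
Local Notation mu := (@lebesgue_measure R).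

Lemma measurable_affine (a b : R) : measurable_fun setT (fun x : mT => a * x + b : mT).
Proof. by apply: measurable_funD => //; apply: measurable_funM. Qed.

(** Uniqueness of Lebesgue measure from its values on half-open intervals. A negative slope
    exchanges the open and the closed end of []x, y]], hence the two computations. *)
Lemma lebesgue_measure_affine (a b : R) (S : set mT) : a != 0 -> measurable S ->
  mu ((fun x => a * x + b) @^-1` S) = (`|a|^-1%:E * mu S)%E.
Proof.
move=> a0 mS; have na : 0 < `|a| by rewrite normr_gt0.
pose m : {measure set mT -> \bar R} := mscale (NngNum (ltW na))
  (measure_function_pushforward__canonical__measure_function_Measure mu (measurable_affine a b)).
suff E : mu S = m S.
  by rewrite E /m /= /mscale /= /pushforward muleA -EFinM mulVf ?mul1e // gt_eqF.
apply: lebesgue_measure_unique => // _ [[x y] _ <-] /=.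
change (mu `]x, y]%classic = (`|a|%:E * mu ((fun t : mT => (a * t + b)%R) @^-1` `]x, y]%classic))%E).
rewrite lebesgue_measure_itv /= lte_fin.
have [a_gt0|a_lt0|a00] := ltgtP a 0; last by rewrite a00 eqxx in a0.
- rewrite (_ : _ @^-1` _ = `[(y - b) / a, (x - b) / a[%classic); last first.
    apply/seteqP; split => t /=; rewrite !in_itv /= ler_ndivrMr // ltr_ndivlMr //;
    by move=> /andP[h1 h2]; apply/andP; split; lra.
  rewrite lebesgue_measure_itv /= lte_fin ltr_nM2r ?invr_lt0 // ltrD2r.
  case: ifP => _; last by rewrite mule0.
  by rewrite -!EFinD -EFinM ltr0_norm //; congr EFin; field.
- rewrite (_ : _ @^-1` _ = `](x - b) / a, (y - b) / a]%classic); last first.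
    apply/seteqP; split => t /=; rewrite !in_itv /= ler_pdivlMr // ltr_pdivrMr //;
    by move=> /andP[h1 h2]; apply/andP; split; lra.
  rewrite lebesgue_measure_itv /= lte_fin ltr_pM2r ?invr_gt0 // ltrD2r.
  case: ifP => _; last by rewrite mule0.
  by rewrite -!EFinD -EFinM gtr0_norm //; congr EFin; field.
Qed.

Lemma ge0_integral_affine (a b : R) (f : mT -> \bar R) : a != 0 ->
  measurable_fun setT f -> (forall x, 0 <= f x)%E ->
  (\int[mu]_x f (a * x + b)%R = `|a|^-1%:E * \int[mu]_x f x)%E.
Proof.
move=> a0 mf f0; have na : 0 <= `|a|^-1 by rewrite invr_ge0.
have := @ge0_integral_pushforward _ _ _ _ R _ (measurable_affine a b) mu setT f measurableT mf (fun y _ => f0 y).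
rewrite preimage_setT /= => <-.
rewrite -(@ge0_integral_mscale _ _ _ mu _ measurableT (NngNum na) f mf (fun x _ => f0 x)).
apply: eq_measure_integral => [|mf1 A mA _]; first exact: measurable_affine.
exact: (lebesgue_measure_affine b a0 mA).
Qed.

Definition mapM n (M : 'M[R]_n) (b : 'I_n -> R) (t : n.-tuple R) : n.-tuple R :=
  [tuple \sum_j M i j * tnth t j + b i | i < n].

Lemma measurable_mapM n (M : 'M[R]_n) b :
  measurable_fun setT (mapM M b : n.-tuple mT -> n.-tuple mT).
Proof.
apply/measurable_fun_tnthP => i.
rewrite (_ : _ \o _ = fun t => \sum_j M i j * tnth t j + b i); last first.
  by apply/funext => t /=; rewrite tnth_mktuple.
apply: measurable_funD => //; apply: measurable_sum => j.
by apply: measurable_funM => //; exact: measurable_tnth.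
Qed.

(** Tonelli in the first coordinate: for a lower triangular [M] this coordinate enters the others
    only as a translation. The shift [b] is in the statement so that the induction hypothesis
    absorbs that translation. *)
Lemma leb_trig n (M : 'M[R]_n) b S : is_trig_mx M -> \det M != 0 -> measurable S ->
  leb R n (mapM M b @^-1` S) = (`|\det M|^-1%:E * leb R n S)%E.
Proof.
elim: n M b S => [|n IH] M b S tM dM mS.
  rewrite det_mx00 normr1 invr1 mul1e; congr (leb R 0 _).
  by apply/seteqP; split => t /=; rewrite [mapM _ _ _]tuple0 [t]tuple0.
pose M' := \matrix_(i, j) M (lift ord0 i) (lift ord0 j).
have tM' : is_trig_mx M'.
  by apply/is_trig_mxP => i j ij; rewrite mxE; apply: (is_trig_mxP tM); rewrite /= /bump.
have dE : \det M = M ord0 ord0 * \det M'.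
  by rewrite !det_trig // big_ord_recl; congr (_ * _); apply: eq_bigr => i _; rewrite mxE.
move: (dM); rewrite dE mulf_eq0 negb_or => /andP[a0 dM'].
have mS' : measurable (@consp R n @^-1` S).
  by rewrite -[_ @^-1` _]setTI; exact: measurable_consp.
transitivity (\int[mu]_x (`|\det M'|^-1%:E *
    leb R n (xsection (@consp R n @^-1` S) (M ord0 ord0 * x + b ord0)%R)))%E.
  rewrite /= /consm /pushforward /product_measure1; apply: eq_integral => x _ /=.
  rewrite -(IH M' (fun i => M (lift ord0 i) ord0 * x + b (lift ord0 i))) //; last first.
    exact: measurable_xsection.
  congr (leb R n _); apply/seteqP.
  suff E t : mapM M b (consp (x, t)) = consp (M ord0 ord0 * x + b ord0,
     mapM M' (fun i => M (lift ord0 i) ord0 * x + b (lift ord0 i)) t).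
    by split => t /=; rewrite /xsection /= !inE /= E.
  apply: eq_from_tnth => i; rewrite tnth_mktuple big_ord_recl tnth0.
  have [j ->|->] := unliftP ord0 i.
    rewrite tnthS tnth_mktuple addrAC [RHS]addrC; congr (_ + _).
    by apply: eq_bigr => k _; rewrite mxE tnthS.
  rewrite tnth0 [X in _ + X + _]big1 ?addr0 // => j _.
  by rewrite (is_trig_mxP tM) ?mul0r.
rewrite (@ge0_integral_affine _ _ (fun y => `|\det M'|^-1%:E *
    leb R n (xsection (@consp R n @^-1` S) y))%E) //; last 2 first.
- apply: emeasurable_funM => //; exact: (measurable_fun_xsection (leb R n) mS').
- by move=> x; rewrite mule_ge0 // lee_fin invr_ge0.
rewrite ge0_integralZl //; try exact: (measurable_fun_xsection (leb R n) mS'); try by rewrite lee_fin invr_ge0.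
by rewrite muleA -EFinM normrM invfM.
Qed.

Lemma mapM_comp n (A B : 'M[R]_n) t :
  mapM A (fun=> 0) (mapM B (fun=> 0) t) = mapM (A *m B) (fun=> 0) t.
Proof.
apply: eq_from_tnth => i; rewrite !tnth_mktuple !addr0.
under eq_bigr do rewrite tnth_mktuple addr0 mulr_sumr.
rewrite exchange_big; apply: eq_bigr => j _; rewrite mxE mulr_suml.
by apply: eq_bigr => k _; rewrite mulrA.
Qed.

Definition leb_scales n (M : 'M[R]_n) := forall S, measurable S ->
  leb R n (mapM M (fun=> 0) @^-1` S) = (`|\det M|^-1%:E * leb R n S)%E.

Lemma leb_scalesM n (A B : 'M[R]_n) : leb_scales A -> leb_scales B -> leb_scales (A *m B).
Proof.
move=> hA hB S mS; rewrite det_mulmx normrM invfM EFinM muleAC -hA // muleC -hB.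
  by rewrite -comp_preimage; congr (leb R n (_ @^-1` S)); apply/funext => t /=; rewrite mapM_comp.
by rewrite -[_ @^-1` _]setTI; exact: measurable_mapM.
Qed.

Lemma leb_scales_perm n (s : 'S_n) : leb_scales (perm_mx s).
Proof.
move=> S mS; rewrite det_perm normrX normrN1 expr1n invr1 mul1e -[RHS](leb_perm s) //.
congr (leb R n (_ @^-1` S)); apply/funext => t; apply: eq_from_tnth => i.
rewrite !tnth_mktuple addr0 (bigD1 (s i)) //= big1 => [|j /negPf js].
  by rewrite !mxE eqxx mul1r addr0.
by rewrite !mxE eq_sym js mul0r.
Qed.

(** The LUP decomposition reduces the formula to permutations and triangular matrices. *)
Lemma leb_scales_unit n (M : 'M[R]_n) : \det M != 0 -> leb_scales M.
Proof.
case: n M => [|n] M dM; first by move=> S; apply: leb_trig => //; apply/is_trig_mxP; case.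
have := cormen_lup_correct M; have := cormen_lup_perm M; have := cormen_lup_detL M.
have := @cormen_lup_lower _ _ M; have := @cormen_lup_upper _ _ M.
case: (cormen_lup M) => -[P L] U /= hU hL dL /is_perm_mxP[s ->] PM.
have tL : is_trig_mx L.
  by apply/is_trig_mxP => i j ij; rewrite hL ?(ltnW ij) // -val_eqE ltn_eqF.
have ME : M = perm_mx (s^-1)%g *m (L *m U).
  by rewrite -[L *m U]/(L * U) -PM mulmxA -perm_mxM mulVg perm_mx1 mul1mx.
have dU : \det U != 0.
  by move: dM; rewrite ME !det_mulmx dL mul1r mulf_eq0 negb_or => /andP[].
(* Reversing the order of the coordinates turns the upper triangular factor into a lower triangular
   one, to which [leb_trig] applies. *)
pose w := perm (@rev_ord_inj n.+1).
have wE : perm_mx w *m (perm_mx w *m U *m perm_mx w) *m perm_mx w = U.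
  have ww : perm_mx w *m perm_mx w = 1%:M :> 'M[R]_n.+1.
    by rewrite -perm_mxM (_ : w * w = 1)%g ?perm_mx1 //; apply/permP => i; rewrite permM !permE rev_ordK.
  by rewrite !mulmxA ww mul1mx -mulmxA ww mulmx1.
have tU : is_trig_mx (perm_mx w *m U *m perm_mx w).
  apply/is_trig_mxP => i j ij.
  have wV : (w^-1)%g = w by apply/eqP; rewrite eq_invg_mul; apply/eqP/permP => k; rewrite permM !permE rev_ordK.
  rewrite -row_permE -[in X in _ *m X]wV -col_permE !mxE !permE hU //=.
  by have := ltn_ord j; lia.
have dU' : \det (perm_mx w *m U *m perm_mx w) != 0.
  by rewrite !det_mulmx !det_perm !mulf_neq0 // signr_eq0.
rewrite ME -wE; apply: leb_scalesM; first exact: leb_scales_perm.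
apply: leb_scalesM; first by move=> S; apply: leb_trig => //; rewrite dL oner_eq0.
apply: leb_scalesM; last exact: leb_scales_perm.
apply: leb_scalesM; first exact: leb_scales_perm.
by move=> S; exact: leb_trig.
Qed.

(** Polarizing the norm on basis vectors gives [M^T *m M = 1%:M], hence a determinant of modulus
    1. *)
Lemma leb_isometry n (M : 'M[R]_n) S :
  (forall t, \sum_i tnth (mapM M (fun=> 0) t) i ^+ 2 = \sum_i tnth t i ^+ 2) ->
  measurable S -> leb R n (mapM M (fun=> 0) @^-1` S) = leb R n S.
Proof.
move=> iso mS.
have MM : M^T *m M = 1%:M.
  apply/matrixP => i j.
  pose q (v : 'I_n -> R) := \sum_k (\sum_l M k l * v l) ^+ 2.
  have qE v : q v = \sum_k v k ^+ 2.
    have := iso [tuple v i | i < n]; rewrite /q.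
    under [in X in _ = X -> _]eq_bigr do rewrite tnth_mktuple.
    move=> <-; apply: eq_bigr => k _; rewrite tnth_mktuple addr0.
    by congr (_ ^+ 2); apply: eq_bigr => l _; rewrite tnth_mktuple.
  pose e (i : 'I_n) : 'I_n -> R := fun k => (k == i)%:R.
  have Me k l : \sum_l0 M k l0 * e l l0 = M k l.
    rewrite (bigD1 l) //= /e eqxx mulr1 big1 ?addr0 // => r /negPf ->; by rewrite mulr0.
  have qe l : \sum_k M k l ^+ 2 = 1.
    have := qE (e l); rewrite /q; under eq_bigr do rewrite Me.
    move=> ->; rewrite (bigD1 l) //= /e eqxx expr1n big1 ?addr0 // => r /negPf ->.
    by rewrite expr0n.
  have qij : \sum_k (M k i + M k j) ^+ 2 = \sum_k (e i k + e j k) ^+ 2.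
    rewrite -(qE (fun k => e i k + e j k)); apply: eq_bigr => k _; congr (_ ^+ 2).
    by under [RHS]eq_bigr do rewrite mulrDr; rewrite big_split /= !Me.
  have S2 (u v : 'I_n -> R) : \sum_k (u k + v k) ^+ 2 =
      \sum_k u k ^+ 2 + \sum_k v k ^+ 2 + 2 * \sum_k u k * v k.
    by rewrite mulr_sumr -!big_split; apply: eq_bigr => k _ /=; ring.
  move: qij; rewrite !S2 !qe.
  have es l : \sum_k e l k ^+ 2 = 1.
    by rewrite -(qE (e l)) /q -[RHS](qe l); apply: eq_bigr => k _; rewrite Me.
  rewrite !es => /addrI /(mulfI _) h; rewrite !mxE.
  transitivity (\sum_k M k i * M k j); first by apply: eq_bigr => k _; rewrite mxE.
  rewrite h ?pnatr_eq0 // (bigD1 i) //= /e eqxx mul1r big1 ?addr0 // => k /negPf ->.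
  by rewrite mul0r.
have d1 : `|\det M| = 1.
  have : \det (M^T *m M) = 1 by rewrite MM det1.
  rewrite det_mulmx det_tr => d2; apply/eqP.
  by rewrite -sqrp_eq1 // -normrX expr2 d2 normr1.
rewrite leb_scales_unit // ?d1 ?invr1 ?mul1e //.
by rewrite -normr_gt0 d1.
Qed.
End Linear.

Section Ball.
Variable R : realType.
Local Notation mT := (measurableTypeR R).
Local Notation mu := (@lebesgue_measure R).

Lemma measurable_sqr_ball n (c : R) :
  measurable ([set t | \sum_i tnth t i ^+ 2 <= c] : set (n.-tuple mT)).
Proof.
have mf : measurable_fun setT (fun t : n.-tuple mT => \sum_i tnth t i ^+ 2).
  by apply: measurable_sum => i; apply: measurable_funX; exact: measurable_tnth.
rewrite (_ : [set _ | _] = (fun t : n.-tuple mT => \sum_i tnth t i ^+ 2) @^-1` `]-oo, c]); last first.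
  by apply/seteqP; split => t /=; rewrite in_itv.
by rewrite -[_ @^-1` _]setTI; apply: mf.
Qed.

(* Compare the indicator of the ball with a multiple of the Gaussian density. *)
Lemma leb_sqr_ball_le n (s c : R) : 0 < s ->
  (leb R n [set t | (\sum_i tnth t i ^+ 2 <= c)%R] <=
   (expR (c / (s ^+ 2 *+ 2)) * Num.sqrt (s ^+ 2 * pi *+ 2) ^+ n)%:E)%E.
Proof.
move=> s0; have s2 : 0 < s ^+ 2 *+ 2 by rewrite mulrn_wgt0 // exprn_gt0.
set k := Num.sqrt _.
have k0 : 0 < k by rewrite sqrtr_gt0 mulrn_wgt0 // mulr_gt0 ?pi_gt0 // exprn_gt0.
elim: n c => [|n IH] c.
  rewrite expr0 mulr1 /= diracE; case: (boolP (_ \in _)) => [|_]; last by rewrite lee_fin expR_ge0.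
  rewrite inE /= big_ord0 => c0; rewrite lee_fin -[X in X <= _]expR0 ler_expR.
  by rewrite divr_ge0 // ltW.
have mc : measurable (@consp R n @^-1` [set t | \sum_i tnth t i ^+ 2 <= c]).
  by rewrite -[_ @^-1` _]setTI; apply: measurable_consp => //; exact: measurable_sqr_ball.
apply: (@le_trans _ _ (\int[mu]_x ((expR (c / (s ^+ 2 *+ 2)) * k ^+ n.+1)%:E * (normal_pdf 0 s x)%:E))%E).
  rewrite /= /consm /pushforward /product_measure1.
  apply: ge0_le_integral => //.
  - exact: (measurable_fun_xsection (leb R n) mc).
  - by apply: emeasurable_funM => //; apply/measurable_EFinP; exact: measurable_normal_pdf.
  - move=> x _ /=.
    (* A slice of the ball is a ball of squared radius [c - x ^+ 2], possibly negative, so every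
       real [c] must be allowed. The factor that splits off is the Gaussian density up to its
       normalisation. *)
    rewrite (_ : xsection _ x = [set t | \sum_i tnth t i ^+ 2 <= c - x ^+ 2]); last first.
      have E t : \sum_i tnth (consp (x, t)) i ^+ 2 = x ^+ 2 + \sum_i tnth t i ^+ 2.
        by rewrite big_ord_recl tnth0; congr (_ + _); apply: eq_bigr => i _; rewrite tnthS.
      by apply/seteqP; split => t /=; rewrite /xsection /= inE /= E => h; lra.
    apply: (le_trans (IH _)); rewrite -EFinM lee_fin normal_pdfE ?gt_eqF //.
    rewrite /normal_fun subr0 mulrBl expRD -mulNr /normal_peak -/k le_eqVlt; apply/orP; left.
    by apply/eqP; rewrite [k ^+ n.+1]exprS; field; rewrite gt_eqF.
rewrite ge0_integralZl //; last 3 first.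
- by apply/measurable_EFinP; exact: measurable_normal_pdf.
- by move=> x _; rewrite lee_fin normal_pdf_ge0.
- by rewrite lee_fin mulr_ge0 ?expR_ge0 // exprn_ge0 // ltW.
by rewrite integral_normal_pdf mule1.
Qed.
End Ball.

(** * Volumes of product sets indexed by a disjoint union *)

Section FinProduct.
Variable R : realType.
Local Notation mT := (measurableTypeR R).
Local Notation mu := (@lebesgue_measure R).

Definition fin_set (K : finType) (S : set (K -> R)) : set (#|K|.-tuple mT) :=
  [set t | S (fun k => tnth t (enum_rank k))].

Lemma lebesgue_finE (K : finType) (S : set (K -> R)) : measurable (fin_set S) ->
  lebesgue_fin S = leb R #|K| (fin_set S).
Proof. exact: lebesgue_tupleE. Qed.

(** [K] is the disjoint union of [K1] and [K2], but its enumeration may interleave them, so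
    concatenating tuples would not do. The product measure is pushed forward along [glue] and
    compared with [leb] on boxes. *)
Lemma lebesgue_fin_prod (K K1 K2 : finType) (f1 : K1 -> K) (f2 : K2 -> K) (g : K -> K1 + K2)
    (S1 : set (K1 -> R)) (S2 : set (K2 -> R)) :
  (forall x, g (f1 x) = inl x) -> (forall x, g (f2 x) = inr x) ->
  (forall k, match g k with inl x => f1 x | inr x => f2 x end = k) ->
  measurable (fin_set S1) -> measurable (fin_set S2) ->
  measurable (fin_set [set u : K -> R | S1 (u \o f1) /\ S2 (u \o f2)]) /\
  lebesgue_fin [set u : K -> R | S1 (u \o f1) /\ S2 (u \o f2)] =
    (lebesgue_fin S1 * lebesgue_fin S2)%E.
Proof.
move=> gf1 gf2 fg m1 m2.
have tr T (P : set T) a b : a = b -> P a -> P b by move->.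
pose sub (K' : finType) (f : K' -> K) (t : #|K|.-tuple mT) : #|K'|.-tuple mT :=
  [tuple tnth t (enum_rank (f (enum_val i))) | i < #|K'|].
have msub (K' : finType) f : measurable_fun setT (@sub K' f).
  apply/measurable_fun_tnthP => i.
  rewrite (_ : _ \o _ = fun t => tnth t (enum_rank (f (enum_val i)))); first exact: measurable_tnth.
  by apply/funext => t /=; rewrite tnth_mktuple.
set S := [set u | _].
have SE : fin_set S = sub _ f1 @^-1` fin_set S1 `&` sub _ f2 @^-1` fin_set S2.
  apply/seteqP; split => t /=.
    move=> [h1 h2]; split; [move: h1|move: h2]; rewrite /fin_set /=; apply: tr; apply/funext => x; by rewrite /= tnth_mktuple enum_rankK.
  move=> [h1 h2]; split; [move: h1|move: h2]; rewrite /fin_set /=; apply: tr; apply/funext => x; by rewrite /= tnth_mktuple enum_rankK.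
have mS : measurable (fin_set S).
  by rewrite SE; apply: measurableI; rewrite -[_ @^-1` _]setTI; apply: msub.
split=> //; rewrite !lebesgue_finE //.
pose glue (p : #|K1|.-tuple mT * #|K2|.-tuple mT) : #|K|.-tuple mT :=
  [tuple match g (enum_val i) with inl x => tnth p.1 (enum_rank x)
         | inr x => tnth p.2 (enum_rank x) end | i < #|K|].
have mglue : measurable_fun setT glue.
  apply/measurable_fun_tnthP => i; case Eg : (g (enum_val i)) => [x|x].
    rewrite (_ : _ \o _ = (fun t => tnth t (enum_rank x)) \o fst).
      by apply: measurableT_comp => //; exact: measurable_tnth.
    by apply/funext => t /=; rewrite tnth_mktuple Eg.
  rewrite (_ : _ \o _ = (fun t => tnth t (enum_rank x)) \o snd).
    by apply: measurableT_comp => //; exact: measurable_tnth.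
  by apply/funext => t /=; rewrite tnth_mktuple Eg.
pose m : {measure set (#|K|.-tuple mT) -> \bar R} :=
  measure_function_pushforward__canonical__measure_function_Measure
    (leb R #|K1| \x leb R #|K2|)%E mglue.
rewrite -(@leb_unique _ _ m) // => [|F mF].
  rewrite /m /= /pushforward -product_measure1E //; congr ((_ \x _)%E _).
  apply/seteqP; split => -[t1 t2] /=; rewrite SE /=.
    move=> [h1 h2]; split; [move: h1|move: h2]; rewrite /fin_set /=; apply: tr; apply/funext => x; by rewrite /= !tnth_mktuple !enum_rankK ?gf1 ?gf2.
  move=> [h1 h2]; split; [move: h1|move: h2]; rewrite /fin_set /=; apply: tr; apply/funext => x; by rewrite /= !tnth_mktuple !enum_rankK ?gf1 ?gf2.
rewrite /m /= /pushforward.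
rewrite (_ : _ @^-1` _ = @box R #|K1| (fun i : 'I_#|K1| => F (enum_rank (f1 (enum_val i)))) `*`
                         @box R #|K2| (fun i : 'I_#|K2| => F (enum_rank (f2 (enum_val i))))); last first.
  apply/seteqP; split => -[t1 t2] /=.
    move=> h; split=> i.
      have := h (enum_rank (f1 (enum_val i))).
      by rewrite tnth_mktuple enum_rankK gf1 enum_valK.
    have := h (enum_rank (f2 (enum_val i))).
    by rewrite tnth_mktuple enum_rankK gf2 enum_valK.
  move=> [h1 h2] i; rewrite tnth_mktuple; have := fg (enum_val i).
  case: (g (enum_val i)) => x fx.
    by have := h1 (enum_rank x); rewrite enum_rankK fx enum_valK.
  by have := h2 (enum_rank x); rewrite enum_rankK fx enum_valK.
rewrite product_measure1E; last 2 first.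
- by apply: measurable_box => i; exact: mF.
- by apply: measurable_box => i; exact: mF.
pose G k := mu (F (enum_rank k)).
have E (L : finType) (h : L -> K) :
    leb R #|L| (box (fun i : 'I_#|L| => F (enum_rank (h (enum_val i))))) = \big[mule/1%E]_(x : L) G (h x).
  rewrite leb_box; last by move=> i; exact: mF.
  rewrite [RHS](reindex (@enum_val L predT)); first by apply: eq_big => i; rewrite ?inE.
  by exists enum_rank => x _; rewrite ?enum_valK ?enum_rankK.
transitivity (\big[mule/1%E]_(k : K) G k); last first.
  rewrite -(E K id) leb_box; last by move=> i; exact: mF.
  by apply: eq_bigr => i _; rewrite enum_valK.
transitivity ((\big[mule/1%E]_(x : K1) G (f1 x)) * (\big[mule/1%E]_(x : K2) G (f2 x)))%E.
  by congr mule; exact: E.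
pose h (x : K1 + K2) := match x with inl x => f1 x | inr x => f2 x end.
rewrite [RHS](reindex h); first by rewrite big_sumType.
by exists g => [[x|x]|k] _ //=; rewrite ?gf1 ?gf2 //; exact: fg.
Qed.
End FinProduct.

(** * Loop equations *)

Section WordAlgebra.
Variables (F : fieldType) (d : nat).
Implicit Types (cs : seq (bool * 'M[F]_d)) (A B P M : 'M[F]_d).

Fixpoint mprod cs : 'M[F]_d := if cs is c :: cs' then c.2 *m mprod cs' else 1%:M.

(* The derivation of the product of [cs] induced by [b |-> [P, b]] on the
   letters flagged [true]. *)
Fixpoint derp P cs : 'M[F]_d := if cs is c :: cs' then
  (if c.1 then P *m c.2 - c.2 *m P else 0) *m mprod cs' + c.2 *m derp P cs' else 0.

(* [gsum A cs] is the sum over matrix units of [\tr (E_lk A (derp E_kl cs))]. *)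
Fixpoint gsum A cs : F := if cs is c :: cs' then
  (if c.1 then \tr A * \tr (c.2 *m mprod cs') - \tr (A *m c.2) * \tr (mprod cs') else 0)
  + gsum (A *m c.2) cs' else 0.

(** The transpose of [P |-> derp P cs] for the trace pairing, a cyclic derivative: it isolates [P],
    so that a matrix unit in its place reads off one entry. *)
Fixpoint qmat A cs : 'M[F]_d := if cs is c :: cs' then
  (if c.1 then c.2 *m mprod cs' *m A - mprod cs' *m A *m c.2 else 0)
  + qmat (A *m c.2) cs' else 0.

Lemma mprod_cat cs1 cs2 : mprod (cs1 ++ cs2) = mprod cs1 *m mprod cs2.
Proof. by elim: cs1 => [|c cs1 IH] /=; rewrite ?mul1mx // IH mulmxA. Qed.

Lemma tr_derp P A cs : \tr (A *m derp P cs) = \tr (P *m qmat A cs).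
Proof.
elim: cs A => [|[b c] cs IH] A /=; first by rewrite !mulmx0 !mxtrace0.
rewrite !mulmxDr !mxtraceD mulmxA -IH; congr (_ + _); last by rewrite !mulmxA.
case: b; last by rewrite mulmx0 mul0mx mulmx0.
rewrite mulmxBr mulmxBl mulmxBr !raddfB /=; congr (_ - _).
  by rewrite -!mulmxA mxtrace_mulC !mulmxA.
by rewrite -!mulmxA mxtrace_mulC -!mulmxA mxtrace_mulC !mulmxA.
Qed.

Lemma tr_delta A k l : \tr (delta_mx k l *m A) = A l k.
Proof.
rewrite /mxtrace (bigD1 k) //= mxE (bigD1 l) //= mxE !eqxx mul1r big1 => [|j /negPf jl].
  rewrite addr0 big1 ?addr0 // => i /negPf ik; rewrite mxE big1 // => j _.
  by rewrite mxE ik mul0r.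
by rewrite mxE jl andbF mul0r.
Qed.

(** Since [E_lk A E_kl] summed over [k, l] is [tr A] times the identity, one trace splits into a
    product of two. This is the source of the factorised terms in the loop equations. *)
Lemma sum_tr_delta A B :
  \sum_k \sum_l \tr (delta_mx l k *m A *m delta_mx k l *m B) = \tr A * \tr B.
Proof.
rewrite /mxtrace mulr_suml; apply: eq_bigr => k _; rewrite mulr_sumr.
apply: eq_bigr => l _; rewrite -!mulmxA -/(mxtrace _) tr_delta.
rewrite mxE (bigD1 k) //= big1 ?addr0 => [|j /negPf jk].
  rewrite mxE (bigD1 l) //= big1 ?addr0 => [|j /negPf jl]; first by rewrite mxE !eqxx mul1r.
  by rewrite mxE jl andbF mul0r.
rewrite mxE big1 ?mulr0 // => i _; by rewrite mxE jk mul0r.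
Qed.

Lemma sum_derp A cs :
  \sum_k \sum_l \tr (delta_mx l k *m A *m derp (delta_mx k l) cs) = gsum A cs.
Proof.
elim: cs A => [|[b c] cs IH] A /=.
  by rewrite big1 // => k _; rewrite big1 // => l _; rewrite mulmx0 mxtrace0.
rewrite -IH.
have -> : (if b then \tr A * \tr (c *m mprod cs) - \tr (A *m c) * \tr (mprod cs) else 0) =
   \sum_k \sum_l \tr (delta_mx l k *m A *m ((if b then delta_mx k l *m c - c *m delta_mx k l else 0) *m mprod cs)).
  case: b; last first.
    by rewrite big1 // => k _; rewrite big1 // => l _; rewrite mul0mx mulmx0 mxtrace0.
  rewrite -!sum_tr_delta -sumrB; apply: eq_bigr => k _; rewrite -sumrB; apply: eq_bigr => l _.
  by rewrite mulmxBl mulmxBr raddfB /= !mulmxA.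
rewrite -big_split; apply: eq_bigr => k _; rewrite -big_split; apply: eq_bigr => l _ /=.
by rewrite mulmxDr mxtraceD !mulmxA.
Qed.

Lemma derpZ a P cs : derp (a *: P) cs = a *: derp P cs.
Proof.
elim: cs => [|[b c] cs IH] /=; first by rewrite scaler0.
rewrite IH scalerDr; congr (_ + _); last by rewrite scalemxAr.
by case: b; rewrite ?mul0mx ?scaler0 // -scalemxAl -scalemxAr -scalerBr scalemxAl.
Qed.

Lemma derpD P P' cs : derp (P + P') cs = derp P cs + derp P' cs.
Proof.
elim: cs => [|[b c] cs IH] /=; first by rewrite addr0.
rewrite IH [c *m (derp _ _ + _)]mulmxDr addrACA; congr (_ + _).
case: b; rewrite ?mul0mx ?addr0 // -mulmxDl; congr (_ *m _).
by rewrite mulmxDl mulmxDr opprD addrACA.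
Qed.
End WordAlgebra.

(** * Squared moduli and operator bounds *)

Section Bounds.
Variable R : realType.
Local Notation C := R[i].

(** The squared modulus is real-valued and polynomial in the real and imaginary parts, so integrands
    built from it stay in a class closed under sums and products. *)
Definition abs2 (z : C) : R := complex.Re z ^+ 2 + complex.Im z ^+ 2.

Lemma abs2_ge0 z : 0 <= abs2 z. Proof. by rewrite addr_ge0 ?sqr_ge0. Qed.
Lemma abs2M x y : abs2 (x * y) = abs2 x * abs2 y.
Proof. by case: x y => [a b] [a' b']; rewrite /abs2 /=; ring. Qed.
Lemma abs2D x y : abs2 (x + y) <= 2 * abs2 x + 2 * abs2 y.
Proof.
case: x y => [a b] [a' b']; rewrite /abs2 /= -subr_ge0.
rewrite [X in 0 <= X](_ : _ = (a - a') ^+ 2 + (b - b') ^+ 2); last by ring.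
by rewrite addr_ge0 ?sqr_ge0.
Qed.
Lemma abs20 : abs2 0 = 0. Proof. by rewrite /abs2 /= expr0n addr0. Qed.
Lemma abs21 : abs2 1 = 1. Proof. by rewrite /abs2 /= expr0n addr0 expr1n. Qed.
Lemma abs2_real (x : R) : abs2 x%:C = x ^+ 2. Proof. by rewrite /abs2 /= expr0n addr0. Qed.
Lemma abs2N x : abs2 (- x) = abs2 x. Proof. by case: x => a b; rewrite /abs2 /= !sqrrN. Qed.
Lemma abs2J x : abs2 (conjc x) = abs2 x. Proof. by case: x => a b; rewrite /abs2 /= !sqrrN. Qed.
Lemma mulcJ_abs2 x : x * conjc x = (abs2 x)%:C.
Proof. by case: x => a b; rewrite /abs2; simpc; congr Complex; ring. Qed.
Lemma abs2_eq0 x : abs2 x = 0 -> x = 0.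
Proof.
case: x => a b; rewrite /abs2 /= => /eqP; rewrite paddr_eq0 ?sqr_ge0 // !sqrf_eq0.
by move=> /andP[/eqP -> /eqP ->].
Qed.
Lemma abs2_sum (I : Type) (s : seq I) (f : I -> C) :
  abs2 (\sum_(i <- s) f i) <= (size s)%:R * \sum_(i <- s) abs2 (f i).
Proof.
elim: s => [|i s IH]; first by rewrite !big_nil abs20 mulr0.
rewrite !big_cons /=; move: IH; set S := \sum_(_ <- _) f _; set T := \sum_(_ <- _) _.
set n : R := (size s)%:R => IH.
have [s0|s0] := posnP (size s).
  rewrite /S /T; move: s0 => /size0nil ->; rewrite !big_nil !addr0 /= mul1r //.
have n0 : 0 < n by rewrite ltr0n.
(* Young's inequality with weight [n], chosen because [(1 + n^-1) * n = 1 + n] is the next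
   constant. *)
have key : abs2 (f i + S) <= (1 + n) * abs2 (f i) + (1 + n^-1) * abs2 S.
  case: (f i) S {IH} => [a b] [a' b']; rewrite /abs2 /= -subr_ge0.
  rewrite [X in 0 <= X](_ : _ = n^-1 * ((n * a - a') ^+ 2 + (n * b - b') ^+ 2)).
    by rewrite mulr_ge0 ?invr_ge0 ?(ltW n0) // addr_ge0 ?sqr_ge0.
  by field; rewrite gt_eqF.
apply: (le_trans key); rewrite -natr1 -/n [n + 1]addrC [leRHS]mulrDr lerD2l.
have -> : (1 + n) * T = (1 + n^-1) * (n * T) by field; rewrite gt_eqF.
by rewrite ler_wpM2l // addr_ge0 // invr_ge0 ltW.
Qed.

Section mx.
Variable d : nat.
Implicit Types (B : 'M[C]_d) (v : 'cV[C]_d).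

Definition l2sq v : R := \sum_k abs2 (v k 0).

(** The square of the operator norm is at most [K]. The constants obtained for sums are not sharp;
    only their independence of [d] matters. *)
Definition bnd (K : R) B := 0 <= K /\ forall v, l2sq (B *m v) <= K * l2sq v.

Lemma l2sq_ge0 v : 0 <= l2sq v. Proof. by apply: sumr_ge0 => k _; exact: abs2_ge0. Qed.

Lemma bnd1 : bnd 1 1%:M. Proof. by split=> // v; rewrite mul1mx mul1r. Qed.

Lemma bnd0 : bnd 0 0.
Proof. by split=> // v; rewrite mul0mx mul0r /l2sq big1 // => k _; rewrite mxE abs20. Qed.

Lemma bndM K K' B B' : bnd K B -> bnd K' B' -> bnd (K * K') (B *m B').
Proof.
move=> [K0 h] [K0' h']; split=> [|v]; first exact: mulr_ge0.
by rewrite -mulmxA (le_trans (h _)) // -mulrA ler_wpM2l.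
Qed.

Lemma bndD K K' B B' : bnd K B -> bnd K' B' -> bnd (2 * K + 2 * K') (B + B').
Proof.
move=> [K0 h] [K0' h']; split=> [|v]; first by rewrite addr_ge0 // mulr_ge0.
rewrite mulmxDl mulrDl -!mulrA; apply: (@le_trans _ _ (2 * l2sq (B *m v) + 2 * l2sq (B' *m v))).
  rewrite /l2sq !mulr_sumr -big_split; apply: ler_sum => k _ /=; rewrite mxE; exact: abs2D.
by rewrite lerD // ler_wpM2l.
Qed.

Lemma bndZ K a B : bnd K B -> bnd (abs2 a * K) (a *: B).
Proof.
move=> [K0 h]; split=> [|v]; first by rewrite mulr_ge0 // abs2_ge0.
rewrite -scalemxAl -mulrA (@le_trans _ _ (abs2 a * l2sq (B *m v))) //.
  rewrite /l2sq mulr_sumr; apply: ler_sum => k _; by rewrite mxE abs2M.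
by rewrite ler_wpM2l // abs2_ge0.
Qed.

Lemma bndB K K' B B' : bnd K B -> bnd K' B' -> bnd (2 * K + 2 * K') (B - B').
Proof.
move=> h h'; rewrite -[- B']scaleN1r; have := bndD h (bndZ (-1) h').
by rewrite abs2N abs21 mul1r.
Qed.

Lemma bnd_le K K' B : K <= K' -> bnd K B -> bnd K' B.
Proof.
move=> KK [K0 h]; split=> [|v]; first exact: le_trans KK.
by apply: (le_trans (h v)); rewrite ler_wpM2r // l2sq_ge0.
Qed.

Lemma bnd_col K B j : bnd K B -> \sum_i abs2 (B i j) <= K.
Proof.
move=> [K0 /(_ (delta_mx j 0))]; rewrite /l2sq.
have -> : \sum_k abs2 ((delta_mx j 0 : 'cV[C]_d) k 0) = 1.
  rewrite (bigD1 j) //= mxE !eqxx /= abs21 big1 ?addr0 // => k /negPf kj.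
  by rewrite mxE kj abs20.
rewrite mulr1; congr (_ <= _); apply: eq_bigr => i _; rewrite mxE (bigD1 j) //= mxE !eqxx mulr1.
by rewrite big1 ?addr0 // => k /negPf kj; rewrite mxE kj mulr0.
Qed.

Lemma bnd_entry K B i j : bnd K B -> abs2 (B i j) <= K.
Proof.
move=> /bnd_col -/(_ j); apply: le_trans; rewrite (bigD1 i) //= lerDl sumr_ge0 // => k _.
exact: abs2_ge0.
Qed.

Lemma bnd_frob K B : bnd K B -> \sum_i \sum_j abs2 (B i j) <= d%:R * K.
Proof.
move=> h; rewrite exchange_big /= (le_trans (ler_sum _ (fun j _ => bnd_col j h))) //.
by rewrite sumr_const card_ord mulr_natl.
Qed.

Definition ntr B : C := \tr B / d%:R.

Lemma bnd_ntr K B : bnd K B -> abs2 (ntr B) <= K.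
Proof.
move=> h; case: (posnP d) => [d0|d0].
  rewrite /ntr (_ : (d%:R : C) = 0) ?invr0 ?mulr0 ?abs20 ?h.1 //.
  by rewrite d0.
rewrite /ntr abs2M; have -> : abs2 (d%:R^-1) = (d%:R^-1) ^+ 2 :> R.
  by rewrite -abs2_real; congr abs2; rewrite fmorphV rmorph_nat.
have dR : 0 < d%:R :> R by rewrite ltr0n.
rewrite exprVn ler_pdivrMr ?exprn_gt0 // mulrC expr2 -mulrA.
apply: (le_trans (abs2_sum _ _)).
have -> : size (index_enum 'I_d) = d by rewrite -[index_enum _]enumT size_enum_ord.
rewrite ler_wpM2l ?(ltW dR) //.
apply: (@le_trans _ _ (\sum_(i < d) K)); last by rewrite sumr_const card_ord mulr_natl.
by apply: ler_sum => i _; exact: bnd_entry.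
Qed.
End mx.
End Bounds.

(** * Invariant expectations and first-order expansions *)

Section Expectation.
Variables (R : realType) (J : Type) (col : J -> bool).
Local Notation C := R[i].
Local Notation Re := complex.Re.
Local Notation Im := complex.Im.

Definition adj m n (V : 'M[C]_(m, n)) : 'M[C]_(n, m) := map_mx conjc V^T.

Definition twist d (k : bool) (V : 'M[C]_d) (z : J -> 'M[C]_d) : J -> 'M[C]_d :=
  fun s => if col s == k then V *m z s *m adj V else z s.

(* Abstracts the uniform probability on a set [edom] of tuples that is invariant
   under unitary conjugation of one colour; [adm] stands for the integrands. *)
Record expct d := Expct {
  edom : set (J -> 'M[C]_d) ;
  adm : ((J -> 'M[C]_d) -> R) -> Prop ;
  ex : ((J -> 'M[C]_d) -> R) -> R ;
  adm_cst : forall c, adm (fun=> c) ;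
  admD : forall f g, adm f -> adm g -> adm (fun z => f z + g z) ;
  admM : forall f g, adm f -> adm g -> adm (fun z => f z * g z) ;
  adm_Re : forall s i j, adm (fun z => Re (z s i j)) ;
  adm_Im : forall s i j, adm (fun z => Im (z s i j)) ;
  adm_rot : forall k V f, V *m adj V = 1%:M -> adm f -> adm (fun z => f (twist k V z)) ;
  ex_lin : forall a f g, adm f -> adm g -> ex (fun z => a * f z + g z) = a * ex f + ex g ;
  ex_le : forall f g, adm f -> adm g -> (forall z, edom z -> f z <= g z) -> ex f <= ex g ;
  ex_cst : forall c, ex (fun=> c) = c ;
  ex_rot : forall k V f, V *m adj V = 1%:M -> adm f -> ex (fun z => f (twist k V z)) = ex f
}.

Section OneDim.
Variables (d : nat) (E : expct d).
Local Notation T := (J -> 'M[C]_d).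
Implicit Types (f g : T -> C).

Lemma exD (f g : T -> R) : adm E f -> adm E g -> ex E (fun z => f z + g z) = ex E f + ex E g.
Proof.
move=> hf hg; have := ex_lin 1 hf hg; rewrite mul1r => <-.
by congr ex; apply/funext => z; rewrite mul1r.
Qed.

Lemma exZ a (f : T -> R) : adm E f -> ex E (fun z => a * f z) = a * ex E f.
Proof.
move=> hf; have := ex_lin a hf (adm_cst E 0); rewrite ex_cst addr0 => <-.
by congr ex; apply/funext => z; rewrite addr0.
Qed.

Lemma admZ a (f : T -> R) : adm E f -> adm E (fun z => a * f z).
Proof. by move=> hf; apply: admM => //; exact: adm_cst. Qed.

Lemma exB (f g : T -> R) : adm E f -> adm E g -> ex E (fun z => f z - g z) = ex E f - ex E g.
Proof.
move=> hf hg; rewrite -mulN1r -exZ // -exD //; last exact: admZ.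
by congr ex; apply/funext => z; rewrite mulN1r.
Qed.

Lemma admB (f g : T -> R) : adm E f -> adm E g -> adm E (fun z => f z - g z).
Proof.
move=> hf hg; rewrite (_ : (fun _ => _) = (fun z => f z + -1 * g z)).
  by apply: admD => //; exact: admZ.
by apply/funext => z; rewrite mulN1r.
Qed.

Lemma ex_ge0 (f : T -> R) : adm E f -> (forall z, edom E z -> 0 <= f z) -> 0 <= ex E f.
Proof. by move=> hf h; rewrite -(ex_cst E 0); apply: ex_le => //; exact: adm_cst. Qed.

Definition cadm f := adm E (fun z => Re (f z)) /\ adm E (fun z => Im (f z)).
Definition cex f : C := ex E (fun z => Re (f z)) +i* ex E (fun z => Im (f z)).

Let ReD (x y : C) : Re (x + y) = Re x + Re y. Proof. by case: x y => ? ? []. Qed.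
Let ImD (x y : C) : Im (x + y) = Im x + Im y. Proof. by case: x y => ? ? []. Qed.
Let ReM (x y : C) : Re (x * y) = Re x * Re y - Im x * Im y. Proof. by case: x y => ? ? []. Qed.
Let ImM (x y : C) : Im (x * y) = Re x * Im y + Im x * Re y. Proof. by case: x y => ? ? []. Qed.
Let ReJ (x : C) : Re (conjc x) = Re x. Proof. by case: x. Qed.
Let ImJ (x : C) : Im (conjc x) = - Im x. Proof. by case: x. Qed.

Lemma cadm_cst c : cadm (fun=> c). Proof. by split; exact: adm_cst. Qed.

Lemma cadmD f g : cadm f -> cadm g -> cadm (fun z => f z + g z).
Proof.
move=> [h1 h2] [h3 h4]; split.
  by under eq_fun do rewrite ReD; apply: admD.
by under eq_fun do rewrite ImD; apply: admD.
Qed.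

Lemma cadmM f g : cadm f -> cadm g -> cadm (fun z => f z * g z).
Proof.
move=> [h1 h2] [h3 h4]; split.
  by under eq_fun do rewrite ReM; apply: admB; apply: admM.
by under eq_fun do rewrite ImM; apply: admD; apply: admM.
Qed.

Lemma cadmZ a f : cadm f -> cadm (fun z => a * f z).
Proof. by move=> h; apply: cadmM => //; exact: cadm_cst. Qed.

Lemma cadmB f g : cadm f -> cadm g -> cadm (fun z => f z - g z).
Proof.
move=> hf hg; rewrite (_ : (fun _ => _) = (fun z => f z + -1 * g z)).
  by apply: cadmD => //; exact: cadmZ.
by apply/funext => z; rewrite mulN1r.
Qed.

Lemma cadmJ f : cadm f -> cadm (fun z => conjc (f z)).
Proof.
move=> [h1 h2]; split; first by under eq_fun do rewrite ReJ.
under eq_fun do rewrite ImJ -mulN1r; exact: admZ.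
Qed.

Lemma cadm_sum (I : Type) (s : seq I) (F : I -> T -> C) :
  (forall i, cadm (F i)) -> cadm (fun z => \sum_(i <- s) F i z).
Proof.
move=> h; elim: s => [|i s IH].
  by under eq_fun do rewrite big_nil; exact: cadm_cst.
by under eq_fun do rewrite big_cons; exact: cadmD.
Qed.

Lemma adm_abs2 f : cadm f -> adm E (fun z => abs2 (f z)).
Proof. by move=> [h1 h2]; apply: admD; under eq_fun do rewrite expr2; apply: admM. Qed.

Lemma cadm_entry s i j : cadm (fun z => z s i j).
Proof. by split; [exact: adm_Re|exact: adm_Im]. Qed.

Lemma cexD f g : cadm f -> cadm g -> cex (fun z => f z + g z) = cex f + cex g.
Proof.
move=> [h1 h2] [h3 h4]; rewrite /cex.
rewrite (funext (fun z => ReD (f z) (g z))) (funext (fun z => ImD (f z) (g z))).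
by rewrite !exD.
Qed.

Lemma cexZ a f : cadm f -> cex (fun z => a * f z) = a * cex f.
Proof.
move=> [h1 h2]; case: a => a b; rewrite /cex.
rewrite (funext (fun z => ReM (a +i* b) (f z))) (funext (fun z => ImM (a +i* b) (f z))).
by rewrite /= exB ?exD ?exZ //; apply: admZ.
Qed.

Lemma cexB f g : cadm f -> cadm g -> cex (fun z => f z - g z) = cex f - cex g.
Proof.
move=> hf hg; rewrite -mulN1r -cexZ // -cexD //; last exact: cadmZ.
by congr cex; apply/funext => z; rewrite mulN1r.
Qed.

Lemma cex_sum (I : Type) (s : seq I) (F : I -> T -> C) :
  (forall i, cadm (F i)) -> cex (fun z => \sum_(i <- s) F i z) = \sum_(i <- s) cex (F i).
Proof.
move=> h; elim: s => [|i s IH].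
  by under eq_fun do rewrite big_nil; rewrite big_nil /cex !ex_cst.
by under eq_fun do rewrite big_cons; rewrite big_cons cexD ?IH //; exact: cadm_sum.
Qed.

Lemma Re_cex f : Re (cex f) = ex E (fun z => Re (f z)). Proof. by []. Qed.

Definition madm (M : T -> 'M[C]_d) := forall i j, cadm (fun z => M z i j).

Lemma madm_cst A : madm (fun=> A). Proof. by move=> i j; exact: cadm_cst. Qed.

Lemma madmM A B : madm A -> madm B -> madm (fun z => A z *m B z).
Proof.
move=> hA hB i j; under eq_fun do rewrite mxE.
by apply: cadm_sum => k; exact: cadmM.
Qed.

Lemma madmD A B : madm A -> madm B -> madm (fun z => A z + B z).
Proof. by move=> hA hB i j; under eq_fun do rewrite mxE; exact: cadmD. Qed.

Lemma madmZ a A : madm A -> madm (fun z => a *: A z).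
Proof. by move=> hA i j; under eq_fun do rewrite mxE; exact: cadmZ. Qed.

Lemma madmB A B : madm A -> madm B -> madm (fun z => A z - B z).
Proof.
move=> hA hB; under eq_fun do rewrite -scaleN1r.
by apply: madmD => //; exact: madmZ.
Qed.

Lemma cadm_tr A : madm A -> cadm (fun z => \tr (A z)).
Proof. by move=> hA; apply: cadm_sum => i; exact: hA. Qed.

Definition ev (cs : seq (bool * (T -> 'M[C]_d))) (z : T) := [seq (c.1, c.2 z) | c <- cs].

Lemma madm_mprod cs : (forall c, List.In c cs -> madm c.2) -> madm (fun z => mprod (ev cs z)).
Proof.
elim: cs => [|c cs IH] h /=; first exact: madm_cst.
by apply: madmM; [apply: h; left|apply: IH => c' ?; apply: h; right].
Qed.

Lemma madm_derp P cs : (forall c, List.In c cs -> madm c.2) -> madm (fun z => derp P (ev cs z)).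
Proof.
elim: cs => [|c cs IH] h /=; first exact: madm_cst.
have hc : madm c.2 by apply: h; left.
have h' c' : List.In c' cs -> madm c'.2 by move=> ?; apply: h; right.
apply: madmD; apply: madmM => //; [|exact: madm_mprod|exact: IH].
case: c.1; last exact: madm_cst.
by apply: madmB; apply: madmM => //; exact: madm_cst.
Qed.

Definition ubd (f : R -> T -> C) :=
  exists B : R, forall e z, 0 < e <= 1 -> edom E z -> abs2 (f e z) <= B.

Lemma ubdD (f g : R -> T -> C) : ubd f -> ubd g -> ubd (fun e z => f e z + g e z).
Proof.
move=> [B hB] [B' hB']; exists (2 * B + 2 * B') => e z he hz.
by apply: (le_trans (abs2D _ _)); rewrite lerD // ler_wpM2l // ?hB ?hB'.
Qed.

Lemma ubdM (f g : R -> T -> C) : ubd f -> ubd g -> ubd (fun e z => f e z * g e z).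
Proof.
move=> [B hB] [B' hB']; exists (B * B') => e z he hz.
by rewrite abs2M ler_pM ?abs2_ge0 ?hB ?hB'.
Qed.

Lemma ubd_cst c : ubd (fun _ _ => c). Proof. by exists (abs2 c). Qed.

Lemma ubd_par : ubd (fun e _ => e%:C).
Proof.
by exists 1 => e z /andP[e0 e1] _; rewrite abs2_real expr_le1 // ltW.
Qed.

(* [F e = F0 + e F1 + O(e ^ 2)] uniformly on [edom E]. *)
Definition jet (F : R -> T -> C) (F0 F1 : T -> C) := exists r : R -> T -> C,
  [/\ ubd (fun=> F0), ubd (fun=> F1), ubd r &
      forall e z, 0 < e <= 1 -> edom E z -> F e z = F0 z + e%:C * F1 z + e%:C ^+ 2 * r e z].

Lemma jetD F F0 F1 G G0 G1 : jet F F0 F1 -> jet G G0 G1 ->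
  jet (fun e z => F e z + G e z) (fun z => F0 z + G0 z) (fun z => F1 z + G1 z).
Proof.
move=> [r [h0 h1 hr hF]] [s [k0 k1 ks hG]]; exists (fun e z => r e z + s e z).
split; try exact: ubdD.
by move=> e z he hz; rewrite hF // hG //; ring.
Qed.

Lemma jetM F F0 F1 G G0 G1 : jet F F0 F1 -> jet G G0 G1 ->
  jet (fun e z => F e z * G e z) (fun z => F0 z * G0 z) (fun z => F1 z * G0 z + F0 z * G1 z).
Proof.
move=> [r [h0 h1 hr hF]] [s [k0 k1 ks hG]].
exists (fun e z => F0 z * s e z + F1 z * G1 z + r e z * G0 z +
   e%:C * (F1 z * s e z + r e z * G1 z) + e%:C * (e%:C * (r e z * s e z))).
split; first exact: ubdM.
- by apply: ubdD; exact: ubdM.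
- by repeat (apply: ubdD || apply: ubdM) => //; exact: ubd_par.
by move=> e z he hz; rewrite hF // hG //; ring.
Qed.

Lemma jetJ F F0 F1 : jet F F0 F1 ->
  jet (fun e z => conjc (F e z)) (fun z => conjc (F0 z)) (fun z => conjc (F1 z)).
Proof.
move=> [r [[B0 h0] [B1 h1] [Br hr] hF]]; exists (fun e z => conjc (r e z)); split.
- by exists B0 => e z he hz; rewrite abs2J; exact: (h0 e).
- by exists B1 => e z he hz; rewrite abs2J; exact: (h1 e).
- by exists Br => e z he hz; rewrite abs2J; exact: (hr e).
by move=> e z he hz; rewrite hF // !rmorphD !rmorphM /= !oppr0.
Qed.

Lemma jet_cst f : ubd (fun=> f) -> jet (fun=> f) f (fun=> 0).
Proof.
move=> h; exists (fun _ _ => 0); split => //; try exact: ubd_cst.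
by move=> e z _ _; ring.
Qed.

Lemma jet_sum (I : Type) (s : seq I) F F0 F1 : (forall i, jet (F i) (F0 i) (F1 i)) ->
  jet (fun e z => \sum_(i <- s) F i e z) (fun z => \sum_(i <- s) F0 i z)
    (fun z => \sum_(i <- s) F1 i z).
Proof.
move=> h; elim: s => [|i s IH].
  have E0 (G : I -> T -> C) : (fun z => \sum_(i <- [::]) G i z) = (fun=> 0).
    by apply/funext => z; rewrite big_nil.
  rewrite !E0 (_ : (fun e z => _) = (fun _ _ => 0)); first by apply: jet_cst; exact: ubd_cst.
  by apply/funext => e; rewrite E0.
have E1 (G : I -> T -> C) : (fun z => \sum_(j <- i :: s) G j z) =
    (fun z => G i z + \sum_(j <- s) G j z).
  by apply/funext => z; rewrite big_cons.
rewrite !E1 (_ : (fun e z => _) = (fun e z => F i e z + \sum_(j <- s) F j e z)); first exact: jetD.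
by apply/funext => e; rewrite E1.
Qed.

(** Differentiation under the expectation, without derivatives: by invariance [e] times the
    expectation of [F1] is, up to sign, that of a quantity of size [e ^ 2], so it is at most a
    constant times [e] for every small [e]. *)
Lemma jet_ex_eq0 F F0 F1 : jet F F0 F1 -> (forall e, cadm (F e)) -> cadm F0 -> cadm F1 ->
  (forall e, 0 < e <= 1 -> cex (F e) = cex F0) -> cex F1 = 0.
Proof.
move=> [r [_ _ [B hB] hF]] aF [aF0 aF0'] [aF1 aF1'] inv.
(* On an empty domain [B] may be negative, but then monotonicity squeezes every expectation between
   0 and 0. *)
have B0 : 0 <= B \/ forall z, ~ edom E z.
  case: (pselect (exists z, edom E z)) => [[z hz]|h]; [left|right=> z hz; apply: h; by exists z].
  by apply: (le_trans (abs2_ge0 (r 1 z))); apply: hB => //; rewrite ltr01 lexx.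
(* [p] is the real or the imaginary part; bounding it by [1 + abs2 z] avoids a square root and
   explains the constant [1 + B]. *)
have key (p : C -> R) : (forall z, `|p z| <= 1 + abs2 z) ->
   (forall (a : R) x y, p (a%:C * x + y) = a * p x + p y) ->
   (forall e, adm E (fun z => p (F e z))) -> adm E (fun z => p (F0 z)) ->
   adm E (fun z => p (F1 z)) ->
   (forall e, 0 < e <= 1 -> ex E (fun z => p (F e z)) = ex E (fun z => p (F0 z))) ->
   ex E (fun z => p (F1 z)) = 0.
  move=> pb pl a a0 a1 pinv; apply/eqP; rewrite -normr_le0 //.
  have bd e : 0 < e <= 1 -> `|ex E (fun z => p (F1 z))| <= e * (1 + B).
    move=> /andP[e0 e1].
    pose D z := p (F e z) - p (F0 z) - e * p (F1 z).
    have aD : adm E D by apply: admB; [exact: admB|exact: admZ].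
    have exDE : ex E D = - (e * ex E (fun z => p (F1 z))).
      by rewrite /D exB ?exB ?exZ ?pinv ?e0 ?subrr ?sub0r //; [exact: admB|exact: admZ].
    have DE z : edom E z -> `|D z| <= e ^+ 2 * (1 + B).
      move=> hz; rewrite /D hF ?e0 // -[X in p (X + _ + _)]mul1r.
      have -> : 1 * F0 z + e%:C * F1 z + e%:C ^+ 2 * r e z =
        (e ^+ 2)%:C * r e z + (e%:C * F1 z + F0 z) by rewrite rmorphXn /=; ring.
      rewrite !pl (_ : _ - _ - _ = e ^+ 2 * p (r e z)); last by ring.
      rewrite normrM ger0_norm ?sqr_ge0 // ler_wpM2l ?sqr_ge0 //.
      by apply: (le_trans (pb _)); rewrite lerD2l; apply: hB => //; rewrite e0.
    have : `|ex E D| <= e ^+ 2 * (1 + B).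
      rewrite ler_norml -[X in _ && (_ <= X)](ex_cst E) -[X in X <= _](ex_cst E).
      by apply/andP; split; apply: ex_le => //; try exact: adm_cst;
         move=> z /DE; rewrite ler_norml => /andP[].
    by rewrite exDE normrN normrM gtr0_norm // expr2 -mulrA ler_pM2l.
  case: B0 => [B0|nodom]; last first.
    rewrite normr_le0; apply/eqP/le_anti/andP; split.
      by rewrite -[leRHS](ex_cst E); apply: ex_le => //; first exact: adm_cst; move=> z /nodom.
    by rewrite -[leLHS](ex_cst E); apply: ex_le => //; first exact: adm_cst; move=> z /nodom.
  rewrite leNgt; apply/negP => x0; set x := `|_| in x0 bd.
  have B1 : 0 < 1 + B by rewrite ltr_pwDl.
  have := bd (Num.min 1 (x / (2 * (1 + B)))).
  have m0 : 0 < Num.min 1 (x / (2 * (1 + B))).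
    by rewrite lt_min ltr01 divr_gt0 // mulr_gt0.
  rewrite m0 ge_min lexx /= => /(_ isT); apply/negP; rewrite -ltNge.
  apply: (@le_lt_trans _ _ (x / (2 * (1 + B)) * (1 + B))).
    by rewrite ler_wpM2r ?(ltW B1) // ge_min lexx orbT.
  by rewrite (_ : _ * _ = x / 2) ?ltr_pdivrMr //; [lra|field; rewrite gt_eqF].
rewrite /cex (key (@Re R)) ?(key (@Im R)) //; try by move=> e; case: (aF e).
- move=> [a b] /=; rewrite /abs2 /= ler_norml; apply/andP; split.
    have : 0 <= (1/2 + b) ^+ 2 by rewrite sqr_ge0.
    have : 0 <= a ^+ 2 by rewrite sqr_ge0.
    nra.
  have : 0 <= (1/2 - b) ^+ 2 by rewrite sqr_ge0.
  have : 0 <= a ^+ 2 by rewrite sqr_ge0.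
  nra.
- by move=> a [x1 x2] [y1 y2] /=; rewrite mul0r addr0.
- by move=> e /inv; rewrite /cex => -[].
- move=> [a b] /=; rewrite /abs2 /= ler_norml; apply/andP; split.
    have : 0 <= (1/2 + a) ^+ 2 by rewrite sqr_ge0.
    have : 0 <= b ^+ 2 by rewrite sqr_ge0.
    nra.
  have : 0 <= (1/2 - a) ^+ 2 by rewrite sqr_ge0.
  have : 0 <= b ^+ 2 by rewrite sqr_ge0.
  nra.
- by move=> a [x1 x2] [y1 y2] /=; rewrite mul0r subr0.
- by move=> e /inv; rewrite /cex => -[].
Qed.
End OneDim.
End Expectation.

Section Loop.
Variables (R : realType) (J : Type) (col : J -> bool) (d : nat) (E : expct R col d).
Local Notation C := R[i].
Local Notation Re := complex.Re.
Local Notation Im := complex.Im.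
Local Notation T := (J -> 'M[C]_d).

Lemma complexP (x y : C) : Re x = Re y -> Im x = Im y -> x = y.
Proof. by case: x y => ? ? [? ?] /= -> ->. Qed.

Lemma adjM m n p (A : 'M[C]_(m, n)) (B : 'M[C]_(n, p)) : adj (A *m B) = adj B *m adj A.
Proof. by rewrite /adj trmx_mul map_mxM. Qed.
Lemma adjK m n (A : 'M[C]_(m, n)) : adj (adj A) = A.
Proof. by apply/matrixP => i j; rewrite !mxE conjcK. Qed.
Lemma adjD m n (A B : 'M[C]_(m, n)) : adj (A + B) = adj A + adj B.
Proof. by apply/matrixP => i j; rewrite !mxE rmorphD. Qed.
Lemma adjZ m n a (A : 'M[C]_(m, n)) : adj (a *: A) = conjc a *: adj A.
Proof. by apply/matrixP => i j; rewrite !mxE rmorphM. Qed.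
Lemma adj1 : adj 1%:M = 1%:M :> 'M[C]_d.
Proof. by rewrite /adj trmx1 map_mx1. Qed.

Section Cayley.
Variable v : 'cV[C]_d.
Let P := v *m adj v.
Let n := l2sq v.

(* [1 + cay e *: P] is the Cayley transform [(1 + i e P) (1 - i e P)^-1], a
   rational curve of unitaries with derivative [2 i P] at [e = 0]. *)
Definition cay (e : R) : C :=
  (- 2 * e ^+ 2 * n / (1 + e ^+ 2 * n ^+ 2)) +i* (2 * e / (1 + e ^+ 2 * n ^+ 2)).

Definition cayV (e : R) : 'M[C]_d := 1%:M + cay e *: P.

Let den e : 0 < 1 + e ^+ 2 * n ^+ 2.
Proof. by rewrite ltr_pwDl // mulr_ge0 ?sqr_ge0. Qed.

Lemma adj_vv : adj P = P. Proof. by rewrite /P adjM adjK. Qed.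

(** [P] has rank one, so rational functions of [P] are affine in [P]; hence the simple form of the
    Cayley curve. *)
Lemma vvM : P *m P = n%:C *: P.
Proof.
rewrite /P mulmxA -(mulmxA v) (_ : adj v *m v = (n%:C)%:M); last first.
  apply/matrixP => i j; rewrite !ord1 !mxE eqxx mulr1n /n /l2sq raddf_sum.
  by apply: eq_bigr => k _; rewrite !mxE mulrC mulcJ_abs2.
by rewrite mul_mx_scalar -scalemxAl.
Qed.

Lemma cayV_unitary e : cayV e *m adj (cayV e) = 1%:M.
Proof.
rewrite /cayV adjD adj1 adjZ adj_vv mulmxDl mul1mx mulmxDr mulmx1 -scalemxAl -scalemxAr vvM.
rewrite -addrA !scalerA -!scalerDl (_ : conjc _ + _ = 0) ?scale0r ?addr0 //.
have D0 := den e; apply: complexP; rewrite /cay /=. all: field; by rewrite exprMn gt_eqF.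
Qed.

Definition mjet (F : R -> T -> 'M[C]_d) (F0 F1 : T -> 'M[C]_d) :=
  forall i j, jet E (fun e z => F e z i j) (fun z => F0 z i j) (fun z => F1 z i j).

Lemma jet_ext F F0 F1 G G0 G1 : jet E F F0 F1 -> (forall e z, F e z = G e z) ->
  (forall z, F0 z = G0 z) -> (forall z, F1 z = G1 z) -> jet E G G0 G1.
Proof.
move=> h h1 h2 h3; suff [<- <- <-] : [/\ F = G, F0 = G0 & F1 = G1] by [].
by split; [apply/funext => e; apply/funext => z| apply/funext|apply/funext].
Qed.

Lemma mjetM F F0 F1 G G0 G1 : mjet F F0 F1 -> mjet G G0 G1 ->
  mjet (fun e z => F e z *m G e z) (fun z => F0 z *m G0 z) (fun z => F1 z *m G0 z + F0 z *m G1 z).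
Proof.
move=> hF hG i j.
apply: (jet_ext (jet_sum (index_enum 'I_d) (fun k => jetM (hF i k) (hG k j)))) => [e z|z|z];
by rewrite !mxE // -big_split.
Qed.

Lemma mjet_cst (A : T -> 'M[C]_d) : (forall i j, ubd E (fun=> (fun z => A z i j))) -> mjet (fun=> A) A (fun=> 0).
Proof. by move=> h i j; apply: (jet_ext (jet_cst (h i j))) => // z; rewrite mxE. Qed.

Lemma jet_cay : jet E (fun e _ => cay e) (fun=> 0) (fun=> 0 +i* 2).
Proof.
(* The remainder [(cay e - 2 i e) / e ^ 2] in closed form, where no division by [e] is left. *)
exists (fun e _ => (- 2 * n / (1 + e ^+ 2 * n ^+ 2)) +i* (- 2 * e * n ^+ 2 / (1 + e ^+ 2 * n ^+ 2))).
split; try exact: ubd_cst.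
  exists (4 * n ^+ 2 + 4 * n ^+ 4) => e z /andP[e0 e1] _; rewrite /abs2 /=.
  have D0 := den e; set D := 1 + _ in D0 *.
  have D1 : 1 <= D by rewrite lerDl mulr_ge0 ?sqr_ge0.
  have iD : D^-1 ^+ 2 <= 1 by rewrite expr_le1 // ?invr_ge0 ?(ltW D0) // invf_le1.
  have iD0 : 0 <= D^-1 ^+ 2 by rewrite sqr_ge0.
  have n2 : 0 <= n ^+ 2 by rewrite sqr_ge0.
  have n4 : 0 <= n ^+ 4 by rewrite exprn_even_ge0.
  rewrite (_ : _ + _ = (4 * n ^+ 2 + e ^+ 2 * (4 * n ^+ 4)) * D^-1 ^+ 2); last by ring.
  apply: (@le_trans _ _ (4 * n ^+ 2 + e ^+ 2 * (4 * n ^+ 4))).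
    have e2 := sqr_ge0 e; rewrite ler_piMr //; have := mulr_ge0 e2 n4; lra.
  have e21 : 0 <= 1 - e ^+ 2 by rewrite subr_ge0 expr_le1 // ltW.
  by have := mulr_ge0 n4 e21; lra.
move=> e z he hz; have D0 := den e; apply: complexP; rewrite /cay -rmorphXn /=; field; by rewrite ?exprMn gt_eqF.
Qed.

Lemma mjet_cayV : mjet (fun e _ => cayV e) (fun=> 1%:M) (fun=> (0 +i* 2) *: P).
Proof.
move=> i j.
have h1 : jet E (fun _ _ => (1%:M : 'M[C]_d) i j) (fun=> (1%:M : 'M[C]_d) i j) (fun=> 0).
  by apply: jet_cst; exact: ubd_cst.
have h2 : jet E (fun _ _ => P i j) (fun=> P i j) (fun=> 0) by apply: jet_cst; exact: ubd_cst.
by apply: (jet_ext (jetD h1 (jetM jet_cay h2))) => [e z|z|z]; rewrite ?mxE //; ring.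
Qed.

Lemma mjet_adj F F0 F1 : mjet F F0 F1 ->
  mjet (fun e z => adj (F e z)) (fun z => adj (F0 z)) (fun z => adj (F1 z)).
Proof. by move=> h i j; apply: (jet_ext (jetJ (h j i))) => *; rewrite !mxE. Qed.

Variable k : bool.

(** A letter may be any matrix function; what counts is admissibility, boundedness and its behaviour
    under conjugation. Later a letter is a whole centred block. *)
Definition letter_ok (c : bool * (T -> 'M[C]_d)) :=
  [/\ madm E c.2, exists B, forall z, edom E z -> bnd B (c.2 z) &
      forall V z, V *m adj V = 1%:M ->
        c.2 (twist col k V z) = if c.1 then V *m c.2 z *m adj V else c.2 z].

Lemma mjet_letter c : letter_ok c ->
  mjet (fun e z => c.2 (twist col k (cayV e) z)) c.2
    (fun z => if c.1 then ((0 +i* 2) *: P) *m c.2 z - c.2 z *m ((0 +i* 2) *: P) else 0).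
Proof.
move=> [_ [B hB] hrot].
have hc : mjet (fun=> c.2) c.2 (fun=> 0).
  by apply: mjet_cst => i j; exists B => e z _ hz; apply: bnd_entry; exact: hB.
case: c hrot hB hc => -[] c /= hrot hB hc i j; last first.
  by apply: (jet_ext (hc i j)) => // e z; rewrite hrot // cayV_unitary.
have := mjetM (mjetM mjet_cayV hc) (mjet_adj mjet_cayV).
move=> /(_ i j) h; apply: (jet_ext h) => [e z|z|z].
- by rewrite hrot // cayV_unitary.
- by rewrite mul1mx adj1 mulmx1.
rewrite adj1 mulmx1 !mul1mx addr0 adjZ adj_vv.
by rewrite (_ : conjc (0 +i* 2) = - (0 +i* 2)) ?scaleNr ?mulmxN //; simpc.
Qed.

Lemma mjet_mprod cs : (forall c, List.In c cs -> letter_ok c) ->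
  mjet (fun e z => mprod (ev cs (twist col k (cayV e) z))) (fun z => mprod (ev cs z))
    (fun z => derp ((0 +i* 2) *: P) (ev cs z)).
Proof.
elim: cs => [|c cs IH] h /=.
  by apply: mjet_cst => i j; exact: ubd_cst.
have hc := mjet_letter (h c (or_introl erefl)).
have hcs := IH (fun c' hc' => h c' (or_intror hc')).
exact: (mjetM hc hcs).
Qed.

(** The adjoint inside the conjugation makes the expression complex linear in [Q], as polarization
    requires; the minus sign comes from [conjc i = - i]. *)
Definition loopf (H : 'M[C]_d) Q cs (z : T) : C :=
  \tr (H *m derp Q (ev cs z)) * conjc (ntr (mprod (ev cs z)))
  - \tr (H *m mprod (ev cs z)) * conjc (ntr (derp (adj Q) (ev cs z))).

Lemma cadm_ntr A : madm E A -> cadm E (fun z => ntr (A z)).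
Proof.
by move=> hA; rewrite /ntr; under eq_fun do rewrite mulrC; apply: cadmZ; exact: cadm_tr.
Qed.

Lemma letters_madm cs : (forall c, List.In c cs -> letter_ok c) ->
  forall c, List.In c cs -> madm E c.2.
Proof. by move=> h c /h[]. Qed.

Lemma cadm_loopf H Q cs : (forall c, List.In c cs -> letter_ok c) -> cadm E (loopf H Q cs).
Proof.
move=> /letters_madm h.
have m1 := madm_mprod h; have m2 P' := madm_derp P' h.
apply: cadmB; apply: cadmM.
- by apply: cadm_tr; apply: madmM => //; exact: madm_cst.
- by apply: cadmJ; exact: cadm_ntr.
- by apply: cadm_tr; apply: madmM => //; exact: madm_cst.
- by apply: cadmJ; apply: cadm_ntr.
Qed.

Lemma jet_tr F F0 F1 : mjet F F0 F1 ->
  jet E (fun e z => \tr (F e z)) (fun z => \tr (F0 z)) (fun z => \tr (F1 z)).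
Proof. by move=> h; apply: (jet_sum (index_enum 'I_d) (fun i => h i i)). Qed.

(* Up to the factor [2 i], [loopf H P cs] is the derivative at [e = 0] of
   [\tr (H W) * conjc (ntr W)] along [cayV], where [W] is the product of [cs]. *)
Lemma cex_loopf_vv H cs : (forall c, List.In c cs -> letter_ok c) -> cex E (loopf H P cs) = 0.
Proof.
move=> h; have hW := mjet_mprod h; set Q := (0 +i* 2) *: P in hW.
have hH : mjet (fun _ _ => H) (fun=> H) (fun=> 0) by apply: mjet_cst => i j; exact: ubd_cst.
have hd : jet E (fun _ _ => (d%:R)^-1) (fun=> d%:R^-1) (fun=> 0) by apply: jet_cst; exact: ubd_cst.
have := jetM (jet_tr (mjetM hH hW)) (jetJ (jetM (jet_tr hW) hd)).
set F0 := (fun z => _ * conjc _); set F1 := (fun z => _ + _) => hj.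
have m1 := madm_mprod (letters_madm h); have m2 P' := madm_derp P' (letters_madm h).
have aF0 : cadm E F0.
  by apply: cadmM; [apply: cadm_tr; apply: madmM => //; exact: madm_cst|apply: cadmJ; exact: cadm_ntr].
have F1E : F1 = (fun z => (0 +i* 2) * loopf H P cs z).
  apply/funext => z; rewrite /F1 /loopf /Q !derpZ mul0mx add0r mulr0 addr0.
  rewrite adj_vv /ntr -!scalemxAr !mxtraceZ !rmorphM /=.
  rewrite (_ : 0 -i* 2 = - (0 +i* 2)); last by simpc.
  by ring.
have := jet_ex_eq0 hj; rewrite F1E cexZ; last exact: cadm_loopf.
move=> hz; apply/eqP; have : (0 +i* 2 : C) * cex E (loopf H P cs) = 0.
  apply: hz => [e|||e he].
  - by have [a1 a2] := aF0; split; [exact: (adm_rot k (cayV_unitary e) a1)|exact: (adm_rot k (cayV_unitary e) a2)].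
  - exact: aF0.
  - by apply: cadmZ; exact: cadm_loopf.
  have [a1 a2] := aF0.
  rewrite /cex; congr (_ +i* _).
    exact: (ex_rot k (cayV_unitary e) a1).
  exact: (ex_rot k (cayV_unitary e) a2).
move=> /eqP; rewrite mulf_eq0 => /orP[|//].
by move=> /eqP h2; have := congr1 (@Im R) h2 => /= /eqP; rewrite pnatr_eq0.
Qed.
End Cayley.

Section Polarized.
Variables (k : bool) (cs : seq (bool * (T -> 'M[C]_d))).
Hypothesis hcs : forall c, List.In c cs -> letter_ok k c.

Lemma loopfD H Q Q' z : loopf H (Q + Q') cs z = loopf H Q cs z + loopf H Q' cs z.
Proof.
rewrite /loopf adjD !derpD mulmxDr mxtraceD /ntr mxtraceD.
by rewrite [(_ + _) / d%:R]mulrDl rmorphD /=; ring.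
Qed.

Lemma loopfZ H a Q z : loopf H (a *: Q) cs z = a * loopf H Q cs z.
Proof.
rewrite /loopf adjZ !derpZ -scalemxAr mxtraceZ /ntr mxtraceZ -!mulrA.
by rewrite [conjc (conjc a * _)]rmorphM /= conjcK; ring.
Qed.

(** Polarization: [4 E_ij] is the sum over the fourth roots of unity [a] of [a] times the rank-one
    matrix of [e_i + a e_j]. The case of rank one thus extends to matrix units by linearity of
    [loopf]. *)
Lemma cex_loopf_delta H i j : cex E (loopf H (delta_mx i j) cs) = 0.
Proof.
pose w (a : C) : 'cV[C]_d := delta_mx i 0 + a *: delta_mx j 0.
pose im : C := 0 +i* 1.
have wE a : w a *m adj (w a) = delta_mx i i + conjc a *: delta_mx i j + a *: delta_mx j i
    + (a * conjc a) *: delta_mx j j.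
  have aj l : adj (delta_mx l 0 : 'cV[C]_d) = delta_mx 0 l by rewrite /adj trmx_delta map_delta_mx.
  rewrite /w adjD adjZ !aj mulmxDl !mulmxDr -!scalemxAl -!scalemxAr !mul_delta_mx scalerA.
  by rewrite !addrA.
have c1 : conjc (1 : C) = 1 by apply: complexP; rewrite /= ?oppr0.
have c2 : conjc im = - im by apply: complexP; rewrite /= ?oppr0.
have c3 : conjc (- 1 : C) = - 1 by apply: complexP; rewrite /= ?oppr0.
have c4 : conjc (- im) = im by apply: complexP; rewrite /= ?oppr0 ?opprK.
have im2 : im * im = -1 by rewrite /im; simpc.
have dE : delta_mx i j = 4^-1 *: (w 1 *m adj (w 1) + im *: (w im *m adj (w im))
   + (-1) *: (w (-1) *m adj (w (-1))) + (- im) *: (w (- im) *m adj (w (- im)))).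
  rewrite !wE c1 c2 c3 c4 {wE w}.
  move: (delta_mx i i) (delta_mx i j) (delta_mx j i) (delta_mx j j) => M1 M2 M3 M4.
  apply/matrixP => x y; rewrite !mxE; move: (M1 x y) (M2 x y) (M3 x y) (M4 x y) => a b c e.
  set X := (X in _ = 4^-1 * X).
  have -> : X = 4 * b + (im * im + 1) * (2 * c - 2 * b) by rewrite /X; ring.
  by rewrite im2 addNr mul0r addr0 mulKf // pnatr_eq0.
have gen Q1 Q2 Q3 Q4 : cex E (loopf H Q1 cs) = 0 -> cex E (loopf H Q2 cs) = 0 ->
    cex E (loopf H Q3 cs) = 0 -> cex E (loopf H Q4 cs) = 0 ->
    cex E (loopf H (4^-1 *: (Q1 + im *: Q2 + (-1) *: Q3 + (- im) *: Q4)) cs) = 0.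
  move=> h1 h2 h3 h4.
  have a x := cadm_loopf H x hcs.
  have aZ b x := cadmZ b (a x).
  have E1 : loopf H (4^-1 *: (Q1 + im *: Q2 + (-1) *: Q3 + (- im) *: Q4)) cs =
    (fun z => 4^-1 * (loopf H Q1 cs z + im * loopf H Q2 cs z + (-1) * loopf H Q3 cs z
       + (- im) * loopf H Q4 cs z)).
    by apply/funext => z; rewrite loopfZ !loopfD !loopfZ.
  have a2 := cadmD (a Q1) (aZ im Q2).
  have a3 := cadmD a2 (aZ (-1) Q3).
  rewrite E1 cexZ; last exact: (cadmD a3 (aZ (- im) Q4)).
  rewrite (cexD a3 (aZ (- im) Q4)) (cexD a2 (aZ (-1) Q3)) (cexD (a Q1) (aZ im Q2)).
  rewrite (cexZ _ (a Q2)) (cexZ _ (a Q3)) (cexZ _ (a Q4)) h1 h2 h3 h4.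
  by rewrite !mulr0 !addr0 mulr0.
by rewrite dE; apply: gen; apply: (@cex_loopf_vv _ k).
Qed.

Definition gfun z : C := gsum 1%:M (ev cs z) / d%:R ^+ 2.
Definition wfun z : C := ntr (mprod (ev cs z)).

(* The terms where the derivative hits the conjugated factor: the two traces merge
   into a single one, so that [mergef] stays bounded while [gsum] is of order
   [d ^ 2]. *)
Definition mergef z : C :=
  \sum_i \sum_j \tr (delta_mx j i *m mprod (ev cs z)) * conjc (ntr (derp (delta_mx j i) (ev cs z))).

(** A Schwinger-Dyson equation: after summing over matrix units, the terms where the derivation hits
    the word factor into products of traces by [sum_derp], and the others form [mergef]. *)
Lemma cex_loop : cex E (fun z => gsum 1%:M (ev cs z) * conjc (wfun z)) = cex E mergef.
Proof.
have e0 : cex E (fun z => \sum_i \sum_j loopf (delta_mx j i) (delta_mx i j) cs z) = 0.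
  rewrite cex_sum => [|i]; last by apply: cadm_sum => j; exact: cadm_loopf hcs.
  rewrite big1 // => i _; rewrite cex_sum => [|j]; last exact: cadm_loopf hcs.
  by rewrite big1 // => j _; rewrite cex_loopf_delta.
have m1 := madm_mprod (letters_madm hcs); have m2 P' := madm_derp P' (letters_madm hcs).
have am : cadm E mergef.
  apply: cadm_sum => i; apply: cadm_sum => j; apply: cadmM.
    by apply: cadm_tr; apply: madmM => //; exact: madm_cst.
  by apply: cadmJ; apply: cadm_ntr.
have ag : cadm E (fun z => gsum 1%:M (ev cs z) * conjc (wfun z)).
  under eq_fun do rewrite -sum_derp.
  apply: cadmM; last by apply: cadmJ; exact: cadm_ntr.
  apply: cadm_sum => i; apply: cadm_sum => j; apply: cadm_tr.
  by apply: madmM => //; exact: madm_cst.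
apply/eqP; rewrite -subr_eq0 -cexB // -[X in _ == X]e0; apply/eqP; congr cex.
apply/funext => z; rewrite -sum_derp mulr_suml -sumrB; apply: eq_bigr => i _.
rewrite mulr_suml -sumrB; apply: eq_bigr => j _; rewrite /loopf mulmx1.
by rewrite /adj trmx_delta map_delta_mx.
Qed.

Hypothesis d0 : (0 < d)%N.

(** In entries, [mergef] is [d^-1] times a Hilbert-Schmidt inner product of two matrices whose
    squared Frobenius norms are at most [d * K] and [d * KQ]; the powers of [d] cancel. *)
Lemma Re_merge_le z K KQ : bnd K (mprod (ev cs z)) -> bnd KQ (qmat 1%:M (ev cs z)) ->
  Re (mergef z) <= K + KQ.
Proof.
move=> hK hQ; have dR : 0 < d%:R :> R by rewrite ltr0n.
have -> : mergef z = (d%:R^-1)%:C * \sum_i \sum_j mprod (ev cs z) i j * conjc (qmat 1%:M (ev cs z) i j).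
  rewrite mulr_sumr; apply: eq_bigr => i _; rewrite mulr_sumr; apply: eq_bigr => j _.
  rewrite tr_delta /ntr -[derp _ _]mul1mx tr_derp tr_delta rmorphM /= fmorphV rmorph_nat /=.
  by rewrite fmorphV rmorph_nat /=; ring.
have ReRM (a : R) (x : C) : Re (a%:C * x) = a * Re x by case: x => x y /=; rewrite mul0r subr0.
rewrite ReRM raddf_sum /= mulrC ler_pdivrMr //.
apply: (@le_trans _ _ (\sum_i \sum_j (abs2 (mprod (ev cs z) i j) + abs2 (qmat 1%:M (ev cs z) i j)))).
  apply: ler_sum => i _; rewrite raddf_sum /=; apply: ler_sum => j _.
  case: (mprod _ _ _) => a b; case: (qmat _ _ _ _) => a' b'; rewrite /abs2 /=.
  have := sqr_ge0 (a - a'); have := sqr_ge0 (b - b').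
  have := sqr_ge0 a; have := sqr_ge0 b; have := sqr_ge0 a'; have := sqr_ge0 b'.
  nra.
rewrite mulrDl; under eq_bigr do rewrite big_split.
by rewrite big_split lerD // mulrC; apply: bnd_frob.
Qed.

(* [|w| ^ 2 <= 2 Re (g w^* ) + |w - g| ^ 2], and the loop equation bounds the first term. *)
Lemma loop_ineq B : (forall z, edom E z -> Re (mergef z) <= B) ->
  ex E (fun z => abs2 (wfun z)) <= ex E (fun z => abs2 (wfun z - gfun z)) + 2 * (B / d%:R ^+ 2).
Proof.
move=> hB; have dR : 0 < d%:R :> R by rewrite ltr0n.
have m1 := madm_mprod (letters_madm hcs); have m2 P' := madm_derp P' (letters_madm hcs).
have aw : cadm E wfun by exact: cadm_ntr.
have ags : cadm E (fun z => gsum 1%:M (ev cs z)).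
  under eq_fun do rewrite -sum_derp.
  apply: cadm_sum => i; apply: cadm_sum => j; apply: cadm_tr.
  by apply: madmM => //; exact: madm_cst.
have ag : cadm E gfun by rewrite /gfun; under eq_fun do rewrite mulrC; exact: cadmZ.
have agw : cadm E (fun z => gfun z * conjc (wfun z)) by apply: cadmM => //; exact: cadmJ.
have am : cadm E mergef.
  apply: cadm_sum => i; apply: cadm_sum => j; apply: cadmM.
    by apply: cadm_tr; apply: madmM => //; exact: madm_cst.
  by apply: cadmJ; apply: cadm_ntr.
have key : ex E (fun z => Re (gfun z * conjc (wfun z))) <= B / d%:R ^+ 2.
  rewrite -Re_cex (_ : (fun z => _) = (fun z => (d%:R ^- 2)%:C * (gsum 1%:M (ev cs z) * conjc (wfun z)))); last first.
    by apply/funext => z; rewrite /gfun fmorphV rmorphXn /= rmorph_nat; ring.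
  rewrite cexZ; last by apply: cadmM => //; exact: cadmJ.
  have ReRM (a : R) (x : C) : Re (a%:C * x) = a * Re x by case: x => x y /=; rewrite mul0r subr0.
  rewrite cex_loop ReRM mulrC ler_pM2r ?invr_gt0 ?exprn_gt0 // Re_cex.
  rewrite -[leRHS](ex_cst E); apply: ex_le => //; [by case: am|exact: adm_cst].
have half : ex E (fun z => abs2 (wfun z)) <=
   ex E (fun z => 2 * Re (gfun z * conjc (wfun z)) + abs2 (wfun z - gfun z)).
  apply: ex_le => [||z hz].
  - exact: adm_abs2.
  - by apply: admD; [apply: admZ; case: agw|apply: adm_abs2; exact: cadmB].
  case: (wfun z) (gfun z) => [a b] [a' b']; rewrite /abs2 /= -subr_ge0.
  rewrite [X in 0 <= X](_ : _ = a' ^+ 2 + b' ^+ 2); last by ring.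
  by rewrite addr_ge0 ?sqr_ge0.
apply: (le_trans half); rewrite exD; last 2 first.
- by apply: admZ; case: agw.
- by apply: adm_abs2; exact: cadmB.
rewrite exZ; last by case: agw.
by rewrite addrC lerD2l ler_pM2l.
Qed.
End Polarized.
End Loop.

Lemma In_cat (X : Type) (x : X) (a b : seq X) : List.In x (a ++ b) <-> List.In x a \/ List.In x b.
Proof. by elim: a => [|y a IH] /=; [split; [right|case]|rewrite IH; tauto]. Qed.

(** * Asymptotic freeness *)

Section Sequences.
Variables (R : realType) (J : Type) (col : J -> bool) (dk : nat -> nat).
Hypothesis dk_gt : forall k, (k < dk k)%N.
Variable E : forall k, expct R col (dk k).
Local Notation C := R[i].
Local Notation T k := (J -> 'M[C]_(dk k)).
Definition fam := forall k, T k -> C.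
Definition mfam := forall k, T k -> 'M[C]_(dk k).

Definition fadm (f : fam) := forall k, cadm (E k) (f k).
Definition fbdd (f : fam) := exists B : R, forall k z, edom (E k) z -> abs2 (f k z) <= B.
(** The dimension varies with [k], so there is no common probability space; smallness is expressed
    by second moments along the sequence. *)
Definition null (f : fam) := (fun k => ex (E k) (fun z => abs2 (f k z))) @ \oo --> (0 : R).

Lemma null_squeeze (f : fam) (u : nat -> R) : fadm f ->
  (forall k, ex (E k) (fun z => abs2 (f k z)) <= u k) -> u @ \oo --> (0 : R) -> null f.
Proof.
move=> af h hu; apply: (@squeeze_cvgr _ _ _ _ (fun=> 0) u) => //; last exact: cvg_cst.
near=> k; rewrite h andbT; apply: ex_ge0; first exact/adm_abs2/af.
by move=> z _; exact: abs2_ge0.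
Unshelve. all: by end_near. Qed.

Lemma null_ext (f g : fam) : null f -> (forall k z, f k z = g k z) -> null g.
Proof.
move=> hf h; rewrite (_ : g = f) //.
by apply/functional_extensionality_dep => k; apply/funext => z; rewrite h.
Qed.

Lemma nullD (f g : fam) : fadm f -> fadm g -> null f -> null g -> null (fun k z => f k z + g k z).
Proof.
move=> af ag hf hg; apply: (@null_squeeze _ (fun k => 2 * ex (E k) (fun z => abs2 (f k z)) +
   2 * ex (E k) (fun z => abs2 (g k z)))).
- by move=> k; apply: cadmD.
- move=> k; have a1 := adm_abs2 (af k); have a2 := adm_abs2 (ag k).
  rewrite -!exZ // -exD; try exact: admZ.
  apply: ex_le; [exact/adm_abs2/cadmD|by apply: admD; exact: admZ|move=> z _; exact: abs2D].
rewrite [X in _ --> X](_ : 0 = 2 * 0 + 2 * 0); last by rewrite !mulr0 addr0.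
by apply: cvgD; apply: cvgM => //; exact: cvg_cst.
Qed.

Lemma nullM (f g : fam) : fadm f -> fadm g -> null f -> fbdd g -> null (fun k z => f k z * g k z).
Proof.
move=> af ag hf [B hB]; apply: (@null_squeeze _ (fun k => B * ex (E k) (fun z => abs2 (f k z)))).
- by move=> k; apply: cadmM.
- move=> k; have a1 := adm_abs2 (af k); rewrite -exZ //.
  apply: ex_le; [exact/adm_abs2/cadmM|exact: admZ|move=> z hz].
  by rewrite abs2M mulrC ler_wpM2r ?abs2_ge0 // hB.
rewrite [X in _ --> X](_ : 0 = B * 0); last by rewrite mulr0.
by apply: cvgM => //; exact: cvg_cst.
Qed.

Lemma null0 : null (fun _ _ => 0).
Proof.
rewrite /null; under eq_fun do rewrite abs20 ex_cst; exact: cvg_cst.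
Qed.

Lemma nullZ a (f : fam) : fadm f -> null f -> null (fun k z => a * f k z).
Proof.
move=> af hf; apply: (null_ext (nullM af _ hf _)) => [k||k z].
- exact: (cadm_cst (E k) a).
- by exists (abs2 a).
exact: mulrC.
Qed.

Lemma nullB (f g : fam) : fadm f -> fadm g -> null f -> null g -> null (fun k z => f k z - g k z).
Proof.
move=> af ag hf hg; apply: (null_ext (nullD af _ hf (nullZ (-1) ag hg))) => [k|k z].
  exact: cadmZ.
by rewrite mulN1r.
Qed.

Definition letter := (bool * mfam)%type.

Definition good (c : letter) :=
  [/\ forall k, madm (E k) (c.2 k),
      exists B : R, forall k z, edom (E k) z -> bnd B (c.2 k z) &
      forall k κ V z, V *m adj V = 1%:M ->
        c.2 k (twist col κ V z) = if c.1 == κ then V *m c.2 k z *m adj V else c.2 k z].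

(** The flags are recomputed for each rotated colour: they say whether a letter moves, while the
    first component of a letter keeps its colour. The product of the matrices does not depend on
    them. *)
Definition atk (κ : bool) (cs : seq letter) k : seq (bool * (T k -> 'M[C]_(dk k))) :=
  [seq (c.1 == κ, c.2 k) | c <- cs].

Definition mw (cs : seq letter) : mfam := fun k z => mprod (ev (atk true cs k) z).
Definition tw (cs : seq letter) : fam := fun k z => ntr (mw cs z).

Lemma mprod_at κ cs k z : mprod (ev (atk κ cs k) z) = mw cs z.
Proof. by rewrite /mw; elim: cs => //= c cs ->. Qed.

Definition goods cs := forall c, List.In c cs -> good c.

Lemma goods_cat a b : goods (a ++ b) <-> goods a /\ goods b.
Proof.
split=> [h|[ha hb] c /In_cat[/ha|/hb] //].
by split=> c hc; apply: h; apply/In_cat; [left|right].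
Qed.

Lemma goods_at κ cs k : goods cs -> forall c, List.In c (atk κ cs k) -> letter_ok (E k) κ c.
Proof.
move=> h c; elim: cs h => [|c' cs IH] h //= [<-|]; last by apply: IH => x hx; apply: h; right.
have [h1 [B hB] h3] := h c' (or_introl erefl); split => //=; first by exists B => z; apply: hB.
by move=> V z hV; exact: h3.
Qed.

Lemma goods_madm cs k : goods cs -> madm (E k) (mw cs (k := k)).
Proof.
move=> h; apply: madm_mprod; apply: (@letters_madm _ _ _ _ (E k) true).
exact: goods_at.
Qed.

Lemma goods_fadm cs : goods cs -> fadm (tw cs).
Proof. by move=> h k; apply: cadm_ntr; exact: goods_madm. Qed.

Lemma goods_bnd cs : goods cs -> exists B, forall k z, edom (E k) z -> bnd B (mw cs z).
Proof.
elim: cs => [|c cs IH] h; first by exists 1 => k z _; exact: bnd1.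
have [B1 h1] := IH (fun c hc => h c (or_intror hc)).
have [_ [B2 h2] _] := h c (or_introl erefl).
by exists (B2 * B1) => k z hz; apply: bndM; [exact: h2|exact: h1].
Qed.

Lemma goods_fbdd cs : goods cs -> fbdd (tw cs).
Proof. by move=> /goods_bnd[B h]; exists B => k z hz; apply: bnd_ntr; exact: h. Qed.

Lemma mw_cat a b k (z : T k) : mw (a ++ b) z = mw a z *m mw b z.
Proof. by rewrite /mw /atk /ev !map_cat mprod_cat. Qed.

Lemma qmat_bnd κ cs pre : goods cs -> goods pre ->
  exists B, forall k z, edom (E k) z -> bnd B (qmat (mw pre z) (ev (atk κ cs k) z)).
Proof.
elim: cs pre => [|c cs IH] pre hcs hpre; first by exists 0 => k z _; exact: bnd0.
have gc : goods [:: c] by move=> x [<-|//]; apply: hcs; left.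
have gcs : goods cs by move=> x hx; apply: hcs; right.
have [B1 h1] := IH (pre ++ [:: c]) gcs (proj2 (goods_cat _ _) (conj hpre gc)).
have [B2 h2] := goods_bnd (proj2 (goods_cat _ _) (conj hcs hpre)).
have [B3 h3] := goods_bnd (proj2 (goods_cat _ _) (conj (proj2 (goods_cat _ _) (conj gcs hpre)) gc)).
exists (2 * (2 * B2 + 2 * B3) + 2 * B1) => k z hz /=.
apply: bndD; last by have := h1 k z hz; rewrite mw_cat /= /mw /= mulmx1.
rewrite mprod_at; have b2 := h2 k z hz; have b3 := h3 k z hz.
case: (c.1 == κ).
  by apply: bndB; [move: b2; rewrite mw_cat|move: b3; rewrite !mw_cat /mw /= mulmx1].
by apply: bnd_le (bnd0 _ _); have := b2.1; have := b3.1; lra.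
Qed.

(** Each term of [gsum], divided by [d ^ 2], is a product of two normalised traces; the first is
    that of a prefix and null by hypothesis, the second is bounded. The word [pre] is the
    accumulator of the recursion. *)
Lemma gsum_null κ cs pre : goods cs -> goods pre ->
  (forall v1 x v2, cs = v1 ++ x :: v2 -> x.1 == κ ->
     null (tw (pre ++ v1)) /\ null (tw (pre ++ v1 ++ [:: x]))) ->
  fadm (fun k z => gsum (mw pre z) (ev (atk κ cs k) z) / (dk k)%:R ^+ 2) /\
  null (fun k z => gsum (mw pre z) (ev (atk κ cs k) z) / (dk k)%:R ^+ 2).
Proof.
elim: cs pre => [|c cs IH] pre hcs hpre h.
  split=> [k|] /=; first by under eq_fun do rewrite mul0r; exact: cadm_cst.
  by apply: (null_ext null0) => k z; rewrite mul0r.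
have gc : goods [:: c] by move=> x [<-|//]; apply: hcs; left.
have gcs : goods cs by move=> x hx; apply: hcs; right.
have gpc : goods (pre ++ [:: c]) by apply/goods_cat.
have [a1 n1] : fadm (fun k z => gsum (mw (pre ++ [:: c]) z) (ev (atk κ cs k) z) / (dk k)%:R ^+ 2) /\
  null (fun k z => gsum (mw (pre ++ [:: c]) z) (ev (atk κ cs k) z) / (dk k)%:R ^+ 2).
  apply: IH => // v1 x v2 e hx; rewrite -!catA /=.
  by apply: (h (c :: v1) x v2) => //=; rewrite e.
pose t : fam := fun k z => if c.1 == κ then
   tw pre z * tw (c :: cs) z - tw (pre ++ [:: c]) z * tw cs z else 0.
have at' : fadm t.
  rewrite /t; case: (c.1 == κ) => k; last exact: cadm_cst.
  by apply: cadmB; apply: cadmM; apply: goods_fadm.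
have nt : null t.
  rewrite /t; case: (boolP (c.1 == κ)) => ck; last exact: null0.
  have [p q] := h [::] c cs erefl ck; rewrite cats0 in p; rewrite cat0s in q.
  have g1 := goods_fadm hpre; have g2 := goods_fadm hcs.
  have g3 := goods_fadm gpc; have g4 := goods_fadm gcs.
  apply: nullB; [by move=> k; apply: cadmM|by move=> k; apply: cadmM| |].
    exact: nullM g1 g2 p (goods_fbdd hcs).
  exact: nullM g3 g4 q (goods_fbdd gcs).
have tE k z : t k z + gsum (mw (pre ++ [:: c]) z) (ev (atk κ cs k) z) / (dk k)%:R ^+ 2 =
   gsum (mw pre z) (ev (atk κ (c :: cs) k) z) / (dk k)%:R ^+ 2.
  have d0 : (dk k)%:R != 0 :> C by rewrite pnatr_eq0 -lt0n (leq_ltn_trans _ (dk_gt k)).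
  rewrite [gsum (mw pre z) _]/= mulrDl mprod_at; congr (_ + _); last first.
    by rewrite mw_cat /mw /= mulmx1.
  rewrite /t; case: (c.1 == κ); last by rewrite mul0r.
  by rewrite /tw /ntr mw_cat /mw /= mulmx1; field.
split; first by move=> k; rewrite -(funext (tE k)); exact: cadmD.
exact: (null_ext (nullD at' a1 nt n1) tE).
Qed.

(** As the first letter is flagged, [gsum] contains [d] times the trace of the word, which
    normalises to the word itself. What remains of [w - g] is [tw [:: c] * tw v], null by the
    hypothesis on [c], and terms with null prefixes; merging costs only [O(d ^- 2)]. *)
Lemma loop_null κ c v : goods (c :: v) -> c.1 == κ -> null (tw [:: c]) ->
  (forall v1 x v2, v = v1 ++ x :: v2 -> x.1 == κ ->
     null (tw (c :: v1)) /\ null (tw (c :: v1 ++ [:: x]))) ->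
  null (tw (c :: v)).
Proof.
move=> hcv ck nc h.
have gc : goods [:: c] by move=> x [<-|//]; apply: hcv; left.
have gv : goods v by move=> x hx; apply: hcv; right.
have [ag ng] := gsum_null gv gc h.
have nX : null (fun k z => tw [:: c] z * tw v z -
    gsum (mw [:: c] z) (ev (atk κ v k) z) / (dk k)%:R ^+ 2).
  have a1 := goods_fadm gc; have a2 := goods_fadm gv.
  apply: nullB => //; first by move=> k; apply: cadmM.
  exact: nullM a1 a2 nc (goods_fbdd gv).
have [K hK] := goods_bnd hcv.
have g0 : goods [::] by [].
have [KQ hKQ] := qmat_bnd κ hcv g0.
apply: (@null_squeeze _ (fun k => ex (E k) (fun z => abs2 (tw [:: c] z * tw v z -
    gsum (mw [:: c] z) (ev (atk κ v k) z) / (dk k)%:R ^+ 2)) + 2 * ((`|K| + `|KQ|) / k.+1%:R))).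
- exact: goods_fadm.
- move=> k; have d0 : (0 < dk k)%N by rewrite (leq_ltn_trans _ (dk_gt k)).
  have hm z : edom (E k) z -> complex.Re (mergef (atk κ (c :: v) k) z) <= `|K| + `|KQ|.
    move=> hz; apply: (@le_trans _ _ (K + KQ)); last by rewrite lerD // ler_norm.
    apply: (Re_merge_le d0); first by rewrite mprod_at; exact: hK.
    by have := hKQ k z hz; rewrite /mw /=.
  have := loop_ineq (goods_at hcv (k := k)) d0 hm.
  rewrite /wfun (_ : (fun z => abs2 (ntr (mprod (ev (atk κ (c :: v) k) z)))) =
    (fun z => abs2 (tw (c :: v) z))); last by apply/funext => z; rewrite mprod_at.
  move=> /le_trans; apply; rewrite lerD //.
    rewrite le_eqVlt; apply/orP; left; apply/eqP; congr ex; apply/funext => z; congr abs2.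
    have dd0 : (dk k)%:R != 0 :> C by rewrite pnatr_eq0 -lt0n.
    rewrite /gfun mprod_at [gsum _ _]/= ck mul1mx mxtrace1 mprod_at.
    have -> : mw [:: c] z = c.2 k z by rewrite /mw /= mulmx1.
    rewrite /tw /ntr (_ : mw [:: c] z = c.2 k z); last by rewrite /mw /= mulmx1.
    rewrite (_ : mw (c :: v) z = c.2 k z *m mw v z) //.
    by move: (gsum _ _) (\tr (c.2 k z)) (\tr (mw v z)) => x y w; field.
  have dR : 0 < (dk k)%:R :> R by rewrite ltr0n.
  (* From [k + 1 <= dk k <= dk k ^ 2] the error is dominated by a harmonic sequence. *)
  rewrite ler_pM2l // ler_wpM2l ?addr_ge0 // lef_pV2 ?posrE ?exprn_gt0 ?ltr0n //.
  rewrite -natrX ler_nat (leq_trans (dk_gt k)) // -[leqLHS]expn1.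
  exact: leq_pexp2l.
rewrite [X in _ --> X](_ : 0 = 0 + 2 * ((`|K| + `|KQ|) * 0)); last by rewrite !mulr0 addr0.
apply: cvgD; first exact: nX.
apply: cvgM; first exact: cvg_cst.
by apply: cvgM; [exact: cvg_cst|exact: cvg_harmonic].
Qed.

Definition alternate (cs : seq letter) := sorted (fun a b : bool => a != b) (map fst cs).

Lemma alternate_catl a b : alternate (a ++ b) -> alternate a.
Proof. by rewrite /alternate map_cat => /cat_sorted2[]. Qed.

Lemma alternate_cons c v : alternate (c :: v) -> alternate v.
Proof. by rewrite /alternate /= => /path_sorted. Qed.

Lemma tw_rot c v k (z : T k) : tw (v ++ [:: c]) z = tw (c :: v) z.
Proof.
rewrite /tw /ntr mw_cat (_ : mw [:: c] z = c.2 k z); last by rewrite /mw /= mulmx1.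
by rewrite mxtrace_mulC.
Qed.

(* Induction on the length. If the first and last colours differ, each term of
   [gsum] for the first letter has a factor that is the trace of a shorter
   alternating word; if they agree, rotate the first letter to the end and use the
   second one. *)
Lemma free_null cs : goods cs -> (forall c, List.In c cs -> null (tw [:: c])) ->
  cs <> [::] -> alternate cs -> null (tw cs).
Proof.
have [N] := ubnP (size cs); elim: N cs => // N IH [//|c v] /ltnSE szN gcs ncs _ alt.
have sub p q : p ++ q = c :: v -> p <> [::] -> q <> [::] -> null (tw p).
  move=> e p0 q0; apply: IH => //.
  - have : (size p + size q)%N = (size v).+1 by rewrite -size_cat e.
    by case: q q0 {e} => // x q _ /=; move: szN => /=; lia.
  - by move: gcs; rewrite -e => /goods_cat[].
  - by move=> x hx; apply: ncs; rewrite -e; apply/In_cat; left.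
  - by move: alt; rewrite -e; exact: alternate_catl.
have nc : null (tw [:: c]) by apply: ncs; left.
have [|lc] := boolP (c.1 == (last c v).1); last first.
  apply: (@loop_null c.1) => // v1 x v2 e hx.
  have v20 : v2 <> [::].
    by move=> v20; move: lc; rewrite e v20 last_cat /= eq_sym hx.
  split; first by apply: (sub (c :: v1) (x :: v2)); rewrite /= ?e.
  by apply: (sub (c :: v1 ++ [:: x]) v2); rewrite //= e -catA.
case: v sub szN gcs ncs alt => [//|c' v] sub szN gcs ncs alt lc.
have ac : c.1 != c'.1 by move: alt; rewrite /alternate /= => /andP[].
have gv : goods (c' :: v) by move=> x hx; apply: gcs; right.
have sub' p q : p ++ q = c' :: v -> p <> [::] -> null (tw p).
  move=> e p0; apply: IH => //.
  - have : (size p + size q)%N = (size v).+1 by rewrite -size_cat e.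
    by move: szN => /=; lia.
  - by move: gv; rewrite -e => /goods_cat[].
  - by move=> x hx; apply: ncs; right; rewrite -e; apply/In_cat; left.
  - by move: alt => /alternate_cons; rewrite -e; exact: alternate_catl.
(* The rotated word ends with two letters of equal colour, so it is not alternating. But prefixes
   ending at or just before a letter of the colour of [c'] never reach [c], hence they are
   alternating and shorter. *)
apply: (null_ext _ (tw_rot c (c' :: v))) => /=.
apply: (@loop_null c'.1) => //.
- move=> x /= [<-|/In_cat[hx|[<-|//]]]; apply: gcs; [right; left|right; right|left] => //.
- by apply: ncs; right; left.
move=> v1 x v2; case/lastP: v2 => [|v2 y].
  rewrite !cats1 => /rcons_inj[_ cx] hx; move: ac; rewrite -cx in hx.
  by rewrite (eqP hx) eqxx.
rewrite -rcons_cons -rcons_cat cats1 => /rcons_inj[e _] hx.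
split; first by apply: (sub' (c' :: v1) (x :: v2)); rewrite /= ?e.
by apply: (sub' (c' :: v1 ++ [:: x]) v2); rewrite //= e -catA.
Qed.
End Sequences.

(** * Moments of bi-free pairs *)

Section BiFreeMoments.
Variables (R : realType) (A : cstarAlg R) (phi : {scalar A}) (n m : nat).
Variables (X : 'I_n -> A) (Y : 'I_m -> A) (p q : nat).
Local Notation C := R[i].
Local Notation L := ('I_n + 'I_m)%type.

Definition colour (s : L) : bool := match s with inl i => (i < p)%N | inr j => (j < q)%N end.
Definition isY (s : L) : bool := if s is inr _ then true else false.

Definition xs (u : seq L) : seq 'I_n := pmap (fun s => if s is inl i then Some i else None) u.
Definition ys (u : seq L) : seq 'I_m := pmap (fun s => if s is inr j then Some j else None) u.

(* Right variables are listed in reversed order, as in the matrix words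
   [A_(i_1) .. A_(i_p) B_(j_q) .. B_(j_1)]. *)
Definition phihat (u : seq L) : C :=
  phi (\prod_(i <- xs u) X i * \prod_(j <- rev (ys u)) Y j).

(** Left letters come before right ones. Stated pairwise, the property passes to subsequences, so
    all words in the expansion of a centred product inherit it. *)
Definition xy_sorted (u : seq L) := pairwise (fun a b => ~~ (isY a && ~~ isY b)) u.

Definition block := (bool * seq L)%type.
Definition mono (b : block) := all (fun s => colour s == b.1) b.2.

(* The formal expansion of the product of the [w - phihat w] over blocks [w], as a
   list of coefficients and words. *)
Fixpoint cent (bs : seq block) : seq (C * seq L) :=
  if bs is b :: bs' then
    [seq (cu.1, b.2 ++ cu.2) | cu <- cent bs'] ++
    [seq (- phihat b.2 * cu.1, cu.2) | cu <- cent bs']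
  else [:: (1, [::])].

Lemma xs_cat u v : xs (u ++ v) = xs u ++ xs v. Proof. exact: pmap_cat. Qed.
Lemma ys_cat u v : ys (u ++ v) = ys u ++ ys v. Proof. exact: pmap_cat. Qed.

Definition csum (V : lmodType C) (f : seq L -> V) (s : seq (C * seq L)) : V :=
  \sum_(cu <- s) cu.1 *: f cu.2.

Lemma csum_cent (V : lmodType C) (f : seq L -> V) b bs :
  csum f (cent (b :: bs)) = csum (fun u => f (b.2 ++ u)) (cent bs) - phihat b.2 *: csum f (cent bs).
Proof.
rewrite /csum /= big_cat !big_map /=; congr (_ + _).
rewrite scaler_sumr -sumrN; apply: eq_bigr => cu _.
by rewrite scalerA mulNr scaleNr.
Qed.

Lemma cent_all (P : pred L) bs : all P (flatten (map snd bs)) ->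
  forall cu, cu \in cent bs -> all P cu.2.
Proof.
elim: bs => [|b bs IH] /=; first by move=> _ cu; rewrite inE => /eqP ->.
rewrite all_cat => /andP[Pb Pbs] cu; rewrite mem_cat => /orP[] /mapP[cu' h ->] /=.
  by rewrite all_cat Pb IH.
exact: IH.
Qed.

Lemma eq_csum (V : lmodType C) (f g : seq L -> V) s :
  (forall cu, cu \in s -> f cu.2 = g cu.2) -> csum f s = csum g s.
Proof. by move=> h; apply: eq_big_seq => cu /h ->. Qed.

Lemma csum_linear (V W : lmodType C) (h : V -> W) (f : seq L -> V) s : linear h ->
  h (csum f s) = csum (h \o f) s.
Proof.
move=> lh; elim: s => [|cu s IH]; last by rewrite /csum !big_cons lh -/(csum f s) IH.
rewrite /csum !big_nil; have := lh 1 0 0.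
by rewrite scaler0 addr0 scale1r => /eqP; rewrite -subr_eq0 opprD addNKr oppr_eq0 => /eqP.
Qed.

Variables (E : bool -> lmodType C) (F : free_product E).
Variables (l r : forall k, A -> {linear (C^o * E k)%type -> (C^o * E k)%type}).
Variables (lambda rho : forall k, {linear (C^o * E k)%type -> (C^o * E k)%type} -> {linear F -> F}).
Variable coef : {scalar F}.
Hypothesis hl : forall (k : bool) (T : {linear (C^o * E k)%type -> (C^o * E k)%type}), is_left_action T (lambda T).
Hypothesis hr : forall (k : bool) (T : {linear (C^o * E k)%type -> (C^o * E k)%type}), is_right_action T (rho T).
Hypothesis hc : is_xi_coefficient coef.

Definition vx (is_ : seq 'I_n) (v : F) : F :=
  foldr (fun i : 'I_n => lambda (l (i < p)%N (X i))) v is_.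
Definition vy (js : seq 'I_m) (v : F) : F :=
  foldr (fun j : 'I_m => rho (r (j < q)%N (Y j))) v js.
Definition lx k (is_ : seq 'I_n) (x : (C^o * E k)%type) : (C^o * E k)%type :=
  foldr (fun i => l k (X i)) x is_.
Definition ry k (js : seq 'I_m) (x : (C^o * E k)%type) : (C^o * E k)%type :=
  foldr (fun j => r k (Y j)) x js.

Definition xi : F := fp_tens F [::].
Definition vec (u : seq L) : F := vx (xs u) (vy (rev (ys u)) xi).
Hypothesis hphi : forall u, phihat u = coef (vec u).

Lemma vx_linear is_ : linear (vx is_).
Proof. by move=> a u v; elim: is_ => //= i is_ ->; rewrite linearP. Qed.
Lemma vy_linear js : linear (vy js).
Proof. by move=> a u v; elim: js => //= i is_ ->; rewrite linearP. Qed.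

Lemma tens0l k (u v : seq {k & E k}) : Defs.alternating (indices u ++ k :: indices v) ->
  fp_tens F (u ++ Tagged E (0 : E k) :: v) = 0.
Proof.
move=> h; have := @fp_multilinear _ _ _ F u v k 1 0 0 h.
by rewrite scaler0 addr0 scale1r => /eqP; rewrite -subr_eq0 opprD addNKr oppr_eq0 => /eqP.
Qed.

Lemma fp_V1 k w : Defs.alternating (k :: indices w) -> fp_V F ((1, 0) : (C^o * E k)%type) w = fp_tens F w.
Proof. by move=> h; rewrite /fp_V /= (@tens0l k [::]) // addr0 scale1r. Qed.

Lemma fp_W1 k w : Defs.alternating (rcons (indices w) k) ->
  fp_W F w ((1, 0) : (C^o * E k)%type) = fp_tens F w.
Proof.
move=> h; rewrite /fp_W /= -cats1 (@tens0l k w [::]) ?addr0 ?scale1r //.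
by rewrite cats1.
Qed.

Lemma vx_fp_V k is_ (x : (C^o * E k)%type) w : all (fun i : 'I_n => (i < p)%N == k) is_ ->
  Defs.alternating (k :: indices w) -> vx is_ (fp_V F x w) = fp_V F (lx is_ x) w.
Proof.
move=> h aw; elim: is_ h => //= i is_ IH /andP[/eqP ik h]; rewrite IH // ik.
exact: hl.
Qed.

Lemma vy_fp_W k js (x : (C^o * E k)%type) w : all (fun j : 'I_m => (j < q)%N == k) js ->
  Defs.alternating (rcons (indices w) k) -> vy js (fp_W F w x) = fp_W F w (ry js x).
Proof.
move=> h aw; elim: js h => //= j js IH /andP[/eqP jk h]; rewrite IH // jk.
exact: hr.
Qed.

Lemma mono_xs b : mono b -> all (fun i : 'I_n => (i < p)%N == b.1) (xs b.2).
Proof. by case: b => k; elim=> //= -[i|j] u IH /= /andP[h /IH h'] //=; rewrite h. Qed.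
Lemma mono_ys b : mono b -> all (fun j : 'I_m => (j < q)%N == b.1) (ys b.2).
Proof. by case: b => k; elim=> //= -[i|j] u IH /= /andP[h /IH h'] //=; rewrite h. Qed.

Definition yvec (b : block) : (C^o * E b.1)%type := ry (rev (ys b.2)) (1, 0).
Definition bvec (b : block) : (C^o * E b.1)%type := lx (xs b.2) (yvec b).

Lemma vy_mono b w : mono b -> Defs.alternating (rcons (indices w) b.1) ->
  vy (rev (ys b.2)) (fp_tens F w) = fp_W F w (yvec b).
Proof.
move=> mb aw; rewrite -(fp_W1 aw) vy_fp_W // all_rev; exact: mono_ys.
Qed.

Lemma phihat_mono b : mono b -> phihat b.2 = (bvec b).1.
Proof.
(* Against the empty word [V_k] and [W_k] coincide, so the two faces act on one and the same vector
   of a single factor. *)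
move=> mb; rewrite hphi /vec /xi vy_mono // -[fp_W F [::] _]/(fp_V F (yvec b) [::]).
rewrite vx_fp_V ?mono_xs // /fp_V raddfD /= linearZ /= !hc //= addr0.
by rewrite mulr1.
Qed.

Definition tagY (b : block) : {k & E k} := Tagged E (yvec b).2.

Lemma allY_xs u : all isY u -> xs u = [::].
Proof. by elim: u => //= -[]. Qed.
Lemma allX_ys u : all (predC isY) u -> ys u = [::].
Proof. by elim: u => //= -[]. Qed.

(** Reversal makes the first right block act first, and right actions happen at the last tensor
    position. Each block thus appends a vector of its colour, in reading order, and centring removes
    the [xi] component. *)
Lemma csum_Y bs w : all isY (flatten (map snd bs)) -> all mono bs ->
  Defs.alternating (indices w ++ map fst bs) ->
  csum (fun u => vy (rev (ys u)) (fp_tens F w)) (cent bs) = fp_tens F (w ++ map tagY bs).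
Proof.
elim: bs w => [|b bs IH] w /=.
  by move=> _ _ _; rewrite /csum big_seq1 /= scale1r cats0.
rewrite all_cat => /andP[Yb Ybs] /andP[mb mbs] aw.
have aw1 : Defs.alternating (rcons (indices w) b.1).
  by move: aw; rewrite -cat_rcons => /cat_sorted2[].
have aw2 : Defs.alternating (indices (rcons w (tagY b)) ++ map fst bs).
  by rewrite /indices map_rcons /= cat_rcons.
rewrite csum_cent -cat_rcons -IH //.
have tE : fp_tens F (rcons w (tagY b)) = vy (rev (ys b.2)) (fp_tens F w) - phihat b.2 *: fp_tens F w.
  rewrite vy_mono // (phihat_mono mb) /bvec (allY_xs Yb) /= /fp_W addrC addKr //.
rewrite tE [RHS](eq_csum (g := fun u => vy (rev (ys u)) (vy (rev (ys b.2)) (fp_tens F w))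
   - phihat b.2 *: vy (rev (ys u)) (fp_tens F w))); last first.
  by move=> cu _; rewrite -scaleNr addrC vy_linear addrC scaleNr.
rewrite {3}/csum; under [RHS]eq_bigr do rewrite scalerBr.
rewrite sumrB; congr (_ - _).
  by apply: eq_bigr => cu _; rewrite ys_cat rev_cat /vy foldr_cat.
by rewrite /csum scaler_sumr; apply: eq_bigr => cu _; rewrite !scalerA mulrC.
Qed.

(** Right letters act first and append at the end, then left letters prepend at the front. At most
    one block contains both kinds, and its two halves act on the same tensor position; so the
    centred product yields a single elementary tensor. *)
Lemma csum_vec bs : all mono bs -> Defs.alternating (map fst bs) ->
  xy_sorted (flatten (map snd bs)) ->
  exists w, indices w = map fst bs /\ csum vec (cent bs) = fp_tens F w.
Proof.
elim: bs => [|b bs IH] /=.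
  by exists [::]; split=> //; rewrite /csum big_seq1 /= scale1r.
move=> /andP[mb mbs] ab; rewrite /xy_sorted pairwise_cat => /and3P[rel_b _ sbs].
have abs : Defs.alternating (map fst bs) by move: ab; rewrite /Defs.alternating /= => /path_sorted.
(* If only right letters follow, [b] may contain both kinds: its right letters create [yvec b], and
   its left letters act on that vector after the later blocks have been appended. *)
have [Ybs|nY] := boolP (all isY (flatten (map snd bs))).
  pose w' := map tagY bs.
  have iw' : indices w' = map fst bs by rewrite /indices /w' -map_comp.
  exists (Tagged E (bvec b).2 :: w'); split; first by rewrite /= iw'.
  rewrite csum_cent.
  have -> : csum vec (cent bs) = fp_tens F w'.
    rewrite -[w']cat0s -csum_Y //; apply: eq_csum => cu hcu.
    by rewrite /vec (allY_xs (cent_all Ybs hcu)).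
  have -> : csum (fun u => vec (b.2 ++ u)) (cent bs) =
      vx (xs b.2) (csum (fun u => vy (rev (ys u)) (fp_W F [::] (yvec b))) (cent bs)).
    rewrite (csum_linear _ _ (vx_linear _)); apply: eq_csum => cu hcu /=.
    rewrite /vec xs_cat (allY_xs (cent_all Ybs hcu)) cats0 ys_cat rev_cat.
    by rewrite -(@vy_mono b [::]) // /vy foldr_cat.
  (* The same tensor seen from the other side: [yvec b], placed to the right of the empty word,
     stands to the left of [w'] once the later blocks are appended. *)
  have -> : csum (fun u => vy (rev (ys u)) (fp_W F [::] (yvec b))) (cent bs) = fp_V F (yvec b) w'.
    rewrite /fp_V -[w' in fp_tens F w']cat0s -[_ :: w']cat1s -!csum_Y //.
    rewrite /csum scaler_sumr -big_split; apply: eq_bigr => cu _ /=.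
    by rewrite vy_linear scalerDr !scalerA mulrC.
  rewrite vx_fp_V ?mono_xs ?iw' // -/(bvec b) phihat_mono // /fp_V.
  by rewrite addrAC subrr add0r.
have [w [iw cw]] := IH mbs abs sbs.
have Xb : all (predC isY) b.2.
  apply/allP => a ab2; move: nY => /allPn[c cbs nc] /=.
  by move/allrelP: rel_b => /(_ a c ab2 cbs); rewrite nc andbT.
exists (Tagged E (bvec b).2 :: w); split; first by rewrite /= iw.
rewrite csum_cent cw.
have -> : csum (fun u => vec (b.2 ++ u)) (cent bs) = vx (xs b.2) (fp_tens F w).
  rewrite -cw (csum_linear _ _ (vx_linear _)); apply: eq_csum => cu _ /=.
  by rewrite /vec xs_cat ys_cat (allX_ys Xb) /= /vx foldr_cat.
have aw : Defs.alternating (b.1 :: indices w) by rewrite iw.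
rewrite -(fp_V1 aw) vx_fp_V ?mono_xs // fp_V1 //.
rewrite -[lx _ _](_ : bvec b = _); last by rewrite /bvec /yvec (allX_ys Xb).
by rewrite phihat_mono // /fp_V addrAC subrr add0r.
Qed.

(** An elementary tensor of positive length has no [xi] component. *)
Lemma csum_phihat0 bs : bs != [::] -> all mono bs -> Defs.alternating (map fst bs) ->
  xy_sorted (flatten (map snd bs)) -> csum (phihat : seq L -> C^o) (cent bs) = 0.
Proof.
move=> bs0 mbs abs sbs; have [w [iw cw]] := csum_vec mbs abs sbs.
have -> : csum (phihat : seq L -> C^o) (cent bs) = coef (csum vec (cent bs)).
  rewrite /csum raddf_sum; apply: eq_bigr => cu _ /=; by rewrite hphi linearZ.
rewrite cw hc ?iw //; case: w iw {cw} => //= e; move: bs0.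
by case: bs e {mbs abs sbs}.
Qed.
End BiFreeMoments.

Lemma tnth_In (T : Type) (s : seq T) (i : 'I_(size s)) : List.In (tnth (in_tuple s) i) s.
Proof.
set x0 := tnth _ _; rewrite /x0 (tnth_nth x0) /=; move: (ltn_ord i); move: x0 => x0.
move: (nat_of_ord i) => {i} i; elim: s i => // y s IH [|i] /=; first by left.
by rewrite ltnS => /IH; right.
Qed.

Lemma In_map_cat (T U V : Type) (f : U -> T) (g : V -> T) a b z :
  List.In z ([seq f x | x <- a] ++ [seq g x | x <- b]) -> (exists x, z = f x) \/ (exists y, z = g y).
Proof.
elim: a => [|x a IH] /=; last by move=> [<-|/IH //]; left; exists x.
by elim: b => [|y b IH] //= [<-|/IH //]; right; exists y.
Qed.

Section BiFreeCent.
Variables (R : realType) (A : cstarAlg R) (phi : {scalar A}) (n m : nat).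
Variables (X : 'I_n -> A) (Y : 'I_m -> A) (p q : nat) (hp : (p <= n)%N) (hq : (q <= m)%N).

Lemma alg_gen_part (n' p' : nat) (h : (p' <= n')%N) (Z : 'I_n' -> A) (i : 'I_n') :
  (if (i < p')%N then alg_gen (first_part h Z) else alg_gen (last_part h Z)) (Z i).
Proof.
case: ifPn => ip.
  have -> : Z i = first_part h Z (Ordinal ip) by congr Z; exact: val_inj.
  by apply: sub_gen_smallest; exists (Ordinal ip).
have ip' : (i - p' < n' - p')%N by rewrite ltn_sub2r // ?ltn_ord // (leq_trans _ (ltn_ord i)) // ltnS leqNgt.
have -> : Z i = last_part h Z (Ordinal ip').
  by congr Z; apply: val_inj => /=; rewrite subnKC // leqNgt.
by apply: sub_gen_smallest; exists (Ordinal ip').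
Qed.

Hypothesis hfree : bi_free phi
  (fun k : bool => if k then alg_gen (first_part hp X) else alg_gen (last_part hp X))
  (fun k : bool => if k then alg_gen (first_part hq Y) else alg_gen (last_part hq Y)).

(** The form in which bi-freeness is used from here on: a statement about moments, without operators
    or free products. *)
Lemma bi_free_cent bs : bs != [::] -> all (mono p q) bs -> Defs.alternating (map fst bs) ->
  xy_sorted (flatten (map snd bs)) ->
  \sum_(cu <- cent phi X Y bs) cu.1 * phihat phi X Y cu.2 = 0.
Proof.
case: hfree => E [F [l [r [lambda [rho [coef [_ hl hr hc hm]]]]]]].
refine (@csum_phihat0 R A phi n m X Y p q E F l r lambda rho coef hl hr hc _ bs) => u.
pose zs := [seq Left (i < p)%N (X i) | i : 'I_n <- xs u] ++
           [seq Right (j < q)%N (Y j) | j : 'I_m <- rev (ys u)].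
have := hm zs; rewrite /zs big_cat !big_map /phihat => -> /=.
  by rewrite foldr_cat !foldr_map.
move=> i; have [[j ->]|[j ->]] := In_map_cat (@tnth_In _ zs i); last exact: (alg_gen_part hq).
exact: (alg_gen_part hp).
Qed.
End BiFreeCent.

(** * Sets of tuples of matrices *)

Section Herm.
Variables (R : realType) (d : nat).
Local Notation C := R[i].
Local Notation Re := complex.Re.
Local Notation Im := complex.Im.

Definition unherm (B : 'M[C]_d) (k l : 'I_d) : R :=
  if k == l then Re (B k k)
  else if (k < l)%N then Num.sqrt 2 * Re (B k l) else Num.sqrt 2 * Im (B l k).

Let s2 : R := Num.sqrt 2.
Let s2_neq0 : s2 != 0. Proof. by rewrite /s2 gt_eqF // sqrtr_gt0. Qed.
Let s2V2 : s2^-1 ^+ 2 = 2^-1. Proof. by rewrite exprVn sqr_sqrtr. Qed.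

Lemma herm_adj (u : 'I_d -> 'I_d -> R) : adj (herm u) = herm u.
Proof.
apply/matrixP => k l; rewrite /adj !mxE eq_sym; case: (eqVneq k l) => [->|kl].
  by rewrite conjc_real.
case: (ltngtP k l) => h; last by rewrite (val_inj h) eqxx in kl.
- by apply: complexP => /=; ring.
- by apply: complexP => /=; ring.
Qed.

Lemma hermK (B : 'M[C]_d) : adj B = B -> herm (unherm B) = B.
Proof.
move=> hB; have hB' k l : conjc (B l k) = B k l by rewrite -[in RHS]hB !mxE.
apply/matrixP => k l; rewrite mxE /unherm; case: (eqVneq k l) => [->|kl].
  rewrite eqxx; have := hB' l l; case: (B l l) => a b /= [] /eqP; rewrite eq_sym -addr_eq0 -mulr2n.
  by rewrite mulrn_eq0 /= => /eqP ->.
case: (ltngtP k l) => h; last by rewrite (val_inj h) eqxx in kl.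
- by apply: complexP => /=; rewrite -/s2; field.
- by rewrite -(hB' k l); case: (B l k) => a b; apply: complexP => /=; rewrite -/s2; field.
Qed.

Lemma sum_abs2_herm (u : 'I_d -> 'I_d -> R) :
  \sum_k \sum_l abs2 (herm u k l) = \sum_k \sum_l u k l ^+ 2.
Proof.
(* [herm] mixes the coordinates [(k, l)] and [(l, k)], so the squares match only after symmetrizing
   over the two. *)
have swap (f : 'I_d -> 'I_d -> R) : \sum_k \sum_l f k l = 2^-1 * \sum_k \sum_l (f k l + f l k).
  under [in RHS]eq_bigr do rewrite big_split.
  by rewrite big_split /= [X in _ * (_ + X)]exchange_big /= -mulr2n -[X in _ * X]mulr_natl mulKf.
rewrite swap [RHS]swap; congr (_ * _); apply: eq_bigr => k _; apply: eq_bigr => l _.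
rewrite !mxE (eq_sym l k); case: (eqVneq k l) => [->|kl]; first by rewrite !abs2_real.
case: (ltngtP k l) => h; last by rewrite (val_inj h) eqxx in kl.
- by rewrite !abs2M !abs2_real -/s2 s2V2 /abs2 /=; field.
- by rewrite !abs2M !abs2_real -/s2 s2V2 /abs2 /=; field.
Qed.

Lemma herm_lin a u v : herm (fun k l => a * u k l + v k l) = a%:C *: herm u + herm v :> 'M[C]_d.
Proof.
apply/matrixP => k l; rewrite !mxE; case: (k == l); first by rewrite rmorphD rmorphM.
by case: (k < l)%N; apply: complexP => /=; ring.
Qed.

Lemma unherm_lin a (A B : 'M[C]_d) k l : unherm (a%:C *: A + B) k l = a * unherm A k l + unherm B k l.
Proof.
rewrite /unherm !mxE; case: (k == l); first by case: (A k k) (B k k) => ? ? [? ?] /=; ring.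
case: (k < l)%N; first by case: (A k l) (B k l) => ? ? [? ?] /=; ring.
by case: (A l k) (B l k) => ? ? [? ?] /=; ring.
Qed.

Lemma tr_adj (B : 'M[C]_d) : \tr (B *m adj B) = (\sum_k \sum_l abs2 (B k l))%:C.
Proof.
rewrite /mxtrace raddf_sum; apply: eq_bigr => k _; rewrite mxE raddf_sum.
by apply: eq_bigr => l _; rewrite !mxE mulcJ_abs2.
Qed.
End Herm.

Lemma linear_expansion (R : realType) (K : finType) (f : (K -> R) -> R) :
  (forall a u v, f (fun k => a * u k + v k) = a * f u + f v) ->
  forall u, f u = \sum_k u k * f (fun k' => (k' == k)%:R).
Proof.
move=> fl u; have f0 : f (fun=> 0) = 0.
  have := fl 1 (fun=> 0) (fun=> 0); rewrite (_ : (fun k => _) = (fun=> 0)).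
    by rewrite mul1r => /eqP; rewrite -subr_eq0 opprD addNKr oppr_eq0 => /eqP.
  by apply/funext => k; rewrite mul1r addr0.
have gen (s : seq K) : f (fun k => \sum_(j <- s) u j * (k == j)%:R) =
    \sum_(j <- s) u j * f (fun k' => (k' == j)%:R).
  elim: s => [|j s IH].
    by rewrite big_nil -[RHS]f0; congr f; apply/funext => k; rewrite big_nil.
  rewrite big_cons -IH -fl; congr f; apply/funext => k; by rewrite big_cons.
rewrite -gen; congr f; apply/funext => k; rewrite (bigD1 k) //= eqxx mulr1 big1 ?addr0 // => j.
by rewrite eq_sym => /negPf ->; rewrite mulr0.
Qed.

Section Twist.
Variables (R : realType) (J : finType) (d : nat) (col : J -> bool).
Local Notation C := R[i].
Local Notation mT := (measurableTypeR R).
Local Notation K := (J * 'I_d * 'I_d)%type.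
Local Notation N := #|{: J * 'I_d * 'I_d}|.

Definition bmat (u : K -> R) : J -> 'M[C]_d := fun s => herm (fun k l => u (s, k, l)).
Definition bmt (t : N.-tuple mT) : J -> 'M[C]_d := bmat (fun k => tnth t (enum_rank k)).
Definition coordset (S : set (J -> 'M[C]_d)) : set (N.-tuple mT) := fin_set [set u | S (bmat u)].

Variables (kap : bool) (V : 'M[C]_d).
Hypothesis hV : V *m adj V = 1%:M.

Definition twc (u : K -> R) : K -> R :=
  fun x => unherm (twist col kap V (bmat u) x.1.1) x.1.2 x.2.

Lemma bmat_twc u : bmat (twc u) = twist col kap V (bmat u).
Proof.
apply/funext => s; rewrite /bmat /twc /=; apply: hermK.
rewrite /twist; case: ifP => _; last exact: herm_adj.
by rewrite !adjM adjK herm_adj mulmxA.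
Qed.

Lemma twc_lin a u v : twc (fun k => a * u k + v k) = (fun k => a * twc u k + twc v k).
Proof.
apply/funext => x; rewrite /twc -unherm_lin; congr (unherm _ _ _).
rewrite /twist /bmat herm_lin; case: ifP => // _.
by rewrite mulmxDr mulmxDl -scalemxAr -scalemxAl.
Qed.

Lemma twc_iso u : \sum_x twc u x ^+ 2 = \sum_x u x ^+ 2.
Proof.
have E (w : K -> R) : \sum_x w x ^+ 2 = \sum_s \sum_k \sum_l abs2 (bmat w s k l).
  under [RHS]eq_bigr do rewrite sum_abs2_herm.
  rewrite (pair_bigA _ (fun s k => \sum_l w (s, k, l) ^+ 2)) /=.
  rewrite (pair_bigA _ (fun (sk : J * 'I_d) l => w (sk.1, sk.2, l) ^+ 2)) /=.
  by apply: eq_bigr => -[[s k] l].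
rewrite !E bmat_twc; apply: eq_bigr => s _; rewrite /twist; case: ifP => // _.
apply: complexI; rewrite -!tr_adj !adjM adjK !mulmxA -(mulmxA _ (adj V) V) (mulmx1C hV) mulmx1.
by rewrite -!mulmxA mxtrace_mulC -!mulmxA (mulmx1C hV) mulmx1.
Qed.

(** Conjugation is real linear and preserves the Frobenius norm; its matrix in the coordinates of
    [herm] is formed in order to apply [leb_isometry]. *)
Definition twM : 'M[R]_N := \matrix_(i, j) twc (fun k => (k == enum_val j)%:R) (enum_val i).

Lemma bmt_twM t : bmt (mapM twM (fun=> 0) t) = twist col kap V (bmt t).
Proof.
rewrite /bmt -bmat_twc; congr bmat; apply/funext => x; rewrite tnth_mktuple addr0.
rewrite [RHS](linear_expansion (f := fun u => twc u x)); last by move=> a u v; rewrite twc_lin.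
rewrite [RHS](reindex (@enum_val K predT)) /=; last first.
  by exists enum_rank => k _; rewrite ?enum_valK ?enum_rankK.
by apply: eq_big => i; rewrite ?inE // => _; rewrite !mxE enum_rankK enum_valK mulrC.
Qed.

Lemma twM_iso t : \sum_i tnth (mapM twM (fun=> 0) t) i ^+ 2 = \sum_i tnth t i ^+ 2.
Proof.
have E (w : N.-tuple R) : \sum_i tnth w i ^+ 2 = \sum_(x : K) (tnth w (enum_rank x)) ^+ 2.
  rewrite [RHS](reindex (@enum_val K predT)) /=; last first.
    by exists enum_rank => k _; rewrite ?enum_valK ?enum_rankK.
  by apply: eq_big => i; rewrite ?inE // => _; rewrite enum_valK.
rewrite !E -[RHS]twc_iso; apply: eq_bigr => x _; congr (_ ^+ 2).
rewrite tnth_mktuple addr0.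
rewrite [RHS](linear_expansion (f := fun u => twc u x)); last by move=> a u v; rewrite twc_lin.
rewrite [RHS](reindex (@enum_val K predT)) /=; last first.
  by exists enum_rank => k _; rewrite ?enum_valK ?enum_rankK.
by apply: eq_big => i; rewrite ?inE // => _; rewrite !mxE enum_rankK enum_valK mulrC.
Qed.

Lemma leb_twist D : measurable D -> leb R N (mapM twM (fun=> 0) @^-1` D) = leb R N D.
Proof. by move=> mD; apply: leb_isometry => // t; exact: twM_iso. Qed.
End Twist.

(** * The operator norm and measurability of its balls *)

Section OpNorm.
Variables (R : realType) (d : nat).
Local Notation C := R[i].
Implicit Types (B : 'M[C]_d) (v : 'cV[C]_d).

Lemma l2normE v : l2norm v = Num.sqrt (l2sq v).
Proof.
congr Num.sqrt; apply: eq_bigr => k _; case: (v k 0) => a b /=.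
by rewrite sqr_sqrtr // addr_ge0 ?sqr_ge0.
Qed.

Lemma l2sqZ (a : R) v : l2sq (a%:C *: v) = a ^+ 2 * l2sq v.
Proof. by rewrite /l2sq mulr_sumr; apply: eq_bigr => k _; rewrite mxE abs2M abs2_real. Qed.

Lemma l2sq_eq0 v : l2sq v = 0 -> v = 0.
Proof.
move=> /eqP; rewrite psumr_eq0 => [/allP h|k _]; last exact: abs2_ge0.
apply/matrixP => k j; rewrite ord1 mxE; apply: abs2_eq0; apply/eqP.
by apply: h; rewrite mem_index_enum.
Qed.

Lemma bnd_exists B : exists K, bnd K B.
Proof.
exists (d%:R * \sum_i \sum_j abs2 (B i j)); split=> [|v].
  by rewrite mulr_ge0 // sumr_ge0 // => i _; rewrite sumr_ge0 // => j _; exact: abs2_ge0.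
rewrite /l2sq -mulrA mulr_suml mulr_sumr; apply: ler_sum => i _; rewrite mxE.
apply: (le_trans (abs2_sum _ _)).
have -> : size (index_enum 'I_d) = d by rewrite -[index_enum _]enumT size_enum_ord.
rewrite ler_wpM2l // mulr_suml; apply: ler_sum => j _; rewrite abs2M ler_wpM2l ?abs2_ge0 //.
by rewrite (bigD1 j) //= lerDl sumr_ge0 // => k _; exact: abs2_ge0.
Qed.

Lemma opnorm_le (r : R) B : 0 <= r -> opnorm B <= r <-> bnd (r ^+ 2) B.
Proof.
move=> r0; set S := [set l2norm (B *m v) | v in [set v | l2norm v <= 1]].
have S0 : S !=set0.
  exists (l2norm (B *m 0)); exists 0 => //=.
  by rewrite l2normE /l2sq big1 ?sqrtr0 // => k _; rewrite mxE abs20.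
split=> [h|[_ h]]; last first.
  apply: ge_sup => // _ [v /= v1 <-]; rewrite l2normE -(ger0_norm r0) -sqrtr_sqr.
  apply: ler_wsqrtr; apply: (le_trans (h v)); rewrite ler_piMr ?sqr_ge0 //.
  by move: v1; rewrite l2normE -[X in _ <= X]sqrtr1 ler_sqrt.
split=> [|v]; first exact: sqr_ge0.
have [K [K0 hK]] := bnd_exists B.
(* The supremum of an unbounded set would be a default value, so a finite bound must be known before
   comparing with it. *)
have hub : has_ubound S.
  exists (Num.sqrt K) => _ [w /= w1 <-]; rewrite l2normE; apply: ler_wsqrtr.
  apply: (le_trans (hK w)); rewrite ler_piMr //.
  by move: w1; rewrite l2normE -[X in _ <= X]sqrtr1 ler_sqrt.
have [v0|vn0] := eqVneq (l2sq v) 0.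
  by rewrite (l2sq_eq0 v0) mulmx0 /l2sq !big1 ?mulr0 // => k _; rewrite mxE abs20.
have vp : 0 < l2sq v by rewrite lt_def vn0 l2sq_ge0.
set L := l2sq v in vn0 vp *.
pose w := (Num.sqrt L)^-1%:C *: v.
have sL : Num.sqrt L ^+ 2 = L by rewrite sqr_sqrtr // ltW.
have lw : l2sq w = 1 by rewrite l2sqZ exprVn sL mulVf.
have : l2norm (B *m w) <= r.
  apply: le_trans h; apply: ub_le_sup => //; exists w => //=.
  by rewrite l2normE lw sqrtr1.
rewrite l2normE => h'; have : l2sq (B *m w) <= r ^+ 2.
  by rewrite -[X in X <= _]sqr_sqrtr ?l2sq_ge0 // lerXn2r // nnegrE sqrtr_ge0.
by rewrite -scalemxAr l2sqZ exprVn sL mulrC ler_pdivrMr.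
Qed.

(* It suffices to test [bnd] on these countably many vectors, whence measurability. *)
Definition qvec (w : {ffun 'I_d -> rat * rat}) : 'cV[C]_d :=
  \col_k (ratr (w k).1 +i* ratr (w k).2).

Lemma l2sqD_le (t : R) v (w : 'cV[C]_d) : 0 < t -> l2sq (v + w) <= (1 + t) * l2sq v + (1 + t^-1) * l2sq w.
Proof.
move=> t0; rewrite /l2sq !mulr_sumr -big_split; apply: ler_sum => k _ /=; rewrite mxE.
case: (v k 0) (w k 0) => [a b] [a' b']; rewrite /abs2 /= -subr_ge0.
rewrite [X in 0 <= X](_ : _ = t^-1 * ((t * a - a') ^+ 2 + (t * b - b') ^+ 2)).
  by rewrite mulr_ge0 ?invr_ge0 ?(ltW t0) // addr_ge0 ?sqr_ge0.
by field; rewrite gt_eqF.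
Qed.

Lemma qvec_dense v (e : R) : 0 < e -> exists w, l2sq (v - qvec w) <= e.
Proof.
move=> e0; have D0 : 0 < 2 * d.+1%:R :> R by rewrite mulr_gt0.
(* [h <= 1] gives [h ^ 2 <= h]; the factor 2 accounts for real and imaginary parts, and [d.+1]
   avoids a division by zero for [d = 0]. *)
have [h [h0 h1 he]] : exists h, [/\ 0 < h, h <= 1 & h <= e / (2 * d.+1%:R)].
  by exists (Num.min 1 (e / (2 * d.+1%:R))); rewrite lt_min ltr01 divr_gt0 // !ge_min !lexx orbT.
have approx (x : R) : {q : rat | `|x - ratr q| <= h}.
  have xh : x - h < x + h by lra.
  have [q] := cid (rat_in_itvoo xh); rewrite in_itv /= => /andP[q1 q2]; exists q.
  by rewrite ler_norml; apply/andP; split; lra.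
exists [ffun k => (sval (approx (complex.Re (v k 0))), sval (approx (complex.Im (v k 0))))].
have hh : h ^+ 2 + h ^+ 2 <= e / d.+1%:R.
  have : h ^+ 2 <= h by rewrite expr2 ler_piMr // ltW.
  have -> : e / d.+1%:R = 2 * (e / (2 * d.+1%:R)) by field; rewrite gt_eqF.
  by move: he; set z := e / _; lra.
apply: (@le_trans _ _ (\sum_(k < d) e / d.+1%:R)).
  apply: ler_sum => k _; rewrite !mxE ffunE /=.
  case: (approx _) => q1 /= h1'; case: (approx _) => q2 /= h2'.
  move: h1' h2'; case: (v k 0) => a b /= h1' h2'; apply: le_trans hh.
  rewrite /abs2 /= lerD // -[X in X <= _]real_normK ?num_real // lerXn2r // ?nnegrE ?(ltW h0) //.
rewrite sumr_const card_ord -[_ *+ d]mulr_natl mulrCA ler_piMr ?(ltW e0) //.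
by rewrite ler_pdivrMr ?ltr0n // mul1r ler_nat.
Qed.

Lemma bnd_qvec (K : R) B : 0 <= K ->
  bnd K B <-> forall w, l2sq (B *m qvec w) <= K * l2sq (qvec w).
Proof.
move=> K0; split=> [[_ h] w //|h]; split=> // v.
have [M [M0 hM]] := bnd_exists B.
rewrite leNgt; apply/negP => gap.
set L := l2sq v in gap; set LB := l2sq (B *m v) in gap.
have L0 : 0 <= L by exact: l2sq_ge0.
have KL : 0 <= K * L by rewrite mulr_ge0.
(* [P] collects the coefficients of [t] in the errors below, plus 1 to make it positive.
   Approximating [v] up to [t ^ 2] makes the term [(1 + t^-1) * t ^ 2] of order [t]. *)
have [P PE] : exists P, P = 3 * (K * L) + 4 * K + 2 * M + 1 by eexists.
have P0 : 0 < P by lra.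
have [t [t0 t1 tP]] : exists t, [/\ 0 < t, t <= 1 & t * P <= (LB - K * L) / 2].
  exists (Num.min 1 ((LB - K * L) / (2 * P))); split.
  - by rewrite lt_min ltr01 divr_gt0 ?mulr_gt0 // subr_gt0.
  - by rewrite ge_min lexx.
  rewrite -ler_pdivlMr // -mulrA -invfM ge_min; apply/orP; right.
  by rewrite mulrC.
have [w hw] := qvec_dense v (exprn_gt0 2 t0).
have tt : t ^+ 2 <= t by rewrite expr2 ler_piMr // ltW.
set x := qvec w in hw; have it : (1 + t^-1) * t ^+ 2 <= 2 * t.
  have -> : (1 + t^-1) * t ^+ 2 = t ^+ 2 + t by field; rewrite gt_eqF.
  by lra.
have it0 : 0 <= 1 + t^-1 by rewrite addr_ge0 // invr_ge0 ltW.
have b1 : LB <= (1 + t) * l2sq (B *m x) + (1 + t^-1) * l2sq (B *m (v - x)).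
  by rewrite /LB (_ : B *m v = B *m x + B *m (v - x)) ?l2sqD_le // -mulmxDr addrC subrK.
have b2 : l2sq x <= (1 + t) * L + (1 + t^-1) * l2sq (v - x).
  have -> : l2sq (v - x) = l2sq (x - v).
    by rewrite -(opprB v x) /l2sq; apply: eq_bigr => k _; rewrite [in RHS]mxE abs2N.
  by rewrite {1}(_ : x = v + (x - v)) ?l2sqD_le // addrC subrK.
have b3 : (1 + t^-1) * l2sq (v - x) <= 2 * t.
  by apply: le_trans it; rewrite ler_wpM2l.
have b4 : (1 + t^-1) * l2sq (B *m (v - x)) <= M * (2 * t).
  apply: (@le_trans _ _ (M * ((1 + t^-1) * l2sq (v - x)))); last by rewrite ler_wpM2l.
  by rewrite mulrCA ler_wpM2l.
have b5 : l2sq x <= (1 + t) * L + 2 * t by lra.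
have b6 : (1 + t) * l2sq (B *m x) <= (1 + t) * (K * ((1 + t) * L + 2 * t)).
  rewrite ler_wpM2l //; first by lra.
  by apply: (le_trans (h w)); rewrite ler_wpM2l.
have b7 : (1 + t) * (K * ((1 + t) * L + 2 * t)) <= K * L + t * (3 * (K * L) + 4 * K).
  have h1 : K * L * t ^+ 2 <= K * L * t by rewrite ler_wpM2l.
  have h2 : K * t ^+ 2 <= K * t by rewrite ler_wpM2l.
  by lra.
have b8 : t * P = t * (3 * (K * L) + 4 * K) + M * (2 * t) + t by rewrite PE; ring.
by lra.
Qed.
End OpNorm.

Section ComplexMeasurable.
Context {R : realType} {dd : measure_display} {T : measurableType dd}.
Local Notation C := R[i].
Local Notation Re := complex.Re.
Local Notation Im := complex.Im.

Definition cmeas (f : T -> C) :=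
  measurable_fun setT (fun t => Re (f t)) /\ measurable_fun setT (fun t => Im (f t)).

Lemma cmeas_cst c : cmeas (fun=> c). Proof. by split; exact: measurable_cst. Qed.

Lemma cmeas_ext f g : cmeas f -> f =1 g -> cmeas g.
Proof. by move=> h /funext <-. Qed.

Lemma cmeasD f g : cmeas f -> cmeas g -> cmeas (fun t => f t + g t).
Proof.
move=> [h1 h2] [h3 h4]; split.
  rewrite (_ : (fun t => _) = (fun t => Re (f t) + Re (g t))); first exact: measurable_funD.
  by apply/funext => t; case: (f t) (g t) => ? ? [].
rewrite (_ : (fun t => _) = (fun t => Im (f t) + Im (g t))); first exact: measurable_funD.
by apply/funext => t; case: (f t) (g t) => ? ? [].
Qed.

Lemma cmeasM f g : cmeas f -> cmeas g -> cmeas (fun t => f t * g t).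
Proof.
move=> [h1 h2] [h3 h4]; split.
  rewrite (_ : (fun t => _) = (fun t => Re (f t) * Re (g t) - Im (f t) * Im (g t))).
    by apply: measurable_funB; apply: measurable_funM.
  by apply/funext => t; case: (f t) (g t) => ? ? [].
rewrite (_ : (fun t => _) = (fun t => Re (f t) * Im (g t) + Im (f t) * Re (g t))).
  by apply: measurable_funD; apply: measurable_funM.
by apply/funext => t; case: (f t) (g t) => ? ? [].
Qed.

Lemma cmeas_sum (I : Type) (s : seq I) (F : I -> T -> C) :
  (forall i, cmeas (F i)) -> cmeas (fun t => \sum_(i <- s) F i t).
Proof.
move=> h; elim: s => [|i s IH].
  by apply: (cmeas_ext (cmeas_cst 0)) => t; rewrite big_nil.
by apply: (cmeas_ext (cmeasD (h i) IH)) => t; rewrite big_cons.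
Qed.

Lemma measurable_abs2 f : cmeas f -> measurable_fun setT (fun t => abs2 (f t)).
Proof. by move=> [h1 h2]; apply: measurable_funD; exact: measurable_funX. Qed.

Lemma measurable_le (f : T -> R) c : measurable_fun setT f -> measurable [set t | f t <= c].
Proof.
move=> mf; rewrite (_ : [set _ | _] = f @^-1` `]-oo, c]).
  by rewrite -[_ @^-1` _]setTI; apply: mf.
by apply/seteqP; split => t /=; rewrite in_itv.
Qed.

Lemma measurable_lt (f : T -> R) c : measurable_fun setT f -> measurable [set t | f t < c].
Proof.
move=> mf; rewrite (_ : [set _ | _] = f @^-1` `]-oo, c[).
  by rewrite -[_ @^-1` _]setTI; apply: mf.
by apply/seteqP; split => t /=; rewrite in_itv.
Qed.

Lemma measurable_forall (I : countType) (F : I -> set T) :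
  (forall i, measurable (F i)) -> measurable [set t | forall i, F i t].
Proof.
move=> mF; rewrite (_ : [set _ | _] = \bigcap_k (if unpickle k is Some i then F i else setT)).
  by apply: bigcap_measurable => [|k _]; [exists 0%N|case: unpickle].
apply/seteqP; split => t /=; first by move=> h k _; case: unpickle.
by move=> h i; have := h (pickle i) Logic.I; rewrite pickleK.
Qed.
End ComplexMeasurable.

Section MicroMeasurable.
Variables (R : realType) (J : finType) (d : nat).
Local Notation C := R[i].
Local Notation mT := (measurableTypeR R).
Local Notation N := #|{: J * 'I_d * 'I_d}|.
Local Notation bmt := (@bmt R J d).
Local Notation Re := complex.Re.
Local Notation Im := complex.Im.

Definition mmeas p q (M : N.-tuple mT -> 'M[C]_(p, q)) := forall i j, cmeas (fun t => M t i j).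

Lemma mmeas_bmt s : mmeas (fun t => bmt t s).
Proof.
have h k : measurable_fun setT (fun t : N.-tuple mT => tnth t (enum_rank k)).
  exact: measurable_tnth.
move=> i j; rewrite /bmt /bmat; split; under eq_fun do rewrite mxE;
  case: (i == j); [exact: h| |exact: measurable_cst|]; case: (i < j)%N => /=;
  under eq_fun do rewrite ?mul0r ?subr0 ?addr0; apply: measurable_funM => //; try exact: h;
  apply: measurable_funN; exact: h.
Qed.

Lemma mmeasM p q r (M : N.-tuple mT -> 'M[C]_(p, q)) (M' : N.-tuple mT -> 'M[C]_(q, r)) :
  mmeas M -> mmeas M' -> mmeas (fun t => M t *m M' t).
Proof.
move=> h h' i j; under eq_fun do rewrite mxE.
by apply: cmeas_sum => k; exact: cmeasM.
Qed.

Lemma mmeas_prod (u : seq J) : mmeas (fun t => \prod_(s <- u) bmt t s).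
Proof.
elim: u => [|s u IH] i j.
  by under eq_fun do rewrite big_nil; exact: cmeas_cst.
under eq_fun do rewrite big_cons.
exact: (mmeasM (mmeas_bmt s) IH).
Qed.

Lemma cmeas_tr p (M : N.-tuple mT -> 'M[C]_p) : mmeas M -> cmeas (fun t => \tr (M t)).
Proof. by move=> h; apply: cmeas_sum => i; exact: h. Qed.

Lemma measurable_bnd (K : R) s : 0 <= K -> measurable [set t | bnd K (bmt t s)].
Proof.
move=> K0; rewrite (_ : [set _ | _] =
   [set t | forall w, l2sq (bmt t s *m qvec R w) <= K * l2sq (qvec R w)]); last first.
  by apply/seteqP; split => t /=; rewrite bnd_qvec.
apply: measurable_forall => w; apply: measurable_le; apply: measurable_sum => k.
apply: measurable_abs2; apply: mmeasM; first exact: mmeas_bmt.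
by move=> i j; exact: cmeas_cst.
Qed.

(* [bnd (r ^+ 2)] says that the operator norm is at most [r], see [opnorm_le]. *)
Definition mstate (c : seq J -> C) (W : set (seq J)) (r e : R) : set (J -> 'M[C]_d) :=
  [set B | [/\ forall s, adj (B s) = B s, forall s, bnd (r ^+ 2) (B s) &
     forall u, W u -> abs2 (c u - ntr (\prod_(s <- u) B s)) < e ^+ 2]].

Lemma mstate_measurable c W r e : measurable (coordset (mstate c W r e)).
Proof.
rewrite (_ : coordset _ = [set t | forall s, bnd (r ^+ 2) (bmt t s)] `&`
   [set t | forall u, [set t | W u -> abs2 (c u - ntr (\prod_(s <- u) bmt t s)) < e ^+ 2] t]).
  apply: measurableI; first by apply: measurable_forall => s; apply: measurable_bnd; exact: sqr_ge0.
  apply: measurable_forall => u.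
  have [Wu|nWu] := pselect (W u); last first.
    by rewrite (_ : [set _ | _] = setT); [exact: measurableT|apply/seteqP; split => t // _ /nWu].
  rewrite (_ : [set _ | _] = [set t | abs2 (c u - ntr (\prod_(s <- u) bmt t s)) < e ^+ 2]); last first.
    by apply/seteqP; split => t /=; [apply|].
  apply: measurable_lt; apply: measurable_abs2; apply: cmeasD; first exact: cmeas_cst.
  apply: (cmeas_ext (f := fun t => - (d%:R^-1) * \tr (\prod_(s <- u) bmt t s))) => [|t].
    by apply: cmeasM; [exact: cmeas_cst|apply: cmeas_tr; exact: mmeas_prod].
  by rewrite /ntr mulNr mulrC.
apply/seteqP; split => t /=; first by move=> [_ h1 h2].
by move=> [h1 h2]; split => // s; exact: herm_adj.
Qed.

End MicroMeasurable.

(** * The uniform probability on an invariant set of tuples *)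

Section UniformExpectation.
Variables (R : realType) (J : finType) (d : nat) (col : J -> bool).
Local Notation C := R[i].
Local Notation mT := (measurableTypeR R).
Local Notation N := #|{: J * 'I_d * 'I_d}|.
Local Notation bmt := (@bmt R J d).
Local Notation T := (J -> 'M[C]_d).
Variable S : set T.
Local Notation D := (coordset S).
Hypothesis mD : measurable D.
Hypothesis D0 : (0 < leb R N D)%E.
Hypothesis Doo : (leb R N D < +oo)%E.
Hypothesis Sbdd : exists B : R, forall z s i j, S z -> abs2 (z s i j) <= B.
Hypothesis Stw : forall k V z, V *m adj V = 1%:M -> S (twist col k V z) <-> S z.

(** Boundedness is asked on [S] only: matrix entries are unbounded on the whole space, and the
    integrals are over [S]. *)
Definition uadm (f : T -> R) := measurable_fun setT (f \o bmt) /\ exists B, forall z, S z -> `|f z| <= B.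
Definition uex (f : T -> R) : R :=
  (\int[leb R N]_(t in D) (f (bmt t))) / fine (leb R N D).

Let c0 : 0 < fine (leb R N D). Proof. by rewrite fine_gt0 // D0 Doo. Qed.

Let uadm_int f : uadm f -> (leb R N).-integrable D (EFin \o (f \o bmt)).
Proof.
move=> [mf [B hB]]; apply: measurable_bounded_integrable => //; first exact: measurable_funTS.
exists B; split; first by rewrite num_real.
by move=> x Bx t Dt /=; apply: le_trans (ltW Bx); exact: hB.
Qed.

Let uadm_cst c : uadm (fun=> c).
Proof. by split; [exact: measurable_cst|exists `|c|]. Qed.

Let uadmD f g : uadm f -> uadm g -> uadm (fun z => f z + g z).
Proof.
move=> [mf [B hB]] [mg [B' hB']]; split; first exact: measurable_funD.
by exists (B + B') => z Sz; rewrite (le_trans (ler_normD _ _)) // lerD ?hB ?hB'.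
Qed.

Let uadmM f g : uadm f -> uadm g -> uadm (fun z => f z * g z).
Proof.
move=> [mf [B hB]] [mg [B' hB']]; split; first exact: measurable_funM.
by exists (B * B') => z Sz; rewrite normrM ler_pM ?hB ?hB'.
Qed.

Let uadm_Re s i j : uadm (fun z => complex.Re (z s i j)).
Proof.
have [B hB] := Sbdd; split; first by have [] := @mmeas_bmt R J d s i j.
exists (1 + B) => z Sz; have := hB z s i j Sz; case: (z s i j) => a b; rewrite /abs2 /= => h.
have := sqr_ge0 b; have := sqr_ge0 (a - 1); have := sqr_ge0 (a + 1); have := sqr_ge0 a.
by rewrite ler_norml => *; apply/andP; split; nra.
Qed.

Let uadm_Im s i j : uadm (fun z => complex.Im (z s i j)).
Proof.
have [B hB] := Sbdd; split; first by have [] := @mmeas_bmt R J d s i j.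
exists (1 + B) => z Sz; have := hB z s i j Sz; case: (z s i j) => b a; rewrite /abs2 /= => h.
have := sqr_ge0 b; have := sqr_ge0 (a - 1); have := sqr_ge0 (a + 1); have := sqr_ge0 a.
by rewrite ler_norml => *; apply/andP; split; nra.
Qed.

Let uadm_rot k V f : V *m adj V = 1%:M -> uadm f -> uadm (fun z => f (twist col k V z)).
Proof.
move=> hV [mf [B hB]]; split; last by exists B => z Sz; apply: hB; exact/Stw.
rewrite (_ : _ \o _ = (f \o bmt) \o mapM (twM col k V) (fun=> 0)).
  by apply: measurableT_comp => //; exact: measurable_mapM.
by apply/funext => t /=; rewrite bmt_twM.
Qed.

Let uex_lin a f g : uadm f -> uadm g -> uex (fun z => a * f z + g z) = a * uex f + uex g.
Proof.
move=> af ag; have af' := uadmM (uadm_cst a) af.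
rewrite /uex RintegralD //; [|exact: uadm_int af'|exact: uadm_int ag].
by rewrite RintegralZl //; [rewrite mulrDl mulrA|exact: uadm_int af].
Qed.

Let uex_le f g : uadm f -> uadm g -> (forall z, S z -> f z <= g z) -> uex f <= uex g.
Proof.
move=> af ag h; rewrite ler_pM2r ?invr_gt0 //; apply: le_Rintegral => //.
- exact: uadm_int af.
- exact: uadm_int ag.
by move=> t; exact: h.
Qed.

Let uex_cst c : uex (fun=> c) = c.
Proof. by rewrite /uex Rintegral_cst // mulfK // gt_eqF. Qed.

(** A change of variables: both Lebesgue measure and [D] are invariant under
    [mapM (twM col k V) (fun=> 0)]. *)
Let uex_rot k V f : V *m adj V = 1%:M -> uadm f -> uex (fun z => f (twist col k V z)) = uex f.
Proof.
move=> hV af; have mt := @measurable_mapM R _ (twM col k V) (fun=> 0).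
have DE : mapM (twM col k V) (fun=> 0) @^-1` D = D.
  have Dt t : D t = S (bmt t) by [].
  by apply/seteqP; split => t; rewrite /preimage /mkset !Dt bmt_twM // Stw.
congr (fine _ / _).
have mf : measurable_fun setT (EFin \o (f \o bmt)) by apply/measurable_EFinP; case: af.
have EE := (@eq_measure_integral _ _ _ D (leb R N)
    (measure_function_pushforward__canonical__measure_function_Measure (leb R N) mt)
    (EFin \o (f \o bmt)) (fun B mB _ => leb_twist col k hV mB)).
apply: etrans EE; apply/esym; apply: etrans; first apply: (integral_pushforward mt mf _ mD).
  rewrite DE; have := uadm_int (uadm_rot k hV af).
  by apply: eq_ind; congr integrable; apply/funext => t /=; rewrite bmt_twM.
by rewrite DE; apply: eq_integral => t _ /=; rewrite bmt_twM.
Qed.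

Definition uniform_expct : expct R col d :=
  Expct uadm_cst uadmD uadmM uadm_Re uadm_Im uadm_rot uex_lin uex_le uex_cst uex_rot.
End UniformExpectation.

Section TwistState.
Variables (R : realType) (J : finType) (col : J -> bool) (d : nat).
Local Notation C := R[i].
Local Notation T := (J -> 'M[C]_d).

Definition mat (u : seq J) (z : T) : 'M[C]_d := \prod_(s <- u) z s.

Lemma mat_nil z : mat [::] z = 1%:M. Proof. by rewrite /mat big_nil. Qed.
Lemma mat_cons s u z : mat (s :: u) z = z s *m mat u z.
Proof. by rewrite /mat big_cons. Qed.
Lemma mat_cat u v z : mat (u ++ v) z = mat u z *m mat v z.
Proof. by rewrite /mat big_cat. Qed.

Lemma mat_twist kap k (V : 'M[C]_d) u z : V *m adj V = 1%:M -> all (fun s => col s == kap) u ->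
  mat u (twist col k V z) = if kap == k then V *m mat u z *m adj V else mat u z.
Proof.
move=> hV; elim: u => [|s u IH] /=.
  by rewrite !mat_nil mulmx1 hV; case: ifP.
move=> /andP[/eqP sk uk]; rewrite !mat_cons IH // {1}/twist sk; case: ifP => // _.
by rewrite !mulmxA -(mulmxA _ (adj V) V) (mulmx1C hV) mulmx1.
Qed.

Lemma ntr_conj (V B : 'M[C]_d) : V *m adj V = 1%:M -> ntr (V *m B *m adj V) = ntr B.
Proof. by move=> hV; rewrite /ntr -mulmxA mxtrace_mulC -mulmxA (mulmx1C hV) mulmx1. Qed.

Lemma l2sq_unitary (V : 'M[C]_d) (v : 'cV[C]_d) : adj V *m V = 1%:M -> l2sq (V *m v) = l2sq v.
Proof.
move=> hV; have E (w : 'cV[C]_d) : (l2sq w)%:C = (adj w *m w) 0 0.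
  rewrite mxE /l2sq raddf_sum; apply: eq_bigr => k _.
  by rewrite !mxE mulrC mulcJ_abs2.
by apply: complexI; rewrite !E adjM -mulmxA (mulmxA (adj V)) hV mul1mx.
Qed.

Lemma bnd_conj K (V B : 'M[C]_d) : V *m adj V = 1%:M -> bnd K B -> bnd K (V *m B *m adj V).
Proof.
move=> hV [K0 h]; split=> // v; rewrite -mulmxA -mulmxA l2sq_unitary ?(mulmx1C hV) //.
by rewrite (le_trans (h _)) // l2sq_unitary ?adjK.
Qed.

Lemma twistK k (V : 'M[C]_d) z : V *m adj V = 1%:M -> twist col k (adj V) (twist col k V z) = z.
Proof.
move=> hV; apply/funext => s; rewrite /twist; case: (col s == k) => //.
by rewrite adjK !mulmxA (mulmx1C hV) mul1mx -mulmxA (mulmx1C hV) mulmx1.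
Qed.

Definition monochrome (u : seq J) := exists kap, all (fun s => col s == kap) u.

(** Conjugating one colour preserves the traces of one-coloured words but in general not those of
    mixed words; the symmetry is therefore available for [parts] rather than for [joint]. *)
Lemma mstate_twist c W r e k (V : 'M[C]_d) z : (forall u, W u -> monochrome u) -> V *m adj V = 1%:M ->
  mstate c W r e (twist col k V z) <-> mstate c W r e z.
Proof.
move=> hW; have h (V' : 'M[C]_d) (z' : T) : V' *m adj V' = 1%:M -> mstate c W r e z' -> mstate c W r e (twist col k V' z').
  move=> hV [h1 h2 h3]; split=> [s|s|u Wu].
  - by rewrite /twist; case: ifP => // _; rewrite !adjM adjK h1 mulmxA.
  - by rewrite /twist; case: ifP => _; [exact: (bnd_conj hV (h2 s))|exact: h2].
  have [kap uk] := hW u Wu; rewrite -/(mat u _) (mat_twist _ _ hV uk).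
  by case: ifP => _; rewrite ?ntr_conj //; exact: h3.
move=> hV; split=> [hz|]; last exact: h.
by rewrite -[z](twistK k z hV); apply: h => //; rewrite adjK (mulmx1C hV).
Qed.
End TwistState.

(** * Convergence of the joint moments *)

Section Words.
Variables (R : realType) (A : cstarAlg R) (phi : {scalar A}) (n m : nat).
Variables (X : 'I_n -> A) (Y : 'I_m -> A) (p q : nat).
Local Notation C := R[i].
Local Notation J := ('I_n + 'I_m)%type.
Local Notation col := (@colour n m p q).
Local Notation ph := (phihat phi X Y).
Local Notation cent := (cent phi X Y).
Hypothesis phi1 : phi 1 = 1.

Hypothesis hcent : forall bs : seq (block n m), bs != [::] -> all (mono p q) bs ->
  Defs.alternating (map fst bs) -> xy_sorted (flatten (map snd bs)) ->
  \sum_(cu <- cent bs) cu.1 * ph cu.2 = 0.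

Definition fl (bs : seq (block n m)) : seq J := flatten (map snd bs).

Lemma cent_sub bs cu : cu \in cent bs -> exists2 bs', subseq bs' bs & cu.2 = fl bs'.
Proof.
elim: bs cu => [|b bs IH] cu /=; first by rewrite inE => /eqP ->; exists [::].
rewrite mem_cat => /orP[] /mapP[cu' /IH[bs' s' e] ->] /=.
  by exists (b :: bs'); rewrite /= ?eqxx // e.
by exists bs' => //; exact: subseq_trans s' (subseq_cons _ _).
Qed.

(** The full word has coefficient 1 and every other word has fewer blocks, as the induction in
    [defect_null_blocks] requires. *)
Lemma cent_shape bs : exists2 rest, cent bs = (1, fl bs) :: rest &
  forall cu, cu \in rest -> exists2 bs', subseq bs' bs & cu.2 = fl bs' /\ (size bs' < size bs)%N.
Proof.
elim: bs => [|b bs [rest e hr]]; first by exists [::].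
exists ([seq (cu.1, b.2 ++ cu.2) | cu <- rest] ++ [seq (- ph b.2 * cu.1, cu.2) | cu <- cent bs]).
  by rewrite /= {1}e.
move=> cu; rewrite mem_cat => /orP[] /mapP[cu' h ->] /=.
  have [bs' s' [e' sz]] := hr _ h; exists (b :: bs'); rewrite /= ?eqxx //.
  by rewrite e'.
have [bs' s' e'] := cent_sub h; exists bs'; first exact: subseq_trans s' (subseq_cons _ _).
by split=> //; rewrite ltnS size_subseq.
Qed.

Lemma subseq_fl bs' bs : subseq bs' bs -> subseq (fl bs') (fl bs).
Proof.
elim: bs bs' => [|b bs IH] [|b' bs'] //=; first by rewrite sub0seq.
case: eqP => [->|_] /IH h; first exact: cat_subseq.
by apply: subseq_trans h _; exact: suffix_subseq.
Qed.

Lemma xy_sorted_subseq (u v : seq J) : subseq u v -> xy_sorted v -> xy_sorted u.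
Proof. exact: subseq_pairwise. Qed.

Lemma xy_sortedE (u : seq J) : xy_sorted u -> u = map inl (xs u) ++ map inr (ys u).
Proof.
elim: u => //= -[i|j] u IH /andP[h /IH e]; first by rewrite /= -e.
have hY : all (@isY n m) u by apply: sub_all h => a; rewrite /= negbK.
rewrite (allY_xs hY) /= [in LHS]e (allY_xs hY) //.
Qed.

Definition mwords (M : nat) : set (seq J) := [set u | xy_sorted u /\ (1 <= size u <= M)%N].
Definition pwords (M : nat) : set (seq J) := [set u | mwords M u /\ monochrome col u].

Variable dk : nat -> nat.
Hypothesis dk_gt : forall k, (k < dk k)%N.
Variable r : R.
Hypothesis r0 : 0 < r.
Variable E : forall k, expct R col (dk k).
Hypothesis domE : forall k z, edom (E k) z ->
  mstate ph (pwords k.+1) r (k.+1%:R^-1) z.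

Definition defect (u : seq J) : fam R J dk := fun k z => ntr (mat u z) - ph u.

Lemma madm_mat u k : madm (E k) (mat u).
Proof.
elim: u => [|s u IH] i j.
  by under eq_fun do rewrite mat_nil; exact: cadm_cst.
under eq_fun do rewrite mat_cons.
apply: (madmM _ IH) => i' j'; exact: cadm_entry.
Qed.

Lemma mat_bnd u : exists B : R, forall k z, edom (E k) z -> bnd B (mat u z).
Proof.
elim: u => [|s u [B IH]]; first by exists 1 => k z _; rewrite mat_nil; exact: bnd1.
exists (r ^+ 2 * B) => k z hz; rewrite mat_cons; apply: bndM; last exact: IH.
by have [_ h _] := domE hz.
Qed.

Lemma defect_fadm u : fadm E (defect u).
Proof.
move=> k; apply: cadmB; last exact: cadm_cst.
by apply: cadm_ntr; exact: madm_mat.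
Qed.

(** The block is centred by the prescribed moment, a constant, so its trace is null only in the
    limit. Scalar matrices are fixed by conjugation, so the block still transforms as one letter. *)
Definition bletter (b : block n m) : letter R J dk :=
  (b.1, fun k z => mat b.2 z - (ph b.2)%:M).

Lemma bletter_good b : mono p q b -> good E (bletter b).
Proof.
move=> mb; split=> [k|| k kap V z hV] /=.
- by apply: madmB; [exact: madm_mat|exact: madm_cst].
- have [B hB] := mat_bnd b.2; exists (2 * B + 2 * (abs2 (ph b.2) * 1)) => k z hz.
  by apply: bndB; [exact: hB|rewrite -scalemx1; apply: bndZ; exact: bnd1].
rewrite (mat_twist _ _ hV mb); case: ifP => // _.
by rewrite mulmxBr mulmxBl mul_mx_scalar -scalemxAl hV scalemx1.
Qed.

Lemma ph_nil : ph [::] = 1. Proof. by rewrite /phihat /= !big_nil mulr1. Qed.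

Lemma ntr_scalar k a : ntr (a%:M : 'M[C]_(dk k)) = a.
Proof.
rewrite /ntr mxtrace_scalar -[a *+ _]mulr_natr mulfK // pnatr_eq0 -lt0n.
exact: leq_ltn_trans (dk_gt k).
Qed.

Lemma defect_mono_null u : xy_sorted u -> monochrome col u -> null E (defect u).
Proof.
(* The empty word is not among the constrained words; its defect is exactly 0. *)
move=> su mu; case: (posnP (size u)) => [/size0nil ->|u0].
  apply: (null_ext (null0 E)) => k z.
  by rewrite /defect mat_nil ntr_scalar ph_nil subrr.
apply: (@squeeze_cvgr _ _ _ _ (fun=> 0) (fun k => k.+1%:R^-1)) => //; last 2 first.
- exact: cvg_cst.
- exact: cvg_harmonic.
near=> k; apply/andP; split.
  apply: ex_ge0; first exact/adm_abs2/defect_fadm.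
  by move=> z _; exact: abs2_ge0.
rewrite -[leRHS](ex_cst (E k)); apply: ex_le; [exact/adm_abs2/defect_fadm|exact: adm_cst|].
move=> z /domE[_ _ h]; rewrite -abs2N /defect opprB.
have uk : (size u <= k)%N by near: k; exact: nbhs_infty_ge.
apply: ltW; apply: lt_le_trans (h u _) _.
  by split=> //; split=> //; rewrite u0 (leq_trans uk).
rewrite expr2 ler_piMr ?invr_ge0 // invf_le1 ?ltr0n // ler1n.
Unshelve. all: by end_near. Qed.

Lemma bletter_centered b : mono p q b -> xy_sorted b.2 -> null E (tw [:: bletter b]).
Proof.
move=> mb sb; apply: (null_ext (defect_mono_null sb _)) => [|k z]; first by exists b.1.
rewrite /tw /mw /= mulmx1 /defect -{1}(ntr_scalar k (ph b.2)).
by rewrite /ntr raddfB /= mulrBl.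
Qed.

Lemma mw_cent bs k (z : J -> 'M[C]_(dk k)) :
  mw (map bletter bs) z = \sum_(cu <- cent bs) cu.1 *: mat cu.2 z.
Proof.
elim: bs => [|b bs IH]; first by rewrite /mw /= big_seq1 mat_nil scale1r.
rewrite /= big_cat !big_map /= [LHS](_ : _ = (mat b.2 z - (ph b.2)%:M) *m mw (map bletter bs) z) //.
rewrite IH mulmxBl !mulmx_sumr -sumrN; congr (_ + _); apply: eq_bigr => cu _ /=.
  by rewrite mat_cat scalemxAr.
by rewrite mul_scalar_mx scalerA mulNr scaleNr.
Qed.

Lemma null_sum_seq (I : eqType) (s : seq I) (F : I -> fam R J dk) : (forall i, fadm E (F i)) ->
  (forall i, i \in s -> null E (F i)) -> null E (fun k z => \sum_(i <- s) F i k z).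
Proof.
move=> aF; elim: s => [|i s IH] hF.
  by apply: (null_ext (null0 E)) => k z; rewrite big_nil.
apply: (null_ext (nullD (aF i) _ (hF i (mem_head _ _)) (IH _))) => [k||k z].
- by apply: cadm_sum => j; exact: aF.
- by move=> j hj; apply: hF; rewrite inE hj orbT.
by rewrite big_cons.
Qed.

Lemma not_alternating (bs : seq (block n m)) : ~~ Defs.alternating (map fst bs) ->
  exists a b1 b2 c, bs = a ++ b1 :: b2 :: c /\ b1.1 = b2.1.
Proof.
elim: bs => [|b [|b' bs] IH] //=; rewrite negb_and negbK => /orP[/eqP e|h].
  by exists [::], b, b', bs.
have [a [b1 [b2 [c [e1 e2]]]]] := IH h.
by exists (b :: a), b1, b2, c; split=> //=; rewrite e1.
Qed.

(** Induction on the number of blocks. Neighbours of equal colour are merged. For alternating blocks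
    the trace of the centred product is null by asymptotic freeness, and its expansion is the defect
    of the full word plus defects with fewer blocks. *)
Lemma defect_null_blocks bs : all (mono p q) bs -> xy_sorted (fl bs) -> null E (defect (fl bs)).
Proof.
have [N] := ubnP (size bs); elim: N bs => // N IH bs /ltnSE szN mbs sbs.
case: (eqVneq bs [::]) => [->|bs0].
  by apply: defect_mono_null => //; exists true.
have [alt|/not_alternating[a [b1 [b2 [c [e e12]]]]]] := boolP (Defs.alternating (map fst bs)); last first.
  have -> : fl bs = fl (a ++ (b1.1, b1.2 ++ b2.2) :: c).
    by rewrite e /fl !map_cat !flatten_cat /= !catA.
  apply: IH.
  - by move: szN; rewrite e !size_cat /=; lia.
  - move: mbs; rewrite e !all_cat /= => /and4P[-> h1 h2 ->]; rewrite andbT.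
    by move: h1 h2; rewrite /mono all_cat /= -e12 => -> ->.
  by move: sbs; rewrite e /fl !map_cat !flatten_cat /= !catA.
have subxy w : w \in map snd bs -> xy_sorted w.
  move=> hw; apply: xy_sorted_subseq sbs; rewrite /fl.
  case/splitPr: hw => s1 s2; rewrite flatten_cat /=.
  exact: subseq_trans (prefix_subseq _ _) (suffix_subseq _ _).
have inb c : List.In c (map bletter bs) -> exists2 b, b \in bs & c = bletter b.
  elim: (bs) => //= b l IHl [<-|/IHl[b' h ->]]; first by exists b => //; rewrite mem_head.
  by exists b' => //; rewrite inE h orbT.
have fr : null E (tw (map bletter bs)).
  apply: (free_null dk_gt).
  - by move=> c /inb[b hb ->]; apply: bletter_good; exact: (allP mbs).
  - move=> c /inb[b hb ->]; apply: bletter_centered; first exact: (allP mbs).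
    by apply: subxy; apply/mapP; exists b.
  - by case: (bs) bs0.
  by move: alt; rewrite /alternate /Defs.alternating -map_comp.
have [rest ce hrest] := cent_shape bs.
have aS : fadm E (fun k z => \sum_(cu <- rest) cu.1 * defect cu.2 z).
  by move=> k; apply: cadm_sum => cu; apply: cadmZ; exact: defect_fadm.
have nS : null E (fun k z => \sum_(cu <- rest) cu.1 * defect cu.2 z).
  apply: (null_sum_seq (F := fun cu k z => cu.1 * defect cu.2 z)) => [cu k|cu hcu].
    by apply: cadmZ; exact: defect_fadm.
  apply: nullZ; first exact: defect_fadm.
  have [bs' s' [-> sz']] := hrest _ hcu; apply: IH.
  - exact: leq_trans sz' szN.
  - by apply/allP => b /(mem_subseq s'); exact: (allP mbs).
  - by apply: xy_sorted_subseq sbs; exact: subseq_fl.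
have gb : goods E (map bletter bs).
  by move=> c /inb[b hb ->]; apply: bletter_good; exact: (allP mbs).
apply: (null_ext (nullB (goods_fadm gb) aS fr nS)) => k z.
have twE : tw (map bletter bs) z = \sum_(cu <- cent bs) cu.1 * defect cu.2 z.
  (* The subtracted sum of scalars is zero by [hcent], so each trace in the expansion may be
     replaced by its defect. *)
  transitivity (\sum_(cu <- cent bs) cu.1 * ntr (mat cu.2 z) - \sum_(cu <- cent bs) cu.1 * ph cu.2).
    rewrite hcent // subr0 /tw mw_cent /ntr raddf_sum mulr_suml.
    by apply: eq_bigr => cu _; rewrite /= mxtraceZ mulrA.
  by rewrite -sumrB; apply: eq_bigr => cu _; rewrite /defect mulrBr.
by rewrite twE ce big_cons mul1r addrK.
Qed.

Lemma defect_null u : xy_sorted u -> null E (defect u).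
Proof.
move=> su; pose bs : seq (block n m) := [seq (col s, [:: s]) | s <- u].
have fe : fl bs = u by rewrite /fl /bs -map_comp; elim: (u) => //= s v ->.
rewrite -fe; apply: defect_null_blocks; last by rewrite fe.
by apply/allP => b /mapP[s _ ->]; rewrite /mono /= eqxx.
Qed.
End Words.

Section Volume.
Variables (R : realType) (J : finType) (d : nat).
Local Notation C := R[i].
Local Notation mT := (measurableTypeR R).
Local Notation N := #|{: J * 'I_d * 'I_d}|.
Local Notation bmt := (@bmt R J d).

Lemma sum_sqr_bmt (t : N.-tuple mT) :
  \sum_i tnth t i ^+ 2 = \sum_s \sum_k \sum_l abs2 (bmt t s k l).
Proof.
under [RHS]eq_bigr do rewrite sum_abs2_herm.
rewrite (pair_bigA _ (fun s k => \sum_l (tnth t (enum_rank (s, k, l))) ^+ 2)) /=.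
rewrite (pair_bigA _ (fun (sk : J * 'I_d) l => (tnth t (enum_rank (sk.1, sk.2, l))) ^+ 2)) /=.
rewrite [RHS](reindex (@enum_val (J * 'I_d * 'I_d)%type predT)) /=; last first.
  by exists enum_rank => k _; rewrite ?enum_valK ?enum_rankK.
apply: eq_big => i; rewrite ?inE // => _.
by rewrite (_ : (_, _, _) = enum_val i) ?enum_valK //; case: (enum_val i) => -[].
Qed.

(** The Gaussian comparison with variance [1 / d]: the squared length of such a tuple is at most
    [#|J| * d * r ^ 2], so the exponent is of order [d ^ 2], while the power of [2 pi / d] later
    cancels the term [log d] of the normalisation. *)
Lemma leb_bnd_le (S : set (J -> 'M[C]_d)) (r : R) : (0 < d)%N ->
  (forall z s, S z -> bnd (r ^+ 2) (z s)) -> measurable (coordset S) ->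
  (leb R N (coordset S) <= (expR (#|J|%:R * r ^+ 2 / 2 * d%:R ^+ 2) *
     Num.sqrt (pi *+ 2 / d%:R) ^+ N)%:E)%E.
Proof.
move=> d0 h mS; have dR : 0 < d%:R :> R by rewrite ltr0n.
have s0 : 0 < Num.sqrt (d%:R^-1) :> R by rewrite sqrtr_gt0 invr_gt0.
have := leb_sqr_ball_le N (#|J|%:R * (d%:R * r ^+ 2)) s0.
rewrite sqr_sqrtr ?invr_ge0 ?(ltW dR) // => hb.
have -> : #|J|%:R * r ^+ 2 / 2 * d%:R ^+ 2 = #|J|%:R * (d%:R * r ^+ 2) / (d%:R^-1 *+ 2) :> R.
  by rewrite -[d%:R^-1 *+ 2]mulr_natl; field; rewrite gt_eqF.
have -> : pi *+ 2 / d%:R = d%:R^-1 * pi *+ 2 :> R by rewrite mulrC mulrnAr.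
apply: le_trans hb; apply: le_measure; rewrite ?inE //; first exact: measurable_sqr_ball.
move=> t /= St; rewrite sum_sqr_bmt.
apply: (@le_trans _ _ (\sum_(s : J) d%:R * r ^+ 2)); last by rewrite sumr_const -[_ *+ #|_|]mulr_natl.
apply: ler_sum => s _; apply: bnd_frob; exact: h.
Qed.

Lemma leb_bnd_fin (S : set (J -> 'M[C]_d)) (r : R) : (0 < d)%N ->
  (forall z s, S z -> bnd (r ^+ 2) (z s)) -> measurable (coordset S) ->
  (leb R N (coordset S) < +oo)%E.
Proof. by move=> d0 h mS; apply: le_lt_trans (leb_bnd_le d0 h mS) _; rewrite ltry. Qed.
End Volume.

Lemma cvg_sum0 (R : realType) (I : eqType) (s : seq I) (g : I -> nat -> R) :
  (forall i, i \in s -> g i @ \oo --> (0 : R)) ->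
  (fun k => \sum_(i <- s) g i k) @ \oo --> (0 : R).
Proof.
elim: s => [|i s IH] h; first by under eq_fun do rewrite big_nil; exact: cvg_cst.
have hs : (fun k => \sum_(j <- s) g j k) @ \oo --> (0 : R).
  by apply: IH => j hj; apply: h; rewrite inE hj orbT.
rewrite (_ : (fun k => \sum_(j <- i :: s) g j k) = (g i \+ (fun k => \sum_(j <- s) g j k))).
  have h3 := cvgD (h i (mem_head _ _)) hs; rewrite addr0 in h3.
  exact: h3.
by apply/funext => k; rewrite big_cons.
Qed.

Definition words_le (J : finType) (M : nat) : seq (seq J) :=
  flatten [seq [seq val t | t <- enum {: k.-tuple J}] | k <- iota 0 M.+1].

Lemma words_leP (J : finType) M (u : seq J) : (size u <= M)%N -> u \in words_le J M.
Proof.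
move=> uM; apply/flattenP; exists [seq val t | t <- enum {: (size u).-tuple J}].
  by apply/mapP; exists (size u) => //; rewrite mem_iota add0n ltnS.
by apply/mapP; exists (in_tuple u) => //; rewrite mem_enum.
Qed.

Section Superadditivity.
Variables (R : realType) (A : cstarAlg R) (phi : {scalar A}) (n m : nat).
Variables (X : 'I_n -> A) (Y : 'I_m -> A) (p q : nat).
Local Notation C := R[i].
Local Notation J := ('I_n + 'I_m)%type.
Local Notation col := (@colour n m p q).
Local Notation ph := (phihat phi X Y).
Hypothesis phi1 : phi 1 = 1.
Hypothesis hcent : forall bs : seq (block n m), bs != [::] -> all (mono p q) bs ->
  Defs.alternating (map fst bs) -> xy_sorted (flatten (map snd bs)) ->
  \sum_(cu <- cent phi X Y bs) cu.1 * ph cu.2 = 0.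
Variable r : R.
Hypothesis r0 : 0 < r.
Local Notation N d := #|{: J * 'I_d * 'I_d}|.

Definition joint d M (e : R) : set (J -> 'M[C]_d) := mstate ph (@mwords n m M) r e.
Definition parts d M (e : R) : set (J -> 'M[C]_d) := mstate ph (@pwords n m p q M) r e.

(* Otherwise one gets uniform probabilities on the sets [parts] in dimensions
   [dk k > k] for which [joint] has probability less than [1 / 2]; this contradicts
   the L^2-convergence [defect_null] of the moments. *)
Lemma leb_parts_le M e : 0 < e -> exists k, forall d, (k < d)%N ->
  (leb R (N d) (coordset (@parts d k.+1 (k.+1%:R^-1))) <=
   2%:E * leb R (N d) (coordset (@joint d M e)))%E.
Proof.
move=> e0; apply: contrapT => /forallNP hno.
have /choice[dk hdk] : forall k, exists d, (k < d)%N /\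
    ~ (leb R (N d) (coordset (@parts d k.+1 (k.+1%:R^-1))) <=
       2%:E * leb R (N d) (coordset (@joint d M e)))%E.
  move=> k; have /existsNP[d hd] := hno k; exists d; exact/not_implyP.
pose S k := @parts (dk k) k.+1 (k.+1%:R^-1).
have dk_gt k : (k < dk k)%N by case: (hdk k).
have dk0 k : (0 < dk k)%N by exact: leq_ltn_trans (dk_gt k).
have lt k : (2%:E * leb R (N (dk k)) (coordset (@joint (dk k) M e)) < leb R (N (dk k)) (coordset (S k)))%E.
  by have [_ /negP] := hdk k; rewrite -ltNge.
have mS k : measurable (coordset (S k)) by exact: mstate_measurable.
have mJ k : measurable (coordset (@joint (dk k) M e)) by exact: mstate_measurable.
have Sb k z s : S k z -> bnd (r ^+ 2) (z s) by case.
(* The strict inequality itself forces positive volume, so that the uniform probability exists. *)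
have S0 k : (0 < leb R (N (dk k)) (coordset (S k)))%E.
  by apply: (le_lt_trans _ (lt k)); apply: mule_ge0.
have Soo k := leb_bnd_fin (dk0 k) (@Sb k) (mS k).
have Sbdd k : exists B : R, forall z s i j, S k z -> abs2 (z s i j) <= B.
  by exists (r ^+ 2) => z s i j /Sb -/(_ s); exact: bnd_entry.
have Stw k kap V z : V *m adj V = 1%:M -> S k (twist col kap V z) <-> S k z.
  by move=> hV; apply: mstate_twist => // u [].
pose E k := uniform_expct (mS k) (S0 k) (Soo k) (Sbdd k) (Stw k).
have nd u : xy_sorted u -> null E (defect phi X Y u).
  by apply: (defect_null phi1 hcent dk_gt r0) => k z.
pose W := [seq u <- words_le J M | xy_sorted u].
pose f k := \sum_(u <- W) ex (E k) (fun z => abs2 (defect phi X Y u z)).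
have f0 : f @ \oo --> (0 : R).
  by apply: cvg_sum0 => u; rewrite mem_filter => /andP[su _]; exact: nd.
have e2 : 0 < e ^+ 2 by rewrite exprn_gt0.
have [k fk] : exists k, f k < e ^+ 2 / 2.
  have /cvgrPdist_lt/(_ (e ^+ 2 / 2)) := f0; rewrite divr_gt0 // => /(_ isT)[k _ /(_ k (leqnn k))] /=.
  by rewrite sub0r normrN => /ltr_normlW h; exists k.
pose g (z : J -> 'M[C]_(dk k)) : R := \1_(@joint (dk k) M e) z.
have ag : adm (E k) g.
  split; last by exists 1 => z _; rewrite /g indicE; case: (_ \in _); rewrite ?normr1 ?normr0.
  rewrite (_ : g \o _ = \1_(coordset (@joint (dk k) M e))); first exact: (measurable_indic (mJ k)).
  by apply/funext => t; rewrite /= /g !indicE; congr (nat_of_bool _)%:R; apply/idP/idP; rewrite !inE.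
have ad u : adm (E k) (fun z => abs2 (defect phi X Y u z)).
  by apply: adm_abs2; exact: (defect_fadm phi X Y E u k).
have asum (s : seq (seq J)) : adm (E k) (fun z => \sum_(u <- s) abs2 (defect phi X Y u z)) /\
    ex (E k) (fun z => \sum_(u <- s) abs2 (defect phi X Y u z)) =
    \sum_(u <- s) ex (E k) (fun z => abs2 (defect phi X Y u z)).
  elim: s => [|u s [IH1 IH2]].
    under eq_fun do rewrite big_nil; rewrite big_nil ex_cst; split=> //; exact: adm_cst.
  under eq_fun do rewrite big_cons; rewrite big_cons -IH2; split; first exact: admD.
  exact: exD.
have [aF eF] := asum W.
(* Chebyshev: at a point of [S k] outside [joint] some word of [W] has squared defect at least
   [e ^ 2]. By the choice of [k] the probability of [joint] then exceeds [1 / 2]. *)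
have key : 1 - (e ^+ 2)^-1 * f k <= ex (E k) g.
  rewrite /f -eF -exZ // -[X in X - _](ex_cst (E k)) -exB //; [|exact: adm_cst|exact: admZ].
  apply: ex_le => //; first by apply: admB; [exact: adm_cst|exact: admZ].
  move=> z Sz; rewrite /g indicE; case: (boolP (z \in _)) => [_|].
    rewrite /= gerBl mulr_ge0 ?invr_ge0 ?(ltW e2) // sumr_ge0 // => u _; exact: abs2_ge0.
  rewrite notin_setE => nj; rewrite /= subr_le0.
  have [u [Mu hu]] : exists u, mwords M u /\ e ^+ 2 <= abs2 (defect phi X Y u z).
    apply: contrapT => /forallNP hn; apply: nj; case: Sz => h1 h2 _; split=> // u Mu.
    rewrite -abs2N opprB ltNge; apply/negP => h; exact: (hn u).
  rewrite ler_pdivlMl // mulr1 (le_trans hu) //.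
  have uW : u \in W by rewrite mem_filter; case: Mu => -> /andP[_ /words_leP].
  rewrite (perm_big _ (perm_to_rem uW)) big_cons /= lerDl sumr_ge0 // => v _; exact: abs2_ge0.
have half : 2^-1 < ex (E k) g.
  apply: lt_le_trans key; rewrite ltrBrDr -ltrBrDl ltr_pdivrMl //.
  by move: fk; rewrite (_ : 1 - 2^-1 = 2^-1 :> R) //; lra.
move: half; rewrite /= /uex.
have -> : \int[leb R (N (dk k))]_(t in coordset (S k)) g (bmt t) =
    fine (leb R (N (dk k)) (coordset (@joint (dk k) M e) `&` coordset (S k))).
  rewrite /Rintegral -(integral_indic _ (mS k) (mJ k)); congr fine.
have Sfin : 0 < fine (leb R (N (dk k)) (coordset (S k))) by rewrite fine_gt0 // S0 Soo.
have fI : (leb R (N (dk k)) (coordset (@joint (dk k) M e) `&` coordset (S k)) <= leb R (N (dk k)) (coordset (S k)))%E.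
  by apply: le_measure; rewrite ?inE; [exact: (measurableI _ _ (mJ k) (mS k))|exact: mS|exact: subIsetr].
have fJ : (leb R (N (dk k)) (coordset (@joint (dk k) M e) `&` coordset (S k)) <= leb R (N (dk k)) (coordset (@joint (dk k) M e)))%E.
  by apply: le_measure; rewrite ?inE; [exact: (measurableI _ _ (mJ k) (mS k))|exact: mJ|exact: subIsetl].
rewrite ltr_pdivlMr // => half.
have := lt k; apply/negP; rewrite -leNgt.
have finS : leb R (N (dk k)) (coordset (S k)) \is a fin_num by rewrite ge0_fin_numE.
have finI : leb R (N (dk k)) (coordset (@joint (dk k) M e) `&` coordset (S k)) \is a fin_num.
  by rewrite ge0_fin_numE // (le_lt_trans fI).
apply: (@le_trans _ _ (2%:E * leb R (N (dk k)) (coordset (@joint (dk k) M e) `&` coordset (S k)))%E); last first.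
  by rewrite lee_wpmul2l.
rewrite -(fineK finS) -(fineK finI) -EFinM lee_fin.
by move: half; rewrite -ltr_pdivlMl ?invr_gt0 // invrK => /ltW; rewrite mulrC.
Qed.
End Superadditivity.

(** * Microstates of the system and of its two parts *)

Section MicrostateSets.
Variables (R : realType) (A : cstarAlg R) (phi : {scalar A}).
Local Notation C := R[i].

Lemma lt_normc_abs2 (z : C) (e : R) : 0 < e -> (`|z| < e%:C) = (abs2 z < e ^+ 2).
Proof.
move=> e0; rewrite normc_def ltcR -/(abs2 z) -[in LHS](ger0_norm (ltW e0)) -sqrtr_sqr.
by rewrite ltr_sqrt // exprn_gt0.
Qed.

Lemma adjE d (B : 'M[C]_d) : (map_mx Num.conj B^T) = adj B.
Proof. by apply/matrixP => i j; rewrite !mxE. Qed.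

Lemma mat_map (d : nat) (J J' : finType) (f : J' -> J) u (z : J -> 'M[C]_d) :
  mat (map f u) z = mat u (z \o f).
Proof. by rewrite /mat big_map. Qed.

Variables (n m : nat) (X : 'I_n -> A) (Y : 'I_m -> A).
Local Notation J := ('I_n + 'I_m)%type.

(** A pair of index sequences [i], [j] corresponds to the word [i] followed by [rev j], and the
    words so obtained are exactly those that satisfy [xy_sorted]. *)
Lemma microstatesE (r : R) M d (e : R) : 0 < r -> 0 < e ->
  microstates phi X Y r M (d := d) e = joint phi X Y r (d := d) M e.
Proof.
move=> r0 e0; apply/seteqP; split => B [h1 h2 h3]; split=> [s|s|].
- by rewrite -adjE; exact: h1.
- by apply/opnorm_le; [exact: ltW|exact: h2].
- move=> u [su szu]; rewrite -lt_normc_abs2 //.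
  have := h3 (xs u) (rev (ys u)); rewrite revK size_rev.
  have -> : (size (xs u) + size (ys u) = size u)%N.
    by rewrite [in RHS](xy_sortedE su) size_cat !size_map.
  move=> /(_ szu); congr (`|_ - \tr _ / _| < _).
  by rewrite [in RHS](xy_sortedE su) big_cat /= !big_map.
- by rewrite -[RHS]h1 -adjE.
- by apply/opnorm_le; [exact: ltW|exact: h2].
move=> i j hij.
have := h3 (map inl i ++ map inr (rev j)); rewrite -lt_normc_abs2 //.
have exs : xs (map inl i ++ map inr (rev j) : seq J) = i.
  by rewrite xs_cat /xs; elim: (i) => [|a l /= -> //]; elim: (rev j).
have eys : ys (map inl i ++ map inr (rev j) : seq J) = rev j.
  rewrite ys_cat (_ : ys (map inl i : seq J) = [::]) ?cat0s; last by elim: (i).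
  by elim: (rev j) => //= a l ->.
have hw : mwords M (map inl i ++ map inr (rev j) : seq J).
  split; last by rewrite size_cat !size_map size_rev.
  rewrite /xy_sorted pairwise_cat; apply/and3P; split.
  - by apply/allrelP => a b /mapP[a' _ ->].
  - by elim: (i) => //= a l ->; rewrite andbT; apply/allP.
  - elim: (rev j) => //= a l ->; rewrite andbT; by apply/allP => b /mapP[b' _ ->].
move=> /(_ hw); rewrite /phihat exs eys revK; congr (`|_ - \tr _ / _| < _).
by rewrite /mat big_cat /= !big_map.
Qed.

Lemma lebesgue_saE (K : finType) d (S : set (K -> 'M[C]_d)) : measurable (coordset S) ->
  lebesgue_sa S = leb R #|{: K * 'I_d * 'I_d}| (coordset S).
Proof. exact: lebesgue_finE. Qed.

Lemma measurable_micro (r : R) M d (e : R) : 0 < r -> 0 < e ->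
  measurable (coordset (microstates phi X Y r M (d := d) e)).
Proof. by move=> r0 e0; rewrite microstatesE //; exact: mstate_measurable. Qed.
End MicrostateSets.

Definition tail_ord n p (hp : (p <= n)%N) (i : 'I_(n - p)) : 'I_n :=
  cast_ord (subnKC hp) (rshift p i).

Section Parts.
Variables (R : realType) (A : cstarAlg R) (phi : {scalar A}) (n m : nat).
Variables (X : 'I_n -> A) (Y : 'I_m -> A) (p q : nat) (hp : (p <= n)%N) (hq : (q <= m)%N).
Local Notation C := R[i].
Local Notation J := ('I_n + 'I_m)%type.
Local Notation J1 := ('I_p + 'I_q)%type.
Local Notation J2 := ('I_(n - p) + 'I_(m - q))%type.
Local Notation col := (@colour n m p q).

Definition inj1 (s : J1) : J :=
  match s with inl i => inl (widen_ord hp i) | inr j => inr (widen_ord hq j) end.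
Definition inj2 (s : J2) : J :=
  match s with inl i => inl (cast_ord (subnKC hp) (rshift p i))
  | inr j => inr (cast_ord (subnKC hq) (rshift q j)) end.

Lemma ord_split (n' p' : nat) (h : (p' <= n')%N) (i : 'I_n') :
  {x : 'I_p' + 'I_(n' - p') | match x with inl a => widen_ord h a
    | inr b => cast_ord (subnKC h) (rshift p' b) end = i}.
Proof.
case: (ltnP i p') => ip; first by exists (inl (Ordinal ip)); exact: val_inj.
have ip' : (i - p' < n' - p')%N by rewrite ltn_sub2r // (leq_ltn_trans ip).
by exists (inr (Ordinal ip')); apply: val_inj; rewrite /= subnKC.
Qed.

Definition split_idx (s : J) : J1 + J2 :=
  match s with
  | inl i => match sval (ord_split hp i) with inl a => inl (inl a) | inr b => inr (inl b) end
  | inr j => match sval (ord_split hq j) with inl a => inl (inr a) | inr b => inr (inr b) end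
  end.

Lemma split_idxK s : match split_idx s with inl a => inj1 a | inr b => inj2 b end = s.
Proof. by case: s => i /=; case: (ord_split _ i) => -[a|b] /= ->. Qed.

Lemma split_inj1 s : split_idx (inj1 s) = inl s.
Proof.
by case: s => i /=; case: (ord_split _ _) => -[a|b] /= /(congr1 val) /= e;
  [congr (inl _); congr (_ _); exact: val_inj|have := ltn_ord i; rewrite -e; lia
  |congr (inl _); congr (_ _); exact: val_inj|have := ltn_ord i; rewrite -e; lia].
Qed.

Lemma split_inj2 s : split_idx (inj2 s) = inr s.
Proof.
by case: s => i /=; case: (ord_split _ _) => -[a|b] /= /(congr1 val) /= e;
  [have := ltn_ord a; rewrite e; lia|congr (inr _); congr (_ _); apply: val_inj => /=; lia
  |have := ltn_ord a; rewrite e; lia|congr (inr _); congr (_ _); apply: val_inj => /=; lia].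
Qed.

Lemma col_inj1 s : col (inj1 s) = true. Proof. by case: s => i; rewrite /= ltn_ord. Qed.
Lemma col_inj2 s : col (inj2 s) = false.
Proof. by case: s => i /=; rewrite ltnNge leq_addr. Qed.

Section embedding.
Variables (n' m' : nat) (f : 'I_n' -> 'I_n) (g : 'I_m' -> 'I_m) (kap : bool).
Definition emb (s : 'I_n' + 'I_m') : J := match s with inl i => inl (f i) | inr j => inr (g j) end.
Hypothesis col_emb : forall s, col (emb s) = kap.
Hypothesis emb_onto : forall s, col s = kap -> exists s', emb s' = s.

Lemma phihat_emb u : phihat phi (X \o f) (Y \o g) u = phihat phi X Y (map emb u).
Proof.
have ex : xs (map emb u) = map f (xs u) by elim: u => //= -[i|j] u /= ->.
have ey : ys (map emb u) = map g (ys u) by elim: (u) => //= -[i|j] l /= ->.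
by rewrite /phihat ex ey -map_rev !big_map.
Qed.

Lemma emb_word u : all (fun s => col s == kap) u -> exists v, u = map emb v.
Proof.
elim: u => [|s u IH] /=; first by exists [::].
by move=> /andP[/eqP /emb_onto[s' <-] /IH[v ->]]; exists (s' :: v).
Qed.

Lemma xy_sorted_emb v : xy_sorted (map emb v) = xy_sorted v.
Proof. by rewrite /xy_sorted pairwise_map; apply: eq_pairwise => -[a|a] [b|b]. Qed.

End embedding.

(** A word of one colour is the image under [inj1] or [inj2] of a word in the letters of one part,
    so the constraints separate into those of the two subsystems. *)
Lemma partsP d M (r e : R) (z : J -> 'M[C]_d) :
  parts phi X Y p q r (d := d) M e z <->
  joint phi (first_part hp X) (first_part hq Y) r (d := d) M e (z \o inj1) /\
  joint phi (last_part hp X) (last_part hq Y) r (d := d) M e (z \o inj2).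
Proof.
have e1 : inj1 = emb (widen_ord hp) (widen_ord hq) by apply/funext => -[].
have e2 : inj2 = emb (@tail_ord n p hp) (@tail_ord m q hq).
  by apply/funext => -[].
have on1 s : col s = true -> exists s', inj1 s' = s.
  move=> cs; have := split_idxK s; case: (split_idx s) => a; first by exists a.
  by move=> e'; move: cs; rewrite -e' col_inj2.
have on2 s : col s = false -> exists s', inj2 s' = s.
  move=> cs; have := split_idxK s; case: (split_idx s) => a; last by exists a.
  by move=> e'; move: cs; rewrite -e' col_inj1.
split.
  move=> [h1 h2 h3]; split; (split=> [s|s|v [sv szv]]; [exact: h1|exact: h2|]).
    rewrite (phihat_emb (widen_ord hp) (widen_ord hq)) -e1 -/(mat v _) -mat_map.
    apply: h3; split; last by exists true; apply/allP => s /mapP[s' _ ->]; rewrite col_inj1.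
    by rewrite /mwords /= size_map e1 xy_sorted_emb.
  rewrite (phihat_emb (@tail_ord n p hp) (@tail_ord m q hq)) -e2 -/(mat v _) -mat_map.
  apply: h3; split; last by exists false; apply/allP => s /mapP[s' _ ->]; rewrite col_inj2.
  by rewrite /mwords /= size_map e2 xy_sorted_emb.
move=> [[a1 a2 a3] [b1 b2 b3]]; split=> [s|s|u [[su szu] [[] uk]]].
- by rewrite -(split_idxK s); case: (split_idx s) => x; [exact: a1|exact: b1].
- by rewrite -(split_idxK s); case: (split_idx s) => x; [exact: a2|exact: b2].
- have [v e'] := emb_word (kap := true) (f := widen_ord hp) (g := widen_ord hq)
     (fun s hs => let: ex_intro s' q := on1 s hs in ex_intro _ s' (etrans (esym (congr1 (fun h => h s') e1)) q)) uk.
  rewrite e' -phihat_emb -/(mat _ _) mat_map -e1; apply: a3.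
  by move: su szu; rewrite e' xy_sorted_emb size_map.
have [v e'] := emb_word (kap := false) (f := @tail_ord n p hp) (g := @tail_ord m q hq)
     (fun s hs => let: ex_intro s' q := on2 s hs in ex_intro _ s' (etrans (esym (congr1 (fun h => h s') e2)) q)) uk.
rewrite e' -phihat_emb -/(mat _ _) mat_map -e2; apply: b3.
by move: su szu; rewrite e' xy_sorted_emb size_map.
Qed.

Lemma lebesgue_parts d M (r e : R) : 0 < r -> 0 < e ->
  leb R #|{: J * 'I_d * 'I_d}| (coordset (parts phi X Y p q r (d := d) M e)) =
  (lebesgue_sa (microstates phi (first_part hp X) (first_part hq Y) r M (d := d) e) *
   lebesgue_sa (microstates phi (last_part hp X) (last_part hq Y) r M (d := d) e))%E.
Proof.
move=> r0 e0.
pose f1 (x : J1 * 'I_d * 'I_d) : J * 'I_d * 'I_d := (inj1 x.1.1, x.1.2, x.2).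
pose f2 (x : J2 * 'I_d * 'I_d) : J * 'I_d * 'I_d := (inj2 x.1.1, x.1.2, x.2).
pose g (x : J * 'I_d * 'I_d) : J1 * 'I_d * 'I_d + J2 * 'I_d * 'I_d :=
  match split_idx x.1.1 with inl s => inl (s, x.1.2, x.2) | inr s => inr (s, x.1.2, x.2) end.
have gf1 x : g (f1 x) = inl x by case: x => -[s k] l; rewrite /g /f1 /= split_inj1.
have gf2 x : g (f2 x) = inr x by case: x => -[s k] l; rewrite /g /f2 /= split_inj2.
have fg x : match g x with inl y => f1 y | inr y => f2 y end = x.
  by case: x => -[s k] l; rewrite /g /f1 /f2 /=; have := split_idxK s; case: (split_idx s) => a /= ->.
have m1 := measurable_micro phi (first_part hp X) (first_part hq Y) M (d:=d) r0 e0.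
have m2 := measurable_micro phi (last_part hp X) (last_part hq Y) M (d:=d) r0 e0.
have [mS <-] := lebesgue_fin_prod gf1 gf2 fg m1 m2.
rewrite lebesgue_finE //; congr (leb _ _ _); rewrite /coordset /fin_set.
apply/seteqP; split => t /=; rewrite !microstatesE //; first by move/partsP.
by move=> h; apply/partsP.
Qed.
End Parts.

(** * Entropy *)

(** The logarithm is additive also at volume 0, because [-oo] absorbs finite values; finiteness
    excludes the product of 0 and [+oo]. *)
Lemma weighted_lneM (R : realType) (t c1 c2 : R) (a b : \bar R) : 0 < t ->
  (0 <= a < +oo)%E -> (0 <= b < +oo)%E ->
  (t%:E * lne (a * b) + (c1 + c2)%:E = (t%:E * lne a + c1%:E) + (t%:E * lne b + c2%:E))%E.
Proof.
move=> t0; case: a => [x| |] //; last by rewrite ltxx andbF.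
case: b => [y| |] // ; last by rewrite ltxx andbF.
rewrite !lee_fin => /andP[x0 _] /andP[y0 _].
have tN : (t%:E * -oo = -oo)%E by rewrite gt0_muleNy // lte_fin.
case: (eqVneq x 0) => [->|xn0].
  by rewrite mul0e (le0_lneNy (lexx 0%E)) tN !addNye.
case: (eqVneq y 0) => [->|yn0].
  by rewrite mule0 (le0_lneNy (lexx 0%E)) tN !addNye addeNy.
have xp : 0 < x by rewrite lt0r xn0.
have yp : 0 < y by rewrite lt0r yn0.
rewrite -EFinM !lne_EFin ?mulr_gt0 // lnM ?posrE // -!EFinM -!EFinD; congr (_%:E); ring.
Qed.

Lemma weighted_lne_le (R : realType) (t c : R) (a b : \bar R) : 0 < t -> (0 <= a)%E -> (a <= b)%E ->
  (t%:E * lne a + c%:E <= t%:E * lne b + c%:E)%E.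
Proof.
move=> t0 a0 ab; apply: leeD2r; apply: lee_wpmul2l; first by rewrite lee_fin ltW.
by rewrite lee_lne // in_itv /= leey andbT ?a0 // (le_trans a0).
Qed.

Section Normalised.
Variables (R : realType) (A : cstarAlg R) (phi : {scalar A}) (n m : nat).
Variables (X : 'I_n -> A) (Y : 'I_m -> A) (r : R).
Hypothesis r0 : 0 < r.
Local Notation J := ('I_n + 'I_m)%type.

Lemma microstates_fin M d (e : R) : (0 < d)%N -> 0 < e ->
  (0 <= lebesgue_sa (microstates phi X Y r M (d := d) e) < +oo)%E.
Proof.
move=> d0 e0; rewrite lebesgue_saE; last exact: measurable_micro.
rewrite measure_ge0 /=; apply: (@leb_bnd_fin _ _ _ _ r d0); last exact: measurable_micro.
by move=> z s; rewrite microstatesE // => -[].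
Qed.

(** The terms in [ln d] cancel, so the bound is independent of [d]. It keeps all upper limits below
    [+oo], which makes their sums meaningful. *)
Lemma chi_seq_le M (e : R) d : (0 < d)%N -> 0 < e ->
  (chi_seq phi X Y r M e d <= ((n + m)%:R * (r ^+ 2 / 2 + ln (pi *+ 2) / 2))%:E)%E.
Proof.
move=> d0 e0; have dR : 0 < d%:R :> R by rewrite ltr0n.
have t0 : 0 < d%:R ^- 2 :> R by rewrite invr_gt0 exprn_gt0.
have /andP[v0 voo] := microstates_fin M d0 e0.
have m1 := measurable_micro phi X Y M (d := d) r0 e0.
have := leb_bnd_le d0 (r := r) (fun z s => _) m1; rewrite -lebesgue_saE // => hb.
rewrite /chi_seq /chi_d; apply: (le_trans (weighted_lne_le _ t0 v0 (hb _))).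
  by move=> z s; rewrite microstatesE // => -[].
have p2 : 0 < pi *+ 2 :> R by rewrite mulrn_wgt0 // pi_gt0.
have pd : 0 < pi *+ 2 / d%:R :> R by rewrite divr_gt0.
have sd : 0 < Num.sqrt (pi *+ 2 / d%:R) :> R by rewrite sqrtr_gt0.
have ls : ln (Num.sqrt (pi *+ 2 / d%:R)) = (ln (pi *+ 2) - ln d%:R) / 2 :> R.
  have := lnXn 2 sd; rewrite sqr_sqrtr ?ltW // ln_div ?posrE // => ->.
  by rewrite -[ln (Num.sqrt _) *+ 2]mulr_natr mulfK.
rewrite lne_EFin ?mulr_gt0 ?expR_gt0 ?exprn_gt0 // lnM ?posrE ?expR_gt0 ?exprn_gt0 //.
rewrite expRK lnXn // ls -EFinM -EFinD lee_fin.
rewrite !card_prod card_sum !card_ord -[(_ / 2) *+ _]mulr_natr !natrM le_eqVlt; apply/orP; left; apply/eqP.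
by field; rewrite gt_eqF.
Qed.

Lemma joint_le M M' d (e e' : R) : (M' <= M)%N -> 0 < e <= e' ->
  joint phi X Y r (d := d) M e `<=` joint phi X Y r M' e'.
Proof.
move=> MM /andP[e0 ee] z [h1 h2 h3]; split=> // u [su /andP[u0 uM]].
apply: (lt_le_trans (h3 u _)); first by split=> //; rewrite u0 (leq_trans uM).
by rewrite lerXn2r // nnegrE ltW // (lt_le_trans e0).
Qed.

Lemma chi_seq_anti M M' d (e e' : R) : (0 < d)%N -> (M' <= M)%N -> 0 < e <= e' ->
  (chi_seq phi X Y r M e d <= chi_seq phi X Y r M' e' d)%E.
Proof.
move=> d0 MM /[dup] he /andP[e0 ee]; have e0' := lt_le_trans e0 ee.
have /andP[v0 _] := microstates_fin M d0 e0.
apply: weighted_lne_le => //; first by rewrite invr_gt0 exprn_gt0 // ltr0n.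
rewrite !lebesgue_saE; [|exact: measurable_micro|exact: measurable_micro].
apply: le_measure; rewrite ?inE; [exact: measurable_micro|exact: measurable_micro|].
by rewrite !microstatesE // => t; exact: joint_le.
Qed.
End Normalised.

Lemma chi_seq_mono (R : realType) (A : cstarAlg R) (phi : {scalar A}) n m (X : 'I_n -> A) (Y : 'I_m -> A)
    (r r' : R) M d e : 0 < r <= r' -> (0 < d)%N -> 0 < e ->
  (chi_seq phi X Y r M e d <= chi_seq phi X Y r' M e d)%E.
Proof.
move=> /andP[r0 rr] d0 e0; have r0' := lt_le_trans r0 rr.
have /andP[v0 _] := microstates_fin phi X Y r0 M d0 e0.
apply: weighted_lne_le => //; first by rewrite invr_gt0 exprn_gt0 // ltr0n.
rewrite !lebesgue_saE; [|exact: measurable_micro|exact: measurable_micro].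
apply: le_measure; rewrite ?inE; [exact: measurable_micro|exact: measurable_micro|].
by move=> t [h1 h2 h3]; split=> // s; exact: le_trans (h2 s) rr.
Qed.

Section Comparison.
Variables (R : realType) (A : cstarAlg R) (phi : {scalar A}) (n m : nat).
Variables (X : 'I_n -> A) (Y : 'I_m -> A) (p q : nat) (hp : (p <= n)%N) (hq : (q <= m)%N).
Variable r : R.
Hypothesis r0 : 0 < r.
Local Notation u := (chi_seq phi X Y r).
Local Notation u1 := (chi_seq phi (first_part hp X) (first_part hq Y) r).
Local Notation u2 := (chi_seq phi (last_part hp X) (last_part hq Y) r).

Lemma chi_seqD M (e : R) d : (0 < d)%N -> 0 < e ->
  (u1 M e d + u2 M e d = (d%:R ^- 2)%:E * lne (leb R #|{: ('I_n + 'I_m) * 'I_d * 'I_d}|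
      (coordset (parts phi X Y p q r (d := d) M e))) + ((n + m)%:R / 2 * ln d%:R)%:E)%E.
Proof.
move=> d0 e0; rewrite (lebesgue_parts phi X Y hp hq) // /chi_seq -weighted_lneM.
- by congr (_ + _%:E)%E; rewrite -mulrDl -mulrDl -natrD; congr (_%:R / _ * _); lia.
- by rewrite invr_gt0 exprn_gt0 // ltr0n.
- exact: microstates_fin.
- exact: microstates_fin.
Qed.

Lemma chi_seq_sub M (e : R) d : (0 < d)%N -> 0 < e -> (u M e d <= u1 M e d + u2 M e d)%E.
Proof.
move=> d0 e0; rewrite chi_seqD //.
have /andP[v0 _] := microstates_fin phi X Y r0 M d0 e0.
apply: weighted_lne_le => //; first by rewrite invr_gt0 exprn_gt0 // ltr0n.
rewrite lebesgue_saE; last exact: measurable_micro.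
apply: le_measure; rewrite ?inE; [exact: measurable_micro|exact: mstate_measurable|].
rewrite microstatesE // => t [h1 h2 h3]; split=> // w [mw _]; exact: h3.
Qed.

Hypothesis phi1 : phi 1 = 1.
Hypothesis hcent : forall bs : seq (block n m), bs != [::] -> all (mono p q) bs ->
  Defs.alternating (map fst bs) -> xy_sorted (flatten (map snd bs)) ->
  \sum_(cu <- cent phi X Y bs) cu.1 * phihat phi X Y cu.2 = 0.

(** The factor 2 of [leb_parts_le] becomes the term with [ln 2]. The same [k] governs the length of
    the words, the precision and the dimension from which the comparison holds. *)
Lemma chi_seq_super M (e : R) : 0 < e -> exists k, forall d, (k < d)%N ->
  (u1 k.+1 (k.+1%:R^-1) d + u2 k.+1 (k.+1%:R^-1) d <= (d%:R ^- 2 * ln 2)%:E + u M e d)%E.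
Proof.
move=> e0; have [k hk] := leb_parts_le phi1 hcent r0 M e0; exists k => d kd.
have d0 : (0 < d)%N by exact: leq_ltn_trans kd.
have t0 : 0 < d%:R ^- 2 :> R by rewrite invr_gt0 exprn_gt0 // ltr0n.
rewrite chi_seqD // ?invr_gt0 //; apply: (le_trans (weighted_lne_le _ t0 _ (hk d kd))) => //.
rewrite -[X in (_ + X%:E)%E]add0r weighted_lneM //.
- by rewrite lne_EFin // -EFinM -EFinD addr0 /chi_seq /chi_d lebesgue_saE ?microstatesE //; exact: mstate_measurable.
- by rewrite lee_fin ltry ler0n.
rewrite -[joint _ _ _ _ _ _]microstatesE // -lebesgue_saE; last exact: measurable_micro.
exact: microstates_fin.
Qed.
End Comparison.

(** * Upper limits along filters, extended reals and ultrafilters *)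

Section Limsup.
Variables (R : realType) (F : set_system nat).
Context {FF : ProperFilter F}.
Implicit Types (u v : nat -> \bar R).

Lemma limf_esup_le u v : (\forall d \near F, (u d <= v d)%E) -> (limf_esup u F <= limf_esup v F)%E.
Proof.
move=> uv; rewrite !limf_esupE; apply: le_ereal_inf_tmp => _ [V FV <-].
apply: ge_ereal_inf; exists (ereal_sup (u @` (V `&` [set d | (u d <= v d)%E]))).
  by exists (V `&` [set d | (u d <= v d)%E]) => //; exact: filterI.
apply: ge_ereal_sup => _ [d [Vd /= ud] <-]; apply: (le_trans ud).
by apply: ereal_sup_ubound; exists d.
Qed.

Lemma limf_esup_shift u (c : R) :
  (limf_esup (fun d => c%:E + u d) F <= c%:E + limf_esup u F)%E.
Proof.
rewrite -leeBlDl // [leRHS]limf_esupE; apply: le_ereal_inf_tmp => _ [V FV <-].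
rewrite leeBlDl // limf_esupE.
apply: ge_ereal_inf; exists (ereal_sup ((fun d => c%:E + u d)%E @` V)); first by exists V.
apply: ge_ereal_sup => _ [d Vd <-]; apply: leeD2l.
by apply: ereal_sup_ubound; exists d.
Qed.

Lemma cvg_limf_esup u (l : \bar R) : u @ F --> l -> limf_esup u F = l.
Proof.
move=> ul; apply/eqP; rewrite eq_le; apply/andP; split; last first.
  rewrite limf_esupE; apply: le_ereal_inf_tmp => _ [V FV <-].
  apply: (cvge_to_le ul).
  by apply: filterS FV => d Vd; apply: ereal_sup_ubound; exists d.
have key (c : R) : (l < c%:E)%E -> (limf_esup u F <= c%:E)%E.
  move=> lc; rewrite limf_esupE.
  have FV : F [set d | (u d < c%:E)%E] by 
    apply: (ul [set y | (y < c%:E)%E]); apply: open_nbhs_nbhs; split=> //; exact: open_ereal_lt_ereal.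
  apply: ge_ereal_inf; exists (ereal_sup (u @` [set d | (u d < c%:E)%E])); first by exists [set d | (u d < c%:E)%E].
  by apply: ge_ereal_sup => _ [d /= /ltW h <-].
case: l {ul} key => [l| |] key; last 2 first.
- exact: leey.
- rewrite leNgt; apply/negP => h.
  have [c h1 h2] : exists2 c : R, (-oo < c%:E)%E & (c%:E < limf_esup u F)%E.
    case: (limf_esup u F) h => [x| |] // _; last by exists 0; rewrite ?ltNyr ?ltry.
    by exists (x - 1); rewrite ?ltNyr // lte_fin gtrBl.
  by have := key c h1; rewrite leNgt h2.
by apply/lee_addgt0Pr => e e0; rewrite -EFinD; apply: key; rewrite lte_fin ltrDl.
Qed.
End Limsup.

Section EReal.
Variable R : realType.
Implicit Types (S T : set (\bar R)) (x y z : \bar R).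
Local Open Scope ereal_scope.

(** The hypotheses exclude the sum of [+oo] and [-oo], which by convention is [-oo]. If one infimum
    is [-oo], then [z] lies below every real and is itself [-oo]. *)
Lemma le_infD S T z : ereal_inf S < +oo -> ereal_inf T < +oo ->
  (forall x y, S x -> T y -> z <= x + y) -> z <= ereal_inf S + ereal_inf T.
Proof.
move=> So To h.
have key (c c' : R) : ereal_inf S < c%:E -> ereal_inf T < c'%:E -> z <= (c + c')%:E.
  move=> /ereal_inf_ltP[x Sx xc] /ereal_inf_ltP[y Ty yc].
  by rewrite EFinD; apply: le_trans (h x y Sx Ty) (leeD (ltW xc) (ltW yc)).
have Ny (c' : R) : (forall c, z <= (c + c')%:E) -> z = -oo.
  case: z {h key So To} => [z| |] // hz; last by have := hz 0%R; rewrite leNgt ltry.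
  by have := hz (z - c' - 1)%R; rewrite lee_fin => {}hz; exfalso; lra.
case: (ereal_inf S) (ereal_inf T) So To key => [a| |] [b| |] // _ _ key.
- apply/lee_addgt0Pr => e e0; rewrite -!EFinD.
  rewrite (_ : a + b + e = (a + e / 2) + (b + e / 2))%R; last by lra.
  by apply: key; rewrite lte_fin; lra.
- rewrite addeNy leeNy_eq; apply/eqP; apply: (Ny (a + 1)%R) => c.
  by rewrite addrC; apply: key; rewrite ?ltNyr // lte_fin; lra.
- rewrite addNye leeNy_eq; apply/eqP; apply: (Ny (b + 1)%R) => c.
  by apply: key; rewrite ?ltNyr // lte_fin; lra.
by rewrite leeNy_eq; apply/eqP; apply: (Ny 0%R) => c; apply: key; rewrite ltNyr.
Qed.

(** Dual to [le_infD] by negation; a supremum equal to [-oo] is apart because negation would turn it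
    into [+oo]. *)
Lemma ge_supD S T z : (forall x, S x -> x < +oo) -> (forall y, T y -> y < +oo) ->
  (forall x y, S x -> T y -> x + y <= z) -> ereal_sup S + ereal_sup T <= z.
Proof.
move=> So To h.
case: (eqVneq (ereal_sup S) -oo) => [->|Sn]; first by rewrite addNye leNye.
case: (eqVneq (ereal_sup T) -oo) => [->|Tn]; first by rewrite addeNy leNye.
have e U : ereal_sup U = - ereal_inf (-%E @` U).
  by rewrite /ereal_inf oppeK image_comp eq_image_id // => w _; rewrite /= oppeK.
have l U : ereal_sup U != -oo -> ereal_inf (-%E @` U) < +oo.
  by rewrite e => hU; rewrite ltey; apply: contraNN hU => /eqP ->.
rewrite -leeN2 oppeD; last first.
  by case: (ereal_sup S) (ereal_sup T) Sn Tn => [a| |] [b| |].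
rewrite !e !oppeK; apply: le_infD; [exact: l|exact: l|].
move=> _ _ [x Sx <-] [y Ty <-]; rewrite -oppeD; first by rewrite leeN2; exact: h.
by move: (So x Sx) (To y Ty); case: x {Sx} => [a| |]; case: y {Ty} => [b| |].
Qed.
End EReal.

Section Ultrafilters.
Variables (R : realType) (w : set_system nat).
Context {UW : UltraFilter w}.

(** An ultrafilter containing a singleton is principal; so [w] contains the complement of each
    point, and finite intersections of these give the tails. *)
Lemma nonprincipal_gt : (forall k, w <> principal_filter k) -> forall k, \forall d \near w, (k < d)%N.
Proof.
move=> np; have npt k : w (~` [set k]).
  have [wk|//] := in_ultra_setVsetC [set k] UW; exfalso; apply: (np k).
  apply/seteqP; split => [P wP|P /principal_filterP Pk].
    have [x [/= -> Pk]] : [set k] `&` P !=set0 by apply: (@filter_ex _ w); exact: filterI.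
    exact/principal_filterP.
  by apply: filterS wk => _ ->.
elim=> [|k IH]; first by apply: filterS (npt 0%N) => -[|d] // /(_ erefl).
by apply: filterS2 (npt k.+1) IH => d /eqP dk kd; rewrite ltn_neqAle eq_sym dk.
Qed.

(** The upper limit is the limit: for each [x], either [x < u d] holds along [w] or its negation
    does, and the latter bounds the upper limit by [x]. *)
Lemma ultra_cvg_ereal (u : nat -> \bar R) : cvg (u @ w).
Proof.
pose l := limf_esup u w.
have up (x : \bar R) : (l < x)%E -> \forall d \near w, (u d < x)%E.
  move=> /ereal_inf_ltP[_ [V wV <-] Vx]; apply: filterS wV => d Vd.
  by apply: le_lt_trans Vx; apply: ereal_sup_ubound; exists d.
have low (x : \bar R) : (x < l)%E -> \forall d \near w, (x < u d)%E.
  move=> xl; have [//|h] := in_ultra_setVsetC [set d | (x < u d)%E] UW.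
  move: xl; rewrite ltNge; case/negP; apply: ge_ereal_inf.
  exists (ereal_sup (u @` (~` [set d | (x < u d)%E]))); first by eexists; first exact: h.
  by apply: ge_ereal_sup => _ [d /= /negP nd <-]; rewrite leNgt.
apply/cvg_ex; exists l; case: l up low => [l| |] up low.
- apply/fine_cvgP; split.
    near=> d; rewrite fin_numElt; apply/andP; split.
      by near: d; apply: low; exact: ltNyr.
    by near: d; apply: up; exact: ltry.
  apply/cvgrPdist_lt => e e0; near=> d.
  have h1 : ((l - e)%:E < u d)%E by near: d; apply: low; rewrite lte_fin gtrBl.
  have h2 : (u d < (l + e)%:E)%E by near: d; apply: up; rewrite lte_fin ltrDl.
  rewrite /=; case: (u d) h1 h2 => // x; rewrite !lte_fin /= ltr_distl; lra.
- by apply/cvgeyPgt => x; apply: low; exact: ltry.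
- by apply/cvgeNyPlt => x; apply: up; exact: ltNyr.
Unshelve. all: by end_near. Qed.
End Ultrafilters.

Section Additivity.
Variables (R : realType) (A : cstarAlg R) (phi : {scalar A}) (n m : nat).
Variables (X : 'I_n -> A) (Y : 'I_m -> A) (p q : nat) (hp : (p <= n)%N) (hq : (q <= m)%N).
Hypothesis phi1 : phi 1 = 1.
Hypothesis hcent : forall bs : seq (block n m), bs != [::] -> all (mono p q) bs ->
  Defs.alternating (map fst bs) -> xy_sorted (flatten (map snd bs)) ->
  \sum_(cu <- cent phi X Y bs) cu.1 * phihat phi X Y cu.2 = 0.
Variable F : set_system nat.
Context {FF : ProperFilter F}.
Hypothesis F_gt : forall k, \forall d \near F, (k < d)%N.
Local Notation u := (chi_seq phi X Y).
Local Notation u1 := (chi_seq phi (first_part hp X) (first_part hq Y)).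
Local Notation u2 := (chi_seq phi (last_part hp X) (last_part hq Y)).
Hypothesis cvg1 : forall (r : R) M (e : R), 0 < r -> (0 < M)%N -> 0 < e -> cvg (u1 r M e @ F).
Hypothesis cvg2 : forall (r : R) M (e : R), 0 < r -> (0 < M)%N -> 0 < e -> cvg (u2 r M e @ F).
Local Notation Ls v := (limf_esup v F).

Lemma limf_chi_seq_lt n' m' (X' : 'I_n' -> A) (Y' : 'I_m' -> A) (r : R) M (e : R) : 0 < r -> 0 < e ->
  (Ls (chi_seq phi X' Y' r M e) < +oo)%E.
Proof.
move=> r0 e0; pose K := (n' + m')%:R * (r ^+ 2 / 2 + ln (pi *+ 2) / 2).
apply: (@le_lt_trans _ _ K%:E); last exact: ltry.
rewrite -(cvg_limf_esup (F := F) (u := fun=> K%:E) (cvg_cst _)); apply: limf_esup_le.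
by apply: filterS (F_gt 0) => d d0; exact: chi_seq_le.
Qed.

Lemma limf_chi_seq_anti n' m' (X' : 'I_n' -> A) (Y' : 'I_m' -> A) (r : R) M M' (e e' : R) : 0 < r ->
  (M' <= M)%N -> 0 < e <= e' -> (Ls (chi_seq phi X' Y' r M e) <= Ls (chi_seq phi X' Y' r M' e'))%E.
Proof.
move=> r0 MM ee; apply: limf_esup_le.
by apply: filterS (F_gt 0) => d d0; exact: chi_seq_anti.
Qed.

(** Here the convergence of the marginal sequences enters: in general the upper limit of a sum is
    only at most the sum of the upper limits, which is the wrong direction for superadditivity. *)
Lemma limf_chi_seqD (r : R) M (e : R) : 0 < r -> (0 < M)%N -> 0 < e ->
  Ls (fun d => u1 r M e d + u2 r M e d)%E = (Ls (u1 r M e) + Ls (u2 r M e))%E.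
Proof.
move=> r0 M0 e0; have l1 := limf_chi_seq_lt (first_part hp X) (first_part hq Y) M r0 e0.
have l2 := limf_chi_seq_lt (last_part hp X) (last_part hq Y) M r0 e0.
have c1 := cvg1 r0 M0 e0; have c2 := cvg2 r0 M0 e0.
move: l1 l2; rewrite (cvg_limf_esup c1) (cvg_limf_esup c2) => l1 l2.
apply: cvg_limf_esup; apply: cvgeD => //.
by apply: ltpinfty_adde_def; rewrite inE.
Qed.

Lemma limf_chi_seq_sub (r : R) M (e : R) : 0 < r -> (0 < M)%N -> 0 < e ->
  (Ls (u r M e) <= Ls (u1 r M e) + Ls (u2 r M e))%E.
Proof.
move=> r0 M0 e0; rewrite -limf_chi_seqD //; apply: limf_esup_le.
by apply: filterS (F_gt 0) => d d0; exact: chi_seq_sub.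
Qed.

Lemma limf_chi_seq_super (r : R) M (e : R) : 0 < r -> (0 < M)%N -> 0 < e -> exists k,
  (Ls (u1 r k.+1 k.+1%:R^-1) + Ls (u2 r k.+1 k.+1%:R^-1) <= Ls (u r M e))%E.
Proof.
move=> r0 M0 e0; have [k hk] := chi_seq_super hp hq r0 phi1 hcent M e0; exists k.
rewrite -limf_chi_seqD ?invr_gt0 //; apply/lee_addgt0Pr => c c0; rewrite [leRHS]addeC.
apply: (le_trans _ (limf_esup_shift F (u r M e) c)); apply: limf_esup_le.
(* For [d > K] the error [ln 2 / d ^ 2] is below [c]. *)
have [K hK] : exists K : nat, ln 2 / c < K%:R by exists (Num.Def.archi_bound (ln 2 / c)); apply: archi_boundP; rewrite divr_ge0 ?(ltW c0) // ln_ge0 // ler1n.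
near=> d; have kd : (k < d)%N by near: d; exact: F_gt.
have Kd : (K < d)%N by near: d; exact: F_gt.
apply: (le_trans (hk d kd)); apply: leeD2r; rewrite lee_fin.
have d1 : 1 <= d%:R :> R by rewrite ler1n (leq_ltn_trans _ kd).
rewrite ler_pdivrMl ?exprn_gt0 ?(lt_le_trans ltr01) // -ler_pdivrMr // (le_trans (ltW hK)) //.
rewrite (@le_trans _ _ (d%:R)) ?ler_nat ?(ltnW Kd) // expr2 ler_peMr // (le_trans ler01).
Unshelve. all: by end_near. Qed.

(** Independent choices for the two parts are replaced by the common ones [maxn M M'],
    [Num.min e e'] and [Num.max r r']; monotonicity in each parameter makes this harmless. *)
Lemma chi_of_limf_esupD :
  chi_of phi X Y (fun v => limf_esup v F) =
  (chi_of phi (first_part hp X) (first_part hq Y) (fun v => limf_esup v F) +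
   chi_of phi (last_part hp X) (last_part hq Y) (fun v => limf_esup v F))%E.
Proof.
pose I n' m' (X' : 'I_n' -> A) (Y' : 'I_m' -> A) r :=
  ereal_inf [set Ls (chi_seq phi X' Y' r Me.1 Me.2) | Me in [set Me : nat * R | (0 < Me.1)%N /\ 0 < Me.2]].
have Ile n' m' X' Y' r M e : (0 < M)%N -> 0 < e -> (@I n' m' X' Y' r <= Ls (chi_seq phi X' Y' r M e))%E.
  by move=> M0 e0; apply: ereal_inf_lbound; exists (M, e).
have Ioo n' m' X' Y' r : 0 < r -> (@I n' m' X' Y' r < +oo)%E.
  by move=> r0; apply: le_lt_trans (Ile _ _ _ _ _ 1%N 1 _ _) (limf_chi_seq_lt _ _ _ r0 _).
have Imono n' m' X' Y' r r' : 0 < r <= r' -> (@I n' m' X' Y' r <= @I n' m' X' Y' r')%E.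
  move=> rr; apply: le_ereal_inf_tmp => _ [[M e] /= [M0 e0] <-]; apply: (le_trans (Ile _ _ _ _ _ M e M0 e0)).
  apply: limf_esup_le; apply: filterS (F_gt 0) => d d0; exact: chi_seq_mono.
have ID r : 0 < r -> I _ _ X Y r = (I _ _ (first_part hp X) (first_part hq Y) r + I _ _ (last_part hp X) (last_part hq Y) r)%E.
  move=> r0; apply/eqP; rewrite eq_le; apply/andP; split.
    apply: le_infD; [exact: Ioo|exact: Ioo|].
    move=> _ _ [[M e] /= [M0 e0] <-] [[M' e'] /= [M0' e0'] <-].
    have M0'' : (0 < maxn M M')%N by rewrite leq_max M0.
    have e0'' : 0 < Num.min e e' by rewrite lt_min e0.
    apply: (le_trans (Ile _ _ _ _ _ _ _ M0'' e0'')); apply: (le_trans (limf_chi_seq_sub r0 M0'' e0'')).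
    by apply: leeD; apply: limf_chi_seq_anti => //; rewrite ?leq_maxl ?leq_maxr ?e0'' ?ge_min ?lexx ?orbT.
  apply: le_ereal_inf_tmp => _ [[M e] /= [M0 e0] <-].
  have [k] := limf_chi_seq_super r0 M0 e0; apply: le_trans.
  by apply: leeD; apply: Ile => //; rewrite invr_gt0.
rewrite /chi_of; apply/eqP; rewrite eq_le; apply/andP; split.
  apply: ge_ereal_sup => _ [r /= r0 <-]; rewrite -/(I _ _ X Y r) ID //.
  by apply: leeD; apply: ereal_sup_ubound; exists r.
apply: ge_supD.
- by move=> _ [r /= r0 <-]; exact: Ioo.
- by move=> _ [r /= r0 <-]; exact: Ioo.
move=> _ _ [r /= r0 <-] [r' /= r0' <-].
have s0 : 0 < Num.max r r' by rewrite lt_max r0.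
apply: (@le_trans _ _ (I _ _ X Y (Num.max r r'))); last by apply: ereal_sup_ubound; exists (Num.max r r').
by rewrite ID //; apply: leeD; apply: Imono; rewrite ?r0 ?r0' le_max lexx ?orbT.
Qed.
End Additivity.

Lemma chi_ultraE (R : realType) (A : cstarAlg R) (phi : {scalar A}) n m (X : 'I_n -> A) (Y : 'I_m -> A)
    (w : set_system nat) : UltraFilter w ->
  chi_ultra phi X Y w = chi_of phi X Y (fun v => limf_esup v w).
Proof.
move=> UW; rewrite /chi_ultra; congr chi_of; apply/funext => v.
by rewrite (cvg_limf_esup (@ultra_cvg_ereal _ _ _ v)).
Qed.

Theorem theorem4p6 (R : realType) (A : cstarAlg R) (phi : {scalar A})
    (n m : nat) (X : 'I_n -> A) (Y : 'I_m -> A)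
    (p q : nat) (hp : (p <= n)%N) (hq : (q <= m)%N)
    (hphi : is_state phi)
    (hXY : tracially_bipartite phi X Y)
    (hfree : bi_free phi
       (fun k : bool => if k then alg_gen (first_part hp X)
                        else alg_gen (last_part hp X))
       (fun k : bool => if k then alg_gen (first_part hq Y)
                        else alg_gen (last_part hq Y))) :
  (chi_limsup_is_lim phi (first_part hp X) (first_part hq Y) ->
   chi_limsup_is_lim phi (last_part hp X) (last_part hq Y) ->
   chi phi X Y = (chi phi (first_part hp X) (first_part hq Y) +
                  chi phi (last_part hp X) (last_part hq Y))%E) /\
  (forall w : set_system nat, UltraFilter w ->
     (forall k : nat, w <> principal_filter k) ->
   chi_ultra phi X Y w =
     (chi_ultra phi (first_part hp X) (first_part hq Y) w +
      chi_ultra phi (last_part hp X) (last_part hq Y) w)%E).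
Proof.
have hc := bi_free_cent hfree; split=> [c1 c2|w UW np].
  (* [limn_esup] is the upper limit along [\oo], so the general statement applies to [chi] by
     conversion. *)
  apply: (chi_of_limf_esupD hphi.2 hc) => // k; exact: nbhs_infty_gt.
rewrite !chi_ultraE; apply: (chi_of_limf_esupD hphi.2 hc) => [|r M e _ _ _|r M e _ _ _].
- exact: nonprincipal_gt.
- exact: ultra_cvg_ereal.
- exact: ultra_cvg_ereal.
Qed.
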